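(* There is a deterministic polynomial-time $4$-approximation algorithm for $2$-column-sparse packing integer programs (with multiplicity constraints). There is also a randomized polynomial-time $(6-\sqrt5)$-approximation algorithm for simple $2$-column-sparse packing integer programs with $d=\mathbf{1}$.
   Context: A packing integer program is $\{\max c\cdot x: Ax\le b,\ 0\le x\le d,\ x\text{ integral}\}$ with $A,b,c,d$ nonnegative rational (entries of $d$ may be $+\infty$, finite ones integral). It is $2$-column-sparse if each column of $A$ has at most 2 nonzero entries. Writing $A_j$ for the $j$th column and $\mathrm{supp}(A_j)=\{i: A_{ij}>0\}$, a 2-column-sparse PIP is non-simple if there exist distinct $j,j'$ with $\mathrm{supp}(A_j)=\mathrm{supp}(A_{j'})$ and $|\mathrm{supp}(A_j)|=2$; otherwise it is simple. An $\alpha$-approximation algorithm returns a feasible solution of value at least $1/\alpha$ times optimal (for the randomized algorithm, in expectation). *)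

(* Defs.v *)
From HB Require Import structures.
From mathcomp Require Import all_boot all_order all_algebra.

Set Implicit Arguments.
Unset Strict Implicit.
Unset Printing Implicit Defensive.

Import Order.TTheory GRing.Theory Num.Theory.
Local Open Scope ring_scope.

(* [pip_d P j = None] stands for the multiplicity bound d_j = +oo. *)
Record pip (m n : nat) := Pip {
  pip_A : 'M[rat]_(m, n);
  pip_b : 'cV[rat]_m;
  pip_c : 'rV[rat]_n;
  pip_d : 'I_n -> option nat;
  pip_A_ge0 : forall i j, 0 <= pip_A i j;
  pip_b_ge0 : forall i, 0 <= pip_b i 0;
  pip_c_ge0 : forall j, 0 <= pip_c 0 j
}.

Section Pip.
Variables (m n : nat) (P : pip m n).

Definition feasible (x : 'cV[int]_n) : Prop :=
  [/\ forall i, (pip_A P *m map_mx intr x) i 0 <= pip_b P i 0,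
      forall j, 0 <= x j 0 &
      forall j u, pip_d P j = Some u -> x j 0 <= u%:Z].

Definition objective (x : 'cV[int]_n) : rat := (pip_c P *m map_mx intr x) 0 0.

Definition optimal (x : 'cV[int]_n) : Prop :=
  feasible x /\ forall y, feasible y -> objective y <= objective x.

Definition supp (j : 'I_n) : {set 'I_m} := [set i | 0 < pip_A P i j].

Definition two_column_sparse : Prop :=
  forall j, (#|[set i | pip_A P i j != 0%R]| <= 2)%N.

Definition non_simple : Prop :=
  exists j j', [/\ j != j', supp j = supp j' & #|supp j| = 2%N].

Definition simple_pip : Prop := ~ non_simple.

Definition unit_multiplicity : Prop := forall j, pip_d P j = Some 1%N.

Definition encode_rat (q : rat) : seq nat := [:: `|numq q|%N; `|denq q|%N].

Definition encode_bound (u : option nat) : seq nat :=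
  if u is Some k then [:: 1%N; k] else [:: 0%N; 0%N].

(* Dimensions, then A in row-major order, then b, c and d; rationals are in
   lowest terms. *)
Definition encode : seq nat :=
  [:: m, n &
      flatten [seq encode_rat (pip_A P i j) | i <- enum 'I_m, j <- enum 'I_n] ++
      flatten [seq encode_rat (pip_b P i 0) | i <- enum 'I_m] ++
      flatten [seq encode_rat (pip_c P 0 j) | j <- enum 'I_n] ++
      flatten [seq encode_bound (pip_d P j) | j <- enum 'I_n]].

End Pip.

(* Model of computation: the random access machine with the logarithmic
   cost criterion (Aho, Hopcroft, Ullman), with structured control flow and a
   fair-coin instruction [Toss]; each instruction costs the bit lengths of the
   values and memory addresses that it handles. *)

(* Number of binary digits of k; 0 has one digit. *)
Definition bitlen (k : nat) : nat := (trunc_log 2 k).+1.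

Definition bitsize (s : seq nat) : nat := (\sum_(k <- s) bitlen k)%N.

Inductive arith := Add | Sub | Mul | Div.

Definition eval_arith (o : arith) : nat -> nat -> nat :=
  match o with Add => addn | Sub => subn | Mul => muln | Div => divn end.

(* Registers are addressed by literals only, so a program uses finitely many;
   the unbounded memory is addressed through registers by [Read] and [Write]. *)
Inductive cmd :=
| Const (r k : nat)
| Arith (o : arith) (r r1 r2 : nat)
| Read (r ra : nat)
| Write (ra r : nat)
| Toss (r : nat)
| Skip
| Seq (c1 c2 : cmd)
| If (r : nat) (c1 c2 : cmd)
| While (r : nat) (c : cmd).

(* [coins] are the outcomes of the tosses still to come. *)
Record state := State {
  reg : nat -> nat;
  ram : nat -> nat;
  coins : seq bool
}.

Definition upd (f : nat -> nat) (a v : nat) : nat -> nat :=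
  fun a' => if a' == a then v else f a'.

Definition set_reg (s : state) (r v : nat) : state :=
  State (upd (reg s) r v) (ram s) (coins s).

Definition set_ram (s : state) (a v : nat) : state :=
  State (reg s) (upd (ram s) a v) (coins s).

(* [exec c s k s']: from [s], [c] halts in [s'] at logarithmic cost [k]. *)
Inductive exec : cmd -> state -> nat -> state -> Prop :=
| ExecConst r v s :
    exec (Const r v) s (bitlen v) (set_reg s r v)
| ExecArith o r r1 r2 s :
    exec (Arith o r r1 r2) s (bitlen (reg s r1) + bitlen (reg s r2))%N
      (set_reg s r (eval_arith o (reg s r1) (reg s r2)))
| ExecRead r ra s :
    exec (Read r ra) s (bitlen (reg s ra) + bitlen (ram s (reg s ra)))%N
      (set_reg s r (ram s (reg s ra)))
| ExecWrite ra r s :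
    exec (Write ra r) s (bitlen (reg s ra) + bitlen (reg s r))%N
      (set_ram s (reg s ra) (reg s r))
| ExecToss r f g b t :
    exec (Toss r) (State f g (b :: t)) 1 (State (upd f r (nat_of_bool b)) g t)
| ExecSkip s :
    exec Skip s 1 s
| ExecSeq c1 c2 s1 s2 s3 k1 k2 :
    exec c1 s1 k1 s2 -> exec c2 s2 k2 s3 -> exec (Seq c1 c2) s1 (k1 + k2)%N s3
| ExecIfTrue r c1 c2 s s' k :
    reg s r != 0%N -> exec c1 s k s' ->
    exec (If r c1 c2) s (bitlen (reg s r) + k)%N s'
| ExecIfFalse r c1 c2 s s' k :
    reg s r = 0%N -> exec c2 s k s' ->
    exec (If r c1 c2) s (bitlen (reg s r) + k)%N s'
| ExecWhileTrue r c s1 s2 s3 k1 k2 :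
    reg s1 r != 0%N -> exec c s1 k1 s2 -> exec (While r c) s2 k2 s3 ->
    exec (While r c) s1 (bitlen (reg s1 r) + k1 + k2)%N s3
| ExecWhileFalse r c s :
    reg s r = 0%N ->
    exec (While r c) s (bitlen (reg s r)) s.

Definition init (input : seq nat) (t : seq bool) : state :=
  State (fun=> 0%N) (nth 0%N input) t.

Definition output (n : nat) (s : state) : 'cV[int]_n := \col_j (ram s j)%:Z.

Definition computes (n : nat) (c : cmd) (input : seq nat) (t : seq bool)
    (T : nat) (x : 'cV[int]_n) : Prop :=
  exists k s, [/\ exec c (init input t) k s, (k <= T)%N & output n s = x].

Lemma exec_det c s k1 s1 k2 s2 :
  exec c s k1 s1 -> exec c s k2 s2 -> k1 = k2 /\ s1 = s2.
Proof.
move=> e1; elim: e1 k2 s2 => {c s k1 s1}.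
- by move=> r v s k2 s2 e; inversion e; subst.
- by move=> o r r1 r2 s k2 s2 e; inversion e; subst.
- by move=> r ra s k2 s2 e; inversion e; subst.
- by move=> ra r s k2 s2 e; inversion e; subst.
- by move=> r f g b t k2 s2 e; inversion e; subst.
- by move=> s k2 s2 e; inversion e; subst.
- move=> c1 c2 s1 s2 s3 k1 k2 _ IH1 _ IH2 k s e; inversion e; subst.
  match goal with H : exec c1 _ _ _ |- _ => case: (IH1 _ _ H) => *; subst end.
  by match goal with H : exec c2 _ _ _ |- _ => case: (IH2 _ _ H) => -> -> end.
- move=> r c1 c2 s s' k rn0 _ IH k2 s2 e; inversion e; subst.
    by match goal with H : exec c1 _ _ _ |- _ => case: (IH _ _ H) => -> -> end.
  by match goal with H : reg s r = 0%N |- _ => rewrite H in rn0 end.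
- move=> r c1 c2 s s' k r0 _ IH k2 s2 e; inversion e; subst.
    by match goal with H : is_true (reg s r != _) |- _ => rewrite r0 in H end.
  by match goal with H : exec c2 _ _ _ |- _ => case: (IH _ _ H) => -> -> end.
- move=> r c s1 s2 s3 k1 k2 rn0 _ IH1 _ IH2 k s e; inversion e; subst.
    match goal with H : exec c _ _ _ |- _ => case: (IH1 _ _ H) => *; subst end.
    by match goal with
       | H : exec (While r c) _ _ _ |- _ => case: (IH2 _ _ H) => -> ->
       end.
  by match goal with H : reg _ r = 0%N |- _ => rewrite H in rn0 end.
- move=> r c s r0 k2 s2 e; inversion e; subst => //.
  by match goal with H : is_true (reg s r != _) |- _ => rewrite r0 in H end.
Qed.

Definition pip_class := forall m n : nat, pip m n -> Prop.

(* The tape of coins is empty: a [Toss] would block the execution.  The ratio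
   is required of the instances that have an optimal solution; the others (a
   null column with d_j = +oo and c_j > 0) are unbounded, and on them the
   algorithm has only to return a feasible solution in time. *)
Definition det_poly_approx (R : rcfType) (alpha : R) (K : pip_class) : Prop :=
  exists (c : cmd) (p : {poly nat}),
    forall (m n : nat) (P : pip m n), K m n P ->
    exists x : 'cV[int]_n,
      [/\ computes c (encode P) [::] p.[bitsize (encode P)] x,
          feasible P x &
          forall y, optimal P y ->
            alpha^-1 * ratr (objective P y) <= ratr (objective P x)].

(* The time bound holds for all outcomes of the tosses, so T coins are enough
   for time T, and the expectation is the mean over the T-bit tapes. *)
Definition rand_poly_approx (R : rcfType) (alpha : R) (K : pip_class) : Prop :=
  exists (c : cmd) (p : {poly nat}),
    forall (m n : nat) (P : pip m n), K m n P ->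
    let T := p.[bitsize (encode P)] in
    exists x : T.-tuple bool -> 'cV[int]_n,
      [/\ forall t : T.-tuple bool, computes c (encode P) t T (x t),
          forall t, feasible P (x t) &
          forall y, optimal P y ->
            alpha^-1 * ratr (objective P y) <=
              (2 ^+ T)^-1 * \sum_(t : T.-tuple bool) ratr (objective P (x t))].

(* Main.v *)
Require Import Defs.
From mathcomp Require Import all_boot all_order all_algebra.
From mathcomp Require Import zify ring lra.

Set Implicit Arguments.
Unset Strict Implicit.
Unset Printing Implicit Defensive.

Import Order.TTheory GRing.Theory Num.Theory.

(** A single deterministic algorithm of ratio 15/4 serves both claims, because
    15/4 <= 6 - sqrt 5 < 4.

    After clearing denominators, a variable bounded by [U] is split in binary into
    at most [log U + 1] items to be taken 0 or 1 times; the item [e] has size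
    [sz i e] in the at most two rows [i] that it meets.  The items are packed by the
    local ratio technique: picking [e] of weight [w e] decreases the weight of each
    other item [f] by [w e] times the sum over the rows [i] of [e] of
    [min (sz i f) d / d], where [d = b i - sz i e].  When the recursive solution
    leaves no room for [e], it already has charge at least 1, so the ratio is the
    largest charge of a fractional solution, and it is enough to find a fractional
    solution of nearly maximal weight with charge at most 3.  For a vertex of the
    relaxation, the number of fractional items is at most the number of rows they
    meet, hence by counting some item meets only rows with few fractional items, and
    has charge at most 3.

    Vertices are not computed.  For each candidate [e], the packing linear program
    with the additional constraint that the charge of [e] is at most 3 is solved
    approximately by a greedy method with quadratic potential, and the candidate of
    largest value is picked.  It loses a factor [1 - 1 / (5 n)], for a total of at
    least 4/5 over the at most [n] rounds, and 3 / (4/5) = 15/4. *)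

Local Open Scope ring_scope.

(** * Local ratio for items with at most two rows *)

Section Charge.
Variables (F : realFieldType) (I K : finType) (sz : I -> K -> nat) (b : I -> nat).
Implicit Types (i : I) (e f k : K) (x : K -> F) (R S : {set K}).

Definition rows k : {set I} := [set i | sz i k != 0%N].

Definition fits k : Prop := forall i, (sz i k <= b i)%N.

Definition load i x : F := \sum_k (sz i k)%:R * x k.

Record fractional R x : Prop := Fractional {
  fractional_ge0 : forall k, 0 <= x k;
  fractional_le1 : forall k, x k <= 1;
  fractional_supp : forall k, k \notin R -> x k = 0;
  fractional_load : forall i, load i x <= (b i)%:R
}.

(* The maximum with 1 only keeps the denominators of the shares positive. *)
Definition slack i e : nat := maxn 1 (b i - sz i e).

Definition share i e f : F := (minn (sz i f) (slack i e))%:R / (slack i e)%:R.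

Definition row_charge i e x : F := \sum_(f | f != e) share i e f * x f.

Definition charge e x : F := x e + \sum_(i in rows e) row_charge i e x.

Lemma slack_gt0 i e : (0 < slack i e)%N.
Proof. by rewrite leq_max. Qed.

Lemma slackE i e : (sz i e < b i)%N -> slack i e = (b i - sz i e)%N.
Proof. by rewrite /slack; lia. Qed.

Let slack_pos i e : 0 < (slack i e)%:R :> F.
Proof. by rewrite ltr0n slack_gt0. Qed.

Lemma share_ge0 i e f : 0 <= share i e f.
Proof. by rewrite divr_ge0 ?ler0n. Qed.

Lemma share_le1 i e f : share i e f <= 1.
Proof. by rewrite ler_pdivrMr // mul1r ler_nat geq_minr. Qed.

Lemma share_le_size i e f : share i e f <= (sz i f)%:R / (slack i e)%:R.
Proof. by rewrite ler_pM2r ?invr_gt0 // ler_nat geq_minl. Qed.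

Lemma share_eq0 i e f : sz i f = 0%N -> share i e f = 0.
Proof. by rewrite /share => ->; rewrite min0n mul0r. Qed.

Section Bounds.
Variables (R : {set K}) (x : K -> F).
Hypothesis x_frac : fractional R x.

Let x_ge0 k : 0 <= x k := fractional_ge0 x_frac k.
Let x_le1 k : x k <= 1 := fractional_le1 x_frac k.

Lemma load_others i e :
  \sum_(f | f != e) (sz i f)%:R * x f <= (b i)%:R - (sz i e)%:R * x e.
Proof. by have := fractional_load x_frac i; rewrite /load (bigD1 e) //=; lra. Qed.

Lemma row_charge_le i e :
  row_charge i e x <= ((b i)%:R - (sz i e)%:R * x e) / (slack i e)%:R.
Proof.
apply: le_trans (_ : (\sum_(f | f != e) (sz i f)%:R * x f) / (slack i e)%:R <= _).
  rewrite mulr_suml; apply: ler_sum => f _.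
  by rewrite [leRHS]mulrAC; apply: ler_wpM2r; [exact: x_ge0 | exact: share_le_size].
by rewrite ler_pM2r ?invr_gt0 // load_others.
Qed.

Lemma row_charge_integral i e : fits e -> x e = 1 -> row_charge i e x <= 1.
Proof.
move=> e_fits xe; apply: le_trans (row_charge_le _ _) _.
by rewrite xe mulr1 ler_pdivrMr // mul1r -natrB // ler_nat leq_maxr.
Qed.

Lemma charge_integral e : fits e -> x e = 1 -> charge e x <= 1 + #|rows e|%:R.
Proof.
move=> e_fits xe; rewrite /charge xe lerD2l -sumr_const; apply: ler_sum => i _.
exact: row_charge_integral.
Qed.

Lemma row_charge_narrow i e : (0 < sz i e)%N -> (2 * sz i e <= b i)%N ->
  x e + row_charge i e x <= 2.
Proof.
move=> e_pos narrow; have := row_charge_le i e.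
rewrite slackE; last by lia.
rewrite natrB; last by lia.
set a := (sz i e)%:R; set c := (b i)%:R => charge_le.
have a_gt0 : 0 < a by rewrite ltr0n.
have a_le : 2 * a <= c by rewrite -natrM ler_nat.
have ca_gt0 : 0 < c - a by lra.
apply: le_trans (lerD (lexx _) charge_le) _.
rewrite -(@ler_pM2r _ (c - a)) // mulrDl divfK ?gt_eqF //.
by have := x_le1 e; nra.
Qed.

(* For [f] of smaller size than [e], the surplus [2 * sz i e - b i] makes up for
   the difference between [sz i f] and the part of [sz i e] that [f] blocks. *)
Lemma share_wide i e f (small : bool) : fits e -> (b i < 2 * sz i e)%N ->
    (~~ small -> sz i f = 0%N \/ (sz i e <= sz i f)%N) ->
  (sz i e)%:R * share i e f <=
    (sz i f)%:R + (2 * (sz i e)%:R - (b i)%:R) * small%:R.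
Proof.
move=> /(_ i) e_fits wide f_size.
set a := (sz i e)%:R; set c := (b i)%:R.
have a_gt0 : 0 < a by rewrite ltr0n; lia.
have a_le : a <= c by rewrite ler_nat.
have c_le : c <= 2 * a by rewrite -natrM ler_nat ltnW.
have le1 := share_le1 i e f; have ge0 := share_ge0 i e f.
have [f_eq0|f_neq0] := eqVneq (sz i f) 0%N.
  by rewrite share_eq0 // mulr0 addr_ge0 ?mulr_ge0 ?ler0n // subr_ge0.
case: small f_size => [_|/(_ isT)[/eqP|e_le_f]]; rewrite ?(negbTE f_neq0) ?mulr1 //; last first.
  have : a <= (sz i f)%:R by rewrite ler_nat.
  by rewrite mulr0; nra.
have [f_le|f_gt] := leqP (sz i f) (b i - sz i e).
  have f_gt0 : 0 < (sz i f)%:R :> F by rewrite ltr0n lt0n.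
  have := share_le_size i e f; rewrite slackE; last by lia.
  rewrite natrB // -/a -/c => share_le.
  have {}f_le : (sz i f)%:R <= c - a by rewrite -natrB // ler_nat.
  apply: le_trans (_ : a * ((sz i f)%:R / (c - a)) <= _); first by rewrite ler_pM2l.
  rewrite mulrA ler_pdivrMr; last by lra.
  by nra.
have : c - a <= (sz i f)%:R by rewrite -natrB // ler_nat ltnW.
by nra.
Qed.

Lemma row_charge_wide i e S : fits e -> (b i < 2 * sz i e)%N -> (#|S| <= 2)%N ->
    (forall f, x f != 0 -> sz i f != 0%N -> f \notin S -> (sz i e <= sz i f)%N) ->
  x e + row_charge i e x <= 3.
Proof.
move=> e_fits wide S_le2 S_small.
set a := (sz i e)%:R : F; set c := (b i)%:R : F.
have a_gt0 : 0 < a by rewrite ltr0n; lia.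
have a_le : a <= c by rewrite ler_nat.
have c_le : c <= 2 * a by rewrite -natrM ler_nat ltnW.
have S_mass : \sum_(f | f != e) (f \in S)%:R * x f <= 2.
  apply: le_trans (_ : \sum_(f in S) 1 <= _); last by rewrite sumr_const ler_nat.
  rewrite big_mkcond [leRHS]big_mkcond; apply: ler_sum => f _.
  by case: (f != e); case: (f \in S); rewrite ?mul1r ?mul0r ?x_le1.
have blocked : a * row_charge i e x <= (c - a * x e) + (2 * a - c) * 2.
  apply: le_trans (_ : \sum_(f | f != e) ((sz i f)%:R * x f +
      (2 * a - c) * ((f \in S)%:R * x f)) <= _).
    rewrite mulr_sumr; apply: ler_sum => f _; rewrite mulrA [X in _ + X]mulrA -mulrDl.
    have [->|xf] := eqVneq (x f) 0; first by rewrite !mulr0.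
    apply: ler_wpM2r => //; apply: share_wide => // fS.
    by have [|f_neq0] := eqVneq (sz i f) 0%N; [left | right; exact: S_small].
  rewrite big_split /= -mulr_sumr; apply: lerD; first exact: load_others.
  by apply: ler_wpM2l => //; lra.
by rewrite -(@ler_pM2l _ a) // mulrDr; lra.
Qed.

(** ** A cheap item of a vertex *)

Definition degree S i : nat := #|[set k in S | i \in rows k]|.

Definition row_cover S : {set I} := \bigcup_(k in S) rows k.

Lemma sum_degree S :
  (\sum_(i in row_cover S) degree S i = \sum_(k in S) #|rows k|)%N.
Proof.
under eq_bigr do rewrite /degree -sum1_card.
under [RHS]eq_bigr do rewrite -sum1_card.
rewrite (exchange_big_dep (mem S)) /=; last by move=> i k _; rewrite inE => /andP[].
apply: eq_bigr => k kS; apply: eq_bigl => i; rewrite inE kS /=.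
by rewrite andb_idl // => ki; apply/bigcupP; exists k.
Qed.

(* A graph with at most as many edges as vertices and all degrees at least 2 is
   a union of cycles. *)
Lemma degree_eq2 S : (forall k, k \in S -> #|rows k| = 2%N) ->
    (#|S| <= #|row_cover S|)%N ->
    (forall i, i \in row_cover S -> (2 <= degree S i)%N) ->
  forall i, i \in row_cover S -> degree S i = 2%N.
Proof.
move=> S_edges few_edges deg_ge2 i iS.
have := sum_degree S; rewrite (bigD1 i) //= [RHS](eq_bigr (fun=> 2%N)) //.
rewrite sum_nat_const => sumE.
have : (2 * (#|row_cover S| - 1) <= \sum_(j in row_cover S | j != i) degree S j)%N.
  rewrite mulnC (cardsD1 i) iS add1n subn1 -sum_nat_const.
  rewrite (eq_bigl (fun j => (j \in row_cover S) && (j != i))); last first.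
    by move=> j; rewrite in_setD1 andbC.
  by apply: leq_sum => j /andP[/deg_ge2].
by have := deg_ge2 i iS; have := subset_leq_card (subsetT (row_cover S)); lia.
Qed.

Section Support.
Variable S : {set K}.
Hypothesis suppE : forall k, (k \in S) = (x k != 0).

Lemma row_charge_degree i e : e \in S -> i \in rows e ->
  row_charge i e x <= (degree S i).-1%:R.
Proof.
move=> eS ie; rewrite /degree (cardsD1 e) inE eS ie -sumr_const /row_charge.
rewrite big_mkcond [leRHS]big_mkcond; apply: ler_sum => f _.
rewrite !inE suppE; case: (f != e) => //=.
have [->|xf] := eqVneq (x f) 0; first by rewrite mulr0.
have [f_eq0|_] := eqVneq (sz i f) 0%N; first by rewrite share_eq0 // mul0r.
by apply: mulr_ile1; rewrite ?share_ge0 ?share_le1.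
Qed.

Definition hubs k : {set I} := [set i in rows k | (1 < degree S i)%N].

Definition core : {set K} := [set k in S | (1 < #|hubs k|)%N].

Lemma hubs_sub k : hubs k \subset rows k.
Proof. by apply/subsetP => i; rewrite inE => /andP[]. Qed.

Lemma core_sub : core \subset S.
Proof. by apply/subsetP => k; rewrite inE => /andP[]. Qed.

Lemma charge_hubs e : e \in S -> charge e x <= x e + \sum_(i in hubs e) row_charge i e x.
Proof.
move=> eS; rewrite /charge lerD2l (bigID (mem (hubs e))) /= -[leRHS]addr0; apply: lerD.
  rewrite le_eqVlt (eq_bigl (mem (hubs e))) ?eqxx // => i.
  by rewrite /= andb_idl // => /(subsetP (hubs_sub e)).
apply: sumr_le0 => i /andP[ie]; rewrite inE ie /= -leqNgt => deg_le1.
apply: le_trans (row_charge_degree eS ie) _.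
by case: (degree S i) deg_le1 => [|[]].
Qed.

Hypothesis S_fits : forall k, k \in S -> fits k.
Hypothesis S_sparse : forall k, k \in S -> (#|rows k| <= 2)%N.

Lemma core_rows k : k \in core -> hubs k = rows k /\ #|rows k| = 2%N.
Proof.
rewrite inE => /andP[/S_sparse rows_le2 hubs_gt1].
have := subset_leq_card (hubs_sub k) => hubs_le.
have rows_eq2 : #|rows k| = 2%N by lia.
by split=> //; apply/eqP; rewrite eqEcard hubs_sub; lia.
Qed.

(* The smallest item with the single hub [u] is cheap, because at most the two
   items of the core at [u] can be smaller. *)
Lemma cheap_leaf k u : k \in S -> k \notin core -> u \in hubs k ->
  (degree core u <= 2)%N -> exists2 e, e \in S & charge e x <= 3.
Proof.
move=> kS k_core uk core_deg.
pose leaf k := [&& k \in S, k \notin core & u \in hubs k].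
have leaf_k : leaf k by apply/and3P.
have [e /and3P[eS e_core ue] e_min] := arg_minnP (sz u) leaf_k.
have hubs_e : hubs e = [set u].
  apply/esym/eqP; rewrite eqEcard sub1set ue cards1.
  by move: e_core; rewrite inE eS /= -leqNgt.
exists e => //; apply: le_trans (charge_hubs eS) _; rewrite hubs_e big_set1.
have u_rows : sz u e != 0%N by have := subsetP (hubs_sub e) _ ue; rewrite inE.
have [narrow|wide] := leqP (2 * sz u e) (b u).
  by apply: le_trans (row_charge_narrow _ narrow) _; rewrite ?lt0n // ler_nat.
apply: (row_charge_wide (S_fits eS) wide core_deg) => f xf uf f_core.
have {}fS : f \in S by rewrite suppE.
have uf' : u \in rows f by rewrite inE.
apply: e_min; rewrite /leaf fS /=; apply/andP; split.
  by apply: contra f_core => fC; rewrite inE fC.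
by rewrite inE uf'; move: ue; rewrite inE => /andP[].
Qed.

Lemma core_degree_ge2 i :
    (forall k u, k \in S -> k \notin core -> u \in hubs k -> (2 < degree core u)%N) ->
  i \in row_cover core -> (2 <= degree core i)%N.
Proof.
move=> leaf_degree /bigcupP[k kC ik]; have [hubsE _] := core_rows kC.
have [/existsP[f /and3P[fS fC fi]]|/existsPn no_leaf] :=
  boolP [exists f, [&& f \in S, f \notin core & i \in hubs f]].
  exact: ltnW (leaf_degree f i fS fC fi).
have deg_gt1 : (1 < degree S i)%N by move: ik; rewrite -hubsE inE => /andP[].
apply: (leq_trans deg_gt1); apply: subset_leq_card; apply/subsetP => f.
case/setIdP=> fS fi; apply/setIdP; split=> //.
have := no_leaf f; rewrite fS /=; apply: contraNT => fC; rewrite fC /=.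
exact/setIdP.
Qed.

Lemma cheap_item_of_hall : S != set0 ->
    (forall Q : {set K}, Q \subset S -> (#|Q| <= #|row_cover Q|)%N) ->
  exists2 e, e \in S & charge e x <= 3.
Proof.
move=> S_neq0 hall.
have [/existsP[k /existsP[u /and4P[kS kC uk deg_le2]]]|no_leaf] := boolP
  [exists k, exists u, [&& k \in S, k \notin core, u \in hubs k & (degree core u <= 2)%N]].
  exact: cheap_leaf kS kC uk deg_le2.
have leaf_degree k u : k \in S -> k \notin core -> u \in hubs k -> (2 < degree core u)%N.
  move=> kS kC uk; rewrite ltnNge; apply: contra no_leaf => deg_le2.
  by apply/existsP; exists k; apply/existsP; exists u; rewrite kS kC uk.
have core_deg2 := degree_eq2 (fun k kC => (core_rows kC).2) (hall _ core_sub)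
  (fun i => core_degree_ge2 leaf_degree).
have [/existsP[k /andP[kS /eqP no_hub]]|/existsPn has_hub] :=
  boolP [exists k, (k \in S) && (hubs k == set0)].
  exists k => //; apply: le_trans (charge_hubs kS) _.
  by rewrite no_hub big_set0; have := x_le1 k; lra.
have coreE : core = S.
  apply/eqP; rewrite eqEsubset core_sub; apply/subsetP => k kS; apply/negPn/negP => kC.
  have /set0Pn[u uk] : hubs k != set0 by have := has_hub k; rewrite kS.
  have u_deg := leaf_degree k u kS kC uk.
  suff /core_deg2 : u \in row_cover core by lia.
  have /card_gt0P[f] : (0 < degree core u)%N by lia.
  by rewrite inE => /andP[fC uf]; apply/bigcupP; exists f.
have [e eS] := set0Pn _ S_neq0; exists e => //.
have : \sum_(i in rows e) row_charge i e x <= #|rows e|%:R.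
  rewrite -sumr_const; apply: ler_sum => i ie.
  apply: le_trans (row_charge_degree eS ie) _.
  by rewrite -coreE core_deg2 //; apply/bigcupP; exists e; rewrite ?coreE.
have : #|rows e|%:R <= 2 :> F by rewrite ler_nat S_sparse.
by rewrite /charge; have := x_le1 e; lra.
Qed.
End Support.
End Bounds.
End Charge.

Lemma box_exit (F : realFieldType) (K : finType) (z d : K -> F) :
    (forall k, 0 <= z k <= 1) -> (exists k, d k != 0) ->
  exists theta k, [/\ 0 <= theta, forall f, 0 <= z f + theta * d f <= 1, d k != 0 &
    z k + theta * d k = 0 \/ z k + theta * d k = 1].
Proof.
move=> z01 [k0 dk0].
pose exit_time k := if 0 < d k then (1 - z k) / d k else z k / - d k.
have exit_ge0 k : 0 <= exit_time k.
  have /andP[z0 z1] := z01 k; rewrite /exit_time; case: ltrP => dk.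
    by rewrite divr_ge0 ?(ltW dk) // subr_ge0.
  by rewrite divr_ge0 // oppr_ge0.
have [k dk k_min] := arg_minP (P := fun k => d k != 0) exit_time dk0.
exists (exit_time k), k; split=> //.
  move=> f; have /andP[z0 z1] := z01 f.
  have [->|df] := eqVneq (d f) 0; first by rewrite mulr0 addr0 z0.
  have := k_min f df; rewrite {2}/exit_time; set theta := exit_time k.
  have theta_ge0 : 0 <= theta by exact: exit_ge0.
  case: ltrP => df0.
    rewrite ler_pdivlMr // => theta_le; have : 0 <= theta * d f by rewrite mulr_ge0 // ltW.
    by move=> td0; apply/andP; split; lra.
  have {}df0 : d f < 0 by rewrite lt_neqAle df.
  rewrite ler_pdivlMr ?oppr_gt0 // mulrN => theta_le.
  have : theta * d f <= 0 by rewrite mulr_ge0_le0 // ltW.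
  by move=> td0; apply/andP; split; lra.
rewrite /exit_time; case: ltrP => dk0'.
  by right; rewrite divfK // addrC subrK.
by left; rewrite invrN mulrN mulNr divfK // subrr.
Qed.

Section Vertex.
Variables (F : realFieldType) (I K : finType) (sz : I -> K -> nat) (b : I -> nat).
Implicit Types (e k : K) (z : K -> F) (R Q : {set K}).

Lemma exists_null_direction Q : (#|row_cover sz Q| < #|Q|)%N ->
  exists d : K -> F, [/\ exists k, d k != 0, forall k, k \notin Q -> d k = 0 &
    forall i, load sz i d = 0].
Proof.
set V := row_cover sz Q => V_small.
pose B : 'M[F]_(#|Q|, #|V|) := \matrix_(a, c) (sz (enum_val c) (enum_val a))%:R.
have : ~~ row_free B.
  by rewrite /row_free; have := rank_leq_col B; apply: contraL => /eqP ->; rewrite -ltnNge.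
rewrite -kermx_eq0 => /rowV0Pn[u /sub_kermxP uB u_neq0].
pose d k := \sum_(a < #|Q| | enum_val a == k) u 0 a.
have d_val a : d (enum_val a) = u 0 a.
  by rewrite /d (big_pred1 a) // => a'; rewrite /= (inj_eq enum_val_inj).
have d_out k : k \notin Q -> d k = 0.
  by move=> kQ; rewrite /d big1 // => a /eqP ak; rewrite -ak enum_valP in kQ.
exists d; split => //.
  by have /rV0Pn[a ua] := u_neq0; exists (enum_val a); rewrite d_val.
move=> i; rewrite /load (bigID (mem Q)) /= [X in _ + X]big1 ?addr0; last first.
  by move=> k /d_out ->; rewrite mulr0.
rewrite big_enum_val /=; under eq_bigr do rewrite d_val.
have [iV|iV] := boolP (i \in V).
  have /matrixP/(_ 0 (enum_rank_in iV i)) := uB; rewrite !mxE => rowE; rewrite -[RHS]rowE.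
  by apply: eq_bigr => a _; rewrite !mxE enum_rankK_in // mulrC.
rewrite big1 // => a _; suff -> : sz i (enum_val a) = 0%N by rewrite mul0r.
apply/eqP; apply: contraNT iV => sz_neq0.
by apply/bigcupP; exists (enum_val a); rewrite ?enum_valP // inE.
Qed.

Lemma loadD i z d (theta : F) :
  load sz i (fun k => z k + theta * d k) = load sz i z + theta * load sz i d.
Proof.
rewrite /load; under eq_bigr do rewrite mulrDr mulrCA.
by rewrite big_split /= -mulr_sumr.
Qed.

Lemma exists_improving_direction Q (w : K -> F) : (#|row_cover sz Q| < #|Q|)%N ->
  exists d : K -> F, [/\ exists k, d k != 0, forall k, k \notin Q -> d k = 0,
    forall i, load sz i d = 0 & 0 <= \sum_k w k * d k].
Proof.
case/exists_null_direction => d [[k dk] dQ d_load].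
have [wd|wd] := lerP 0 (\sum_k w k * d k); first by exists d; split=> //; exists k.
exists (fun f => - d f); split.
- by exists k; rewrite oppr_eq0.
- by move=> f /dQ ->; rewrite oppr0.
- move=> i; rewrite /load; under eq_bigr do rewrite mulrN.
  by rewrite sumrN -/(load sz i d) d_load oppr0.
- by under eq_bigr do rewrite mulrN; rewrite sumrN oppr_ge0 ltW.
Qed.

Lemma exists_fuller_packing R z (w : K -> F) : fractional sz b R z ->
    (exists2 Q : {set K}, Q \subset [set k | z k != 0] & (#|row_cover sz Q| < #|Q|)%N) ->
  exists z', [/\ fractional sz b R z', \sum_k w k * z k <= \sum_k w k * z' k,
    {subset [pred k | z' k != 0] <= [pred k | z k != 0]} &
    exists2 k, z k != 0 & z' k = 0 \/ z' k = 1].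
Proof.
move=> zR [Q QS /exists_improving_direction - /(_ w)[d [d_neq0 dQ d_load wd]]].
have d_supp k : d k != 0 -> z k != 0.
  by move=> dk; have := subsetP QS k; rewrite inE; apply; apply: contraNT dk => /dQ ->.
have z01 k : 0 <= z k <= 1 by rewrite (fractional_ge0 zR) (fractional_le1 zR).
have [theta [k [theta_ge0 z'01 dk z'k]]] := box_exit z01 d_neq0.
have supp k' : z k' = 0 -> z k' + theta * d k' = 0.
  move=> zk'; rewrite zk' add0r; have [->|/d_supp] := eqVneq (d k') 0; first by rewrite mulr0.
  by rewrite zk' eqxx.
exists (fun f => z f + theta * d f); split.
- split=> [f|f|f fR|i]; [by case/andP: (z'01 f) | by case/andP: (z'01 f) | |].
    by apply: supp; apply: (fractional_supp zR).
  by rewrite loadD d_load mulr0 addr0; apply: (fractional_load zR).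
- under [leRHS]eq_bigr do rewrite mulrDr mulrCA.
  by rewrite big_split /= -mulr_sumr lerDl mulr_ge0.
- by move=> f; rewrite !inE; apply: contra_neq => /supp.
- by exists k => //; apply: d_supp.
Qed.

(* If no set of items outnumbers the rows that it meets, the items satisfy the
   condition of Hall; otherwise one more coordinate can be made integral. *)
Lemma exists_cheap_item R (w : K -> F) z : fractional sz b R z -> R != set0 ->
    (forall k, k \in R -> fits sz b k) -> (forall k, k \in R -> (#|rows sz k| <= 2)%N) ->
  exists e z', [/\ e \in R, fractional sz b R z', \sum_k w k * z k <= \sum_k w k * z' k &
    charge sz b e z' <= 3].
Proof.
move=> zR R_neq0 R_fits R_sparse; have [n] := ubnP #|[set k | z k != 0]|.
elim: n z zR => // n IH z zR; set S := [set k | z k != 0]; rewrite ltnS => S_le.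
have SR k : k \in S -> k \in R.
  by rewrite inE; apply: contraR => /(fractional_supp zR) ->.
have [S0|S_neq0] := eqVneq S set0.
  have /set0Pn[e eR] := R_neq0; exists e, z; split=> //.
  have z0 k : z k = 0.
    by apply/eqP/negPn/negP => zk; have := in_set0 k; rewrite -S0 inE zk.
  rewrite /charge z0 big1 ?addr0 ?ler0n // => i _.
  by rewrite /row_charge big1 // => f _; rewrite z0 mulr0.
have [/forallP hall|] :=
  boolP [forall Q : {set K}, (Q \subset S) ==> (#|Q| <= #|row_cover sz Q|)%N].
  have suppE k : (k \in S) = (z k != 0) by rewrite inE.
  have [|||e eS e_cheap] := cheap_item_of_hall zR suppE _ _ S_neq0.
  - by move=> k /SR; apply: R_fits.
  - by move=> k /SR; apply: R_sparse.
  - by move=> Q; apply/implyP.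
  - by exists e, z; split=> //; apply: SR.
rewrite negb_forall => /existsP[Q]; rewrite negb_imply -ltnNge => /andP[QS Q_many].
have [z' [z'R wz' z'_sub [k zk z'k]]] :=
  exists_fuller_packing w zR (ex_intro2 _ _ Q QS Q_many).
have kR : k \in R by apply: SR; rewrite inE.
case: z'k => z'k; last first.
  exists k, z'; split=> //; apply: le_trans (charge_integral z'R (R_fits k kR) z'k) _.
  by rewrite -[3]/(1 + 2) lerD2l ler_nat R_sparse.
have [|e [z'' [eR z''R wz'' e_cheap]]] := IH z' z'R.
  apply: leq_trans S_le; apply: proper_card; apply/properP; split.
    by apply/subsetP => f; rewrite !inE; apply: z'_sub.
  by exists k; rewrite inE // z'k eqxx.
by exists e, z''; split=> //; apply: le_trans wz' wz''.
Qed.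
End Vertex.

(** ** The local ratio algorithm *)

Section LocalRatio.
Variables (F : realFieldType) (I K : finType) (sz : I -> K -> nat) (b : I -> nat).
Implicit Types (i : I) (e f k : K) (x z : K -> F) (w : {ffun K -> nat}) (R S : {set K}).

Definition slack_prod e : nat := (\prod_(i in rows sz e) slack sz b i e)%N.

(* The charges are multiplied by [slack_prod e] so that the weights stay integral. *)
Definition charge_coef e f : nat :=
  if f == e then slack_prod e
  else (\sum_(i in rows sz e) slack_prod e %/ slack sz b i e * minn (sz i f) (slack sz b i e))%N.

Lemma slack_prod_gt0 e : (0 < slack_prod e)%N.
Proof. by apply: prodn_gt0 => i; apply: slack_gt0. Qed.

Lemma slack_dvd_prod i e : i \in rows sz e -> (slack sz b i e %| slack_prod e)%N.
Proof. by move=> ie; rewrite /slack_prod (bigD1 i) //= dvdn_mulr. Qed.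

Lemma charge_coef_share e f : f != e ->
  (charge_coef e f)%:R = (slack_prod e)%:R * \sum_(i in rows sz e) share F sz b i e f.
Proof.
move=> /negbTE fe; rewrite /charge_coef fe natr_sum mulr_sumr; apply: eq_bigr => i ie.
rewrite natrM /share mulrA mulrAC; congr (_ * _).
by rewrite -[in RHS](divnK (slack_dvd_prod ie)) natrM mulfK // pnatr_eq0 -lt0n slack_gt0.
Qed.

Lemma scaled_charge e x :
  (slack_prod e)%:R * charge sz b e x = \sum_f (charge_coef e f)%:R * x f.
Proof.
rewrite [RHS](bigD1 e) //= {1}/charge_coef eqxx /charge mulrDr; congr (_ + _).
under [RHS]eq_bigr => f fe do rewrite charge_coef_share // -mulrA mulr_suml.
by rewrite -mulr_sumr [in RHS]exchange_big.
Qed.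

Definition active w : {set K} := [set k | w k != 0%N].

Definition weight w S : nat := (\sum_(k in S) w k)%N.

Definition size_in i S : nat := (\sum_(k in S) sz i k)%N.

Definition local_step e w : {ffun K -> nat} :=
  [ffun f => (slack_prod e * w f - w e * charge_coef e f)%N].

Definition insert e S : {set K} :=
  if [forall i, (size_in i S + sz i e <= b i)%N] then e |: S else S.

Lemma local_step_le e w f : (local_step e w f <= slack_prod e * w f)%N.
Proof. by rewrite ffunE leq_subr. Qed.

Lemma active_local_step e w : active (local_step e w) \subset active w :\ e.
Proof.
apply/subsetP => f; rewrite !inE ffunE; apply: contraR.
rewrite negb_and !negbK => /orP[] /eqP ->; last by rewrite muln0.
by rewrite /charge_coef eqxx mulnC subnn.
Qed.

Lemma card_active_local_step e w : e \in active w ->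
  (#|active (local_step e w)| < #|active w|)%N.
Proof.
by move=> ea; rewrite (cardsD1 e (active w)) ea add1n ltnS subset_leq_card ?active_local_step.
Qed.

Lemma blocked_charge e S i : fits sz b e -> e \notin S -> (size_in i S <= b i)%N ->
    (b i < size_in i S + sz i e)%N ->
  (slack_prod e <= \sum_(f in S) charge_coef e f)%N.
Proof.
move=> /(_ i) e_fits eS S_fits blocked.
have ie : i \in rows sz e by rewrite inE; lia.
apply: leq_trans (_ : \sum_(f in S) slack_prod e %/ slack sz b i e *
    minn (sz i f) (slack sz b i e) <= _)%N; last first.
  apply: leq_sum => f fS; rewrite /charge_coef ifN; last by apply: contraNneq eS => <-.
  by rewrite [leqRHS](bigD1 i) //= leq_addr.
rewrite -big_distrr /= -[leqLHS](divnK (slack_dvd_prod ie)) leq_mul2l; apply/orP; right.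
have [/existsP[f /andP[fS f_big]]|/existsPn no_big] :=
  boolP [exists f in S, (slack sz b i e <= sz i f)%N].
  by rewrite (bigD1 f) //= (minn_idPr f_big) leq_addr.
apply: leq_trans (_ : size_in i S <= _)%N; first by rewrite /slack; lia.
apply: leq_sum => f fS; have := no_big f; rewrite fS /= -ltnNge => f_small.
by rewrite (minn_idPl _) // ltnW.
Qed.

Lemma weight_insert e w S : fits sz b e -> S \subset active (local_step e w) ->
    (forall i, (size_in i S <= b i)%N) ->
  (weight (local_step e w) S + slack_prod e * w e <= slack_prod e * weight w (insert e S))%N.
Proof.
move=> e_fits S_active S_fits.
have eS : e \notin S.
  by apply/negP => /(subsetP S_active)/(subsetP (active_local_step e w)); rewrite !inE eqxx.
have weightE : (slack_prod e * weight w S =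
    weight (local_step e w) S + w e * \sum_(f in S) charge_coef e f)%N.
  rewrite /weight !big_distrr /= -big_split /=; apply: eq_bigr => f /(subsetP S_active).
  by rewrite inE ffunE; lia.
rewrite /insert; case: ifP => [_|/negbT].
  by rewrite {2}/weight big_setU1 //= -/(weight w S) mulnDr weightE; lia.
rewrite negb_forall => /existsP[i]; rewrite -ltnNge => blocked.
by rewrite weightE leq_add2l mulnC leq_mul2l (blocked_charge e_fits eS (S_fits i)) ?orbT.
Qed.

Lemma local_step_value e w x : (forall k, 0 <= x k) ->
  (slack_prod e)%:R * \sum_k (w k)%:R * x k <=
    \sum_k (local_step e w k)%:R * x k + (slack_prod e)%:R * (w e)%:R * charge sz b e x.
Proof.
move=> x_ge0; rewrite [X in _ + X]mulrAC scaled_charge !mulr_sumr mulr_suml -big_split /=.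
apply: ler_sum => k _; rewrite mulrA [X in _ + X]mulrAC -mulrDl; apply: ler_wpM2r => //.
by rewrite -!natrM -natrD ler_nat ffunE; lia.
Qed.

Lemma fractional_restrict R x : fractional sz b R x ->
  forall S, fractional sz b S (fun k => if k \in S then x k else 0).
Proof.
move=> xR S; split=> [k|k|k /negbTE -> //|i].
- by case: ifP => _; rewrite ?(fractional_ge0 xR).
- by case: ifP => _; rewrite ?(fractional_le1 xR) ?ler01.
apply: le_trans (fractional_load xR i); apply: ler_sum => k _; apply: ler_wpM2l => //.
by case: ifP => _; rewrite ?(fractional_ge0 xR).
Qed.

Variables alpha eta : F.
Hypotheses (alpha_ge0 : 0 <= alpha) (eta01 : 0 <= eta <= 1).

Definition good_pick w e : Prop := e \in active w /\
  exists x, [/\ fractional sz b (active w) x, charge sz b e x <= alpha &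
    forall z, fractional sz b (active w) z ->
      (1 - eta) * \sum_k (w k)%:R * z k <= \sum_k (w k)%:R * x k].

Inductive solved : {ffun K -> nat} -> {set K} -> Prop :=
| SolvedNil w : active w = set0 -> solved w set0
| SolvedStep w e S : good_pick w e -> solved (local_step e w) S -> solved w (insert e S).

Lemma solved_active w S : solved w S -> S \subset active w.
Proof.
elim=> {w S} [w _|w e S [ea _] _ IH]; first exact: sub0set.
have Sw : S \subset active w.
  by apply: subset_trans IH (subset_trans (active_local_step e w) (subD1set _ _)).
by rewrite /insert; case: ifP => // _; rewrite subUset sub1set ea.
Qed.

Lemma solved_feasible w S i : solved w S -> (size_in i S <= b i)%N.
Proof.
elim=> {w S} [w _|w e S _ _ IH]; first by rewrite /size_in big_set0.
rewrite /insert; case: ifP => // /forallP/(_ i); apply: leq_trans.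
have [eS|eS] := boolP (e \in S); last by rewrite /size_in big_setU1 //= addnC.
by rewrite (setUidPr _) ?sub1set // leq_addr.
Qed.

Lemma solved_ratio w S z : solved w S -> (forall k, k \in active w -> fits sz b k) ->
    fractional sz b (active w) z ->
  (1 - eta) ^+ #|active w| * \sum_k (w k)%:R * z k <= alpha * (weight w S)%:R.
Proof.
have /andP[eta_ge0 eta_le1] := eta01.
move=> wS; elim: wS z => {w S} [w w0|w e S [ea [x [xw x_cheap x_opt]]] eS IH] z w_fits zw.
  rewrite big1 ?mulr0 ?mulr_ge0 // => k _.
  by rewrite (fractional_supp zw) ?mulr0 // w0 inE.
set w' := local_step e w in eS IH; set P := (slack_prod e)%:R : F.
have P_gt0 : 0 < P by rewrite ltr0n slack_prod_gt0.
pose x' k := if k \in active w' then x k else 0.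
have x'_value : \sum_k (w' k)%:R * x' k = \sum_k (w' k)%:R * x k.
  by apply: eq_bigr => k _; rewrite /x' inE; case: eqP => //= ->; rewrite !mul0r.
have w'_fits k : k \in active w' -> fits sz b k.
  by move/(subsetP (active_local_step e w)); rewrite in_setD1 => /andP[_]; apply: w_fits.
set E := (1 - eta) ^+ #|active w'|.
have E_ge0 : 0 <= E by rewrite exprn_ge0 // subr_ge0.
have E_le1 : E <= 1 by rewrite exprn_ile1 // ?subr_ge0 // lerBlDr lerDl.
have IHx : E * \sum_k (w' k)%:R * x k <= alpha * (weight w' S)%:R.
  by rewrite -x'_value; apply: IH w'_fits (fractional_restrict xw _).
have step_le : P * \sum_k (w k)%:R * x k <= \sum_k (w' k)%:R * x k + alpha * (P * (w e)%:R).
  apply: le_trans (local_step_value e w (fractional_ge0 xw)) _.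
  by rewrite lerD2l [leRHS]mulrC; apply: ler_wpM2l; rewrite ?mulr_ge0 ?ler0n.
have insert_ge : (weight w' S)%:R + P * (w e)%:R <= P * (weight w (insert e S))%:R.
  rewrite -!natrM -natrD ler_nat; apply: weight_insert (w_fits e ea) (solved_active eS) _.
  by move=> i; apply: solved_feasible eS.
have pow_le : (1 - eta) ^+ #|active w| <= E * (1 - eta).
  by rewrite -exprSr ler_wiXn2l ?subr_ge0 ?card_active_local_step // gerDl oppr_le0.
have z_ge0 : 0 <= \sum_k (w k)%:R * z k.
  by apply: sumr_ge0 => k _; rewrite mulr_ge0 // (fractional_ge0 zw).
rewrite -(@ler_pM2l _ P) //.
apply: le_trans (_ : P * (E * \sum_k (w k)%:R * x k) <= _).
  rewrite ler_pM2l //; apply: le_trans (ler_wpM2r z_ge0 pow_le) _.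
  by rewrite -mulrA; apply: ler_wpM2l => //; apply: x_opt.
rewrite mulrCA [leRHS]mulrCA; apply: le_trans (ler_wpM2l E_ge0 step_le) _.
apply: le_trans (ler_wpM2l alpha_ge0 insert_ge); rewrite !mulrDr; apply: lerD => //.
by rewrite ler_piMl // !mulr_ge0 ?ler0n.
Qed.

Definition unwind (es : seq (option K)) S : {set K} :=
  foldr (fun o T => if o is Some e then insert e T else T) S es.
End LocalRatio.

(** * Approximate packing linear programs *)

(* A greedy algorithm with quadratic potential: [cnt] counts how often each item
   was chosen, [s] is the scale for which [cnt / s] has at least the value of every
   packing of capacity 1, and the potential is the sum of the squares of the
   excesses of the loads over [s]. *)
Section Greedy.
Variables (F : realFieldType) (J K : finType) (a : J -> K -> nat) (w : {ffun K -> nat}).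
Variables (G T : nat) (J0 : {set J}).
Implicit Types (cnt : K -> nat) (s t : nat) (j : J) (k : K) (z : K -> F).

Definition row_load cnt j : nat := (\sum_k cnt k * a j k)%N.
Definition excess cnt s j : nat := (row_load cnt j - s)%N.
Definition total_excess cnt s : nat := (\sum_j excess cnt s j)%N.
Definition price cnt s k : nat := (\sum_j excess cnt s j * a j k)%N.
Definition value cnt : nat := (\sum_k w k * cnt k)%N.
Definition scale cnt s : nat := (s + total_excess cnt s)%N.

Definition cheapest cnt s k0 : Prop := w k0 != 0%N /\
  forall k, w k != 0%N -> (price cnt s k0 * w k <= price cnt s k * w k0)%N.

Record packs (c : F) z : Prop := Packs {
  packs_cap_ge0 : 0 <= c;
  packs_ge0 : forall k, 0 <= z k;
  packs_supp : forall k, w k = 0%N -> z k = 0;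
  packs_load : forall j, \sum_k (a j k)%:R * z k <= c
}.

Record greedy_inv t cnt s : Prop := GreedyInv {
  greedy_total : (\sum_k cnt k = t)%N;
  greedy_supp : forall k, w k = 0%N -> cnt k = 0%N;
  greedy_potential : (\sum_j excess cnt s j ^ 2 <= t * (2 * #|J0| * G ^ 2))%N;
  greedy_value : forall c z, packs c z ->
    s%:R * (\sum_k (w k)%:R * z k) <= (value cnt)%:R * c
}.

Hypothesis a_le : forall j k, w k != 0%N -> (a j k <= G)%N.
Hypothesis a_out : forall j k, w k != 0%N -> j \notin J0 -> a j k = 0%N.

Lemma packs_value_ge0 c z : packs c z -> 0 <= \sum_k (w k)%:R * z k.
Proof. by move=> zc; apply: sumr_ge0 => k _; rewrite mulr_ge0 ?(packs_ge0 zc). Qed.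

Lemma greedy_init cnt : (forall k, cnt k = 0%N) -> greedy_inv 0 cnt 0.
Proof.
move=> cnt0; split=> // [||c z _].
- by rewrite big1.
- rewrite big1 // => j _; rewrite /excess /row_load big1 // => k _.
  by rewrite cnt0.
have -> : value cnt = 0%N by rewrite /value big1 // => k _; rewrite cnt0 muln0.
by rewrite !mul0r.
Qed.

Section Invariant.
Variables (t s : nat) (cnt : K -> nat).
Hypothesis inv : greedy_inv t cnt s.

Lemma cnt_le k : (cnt k <= t)%N.
Proof. by rewrite -(greedy_total inv) (bigD1 k) //= leq_addr. Qed.

Lemma row_load_le j : (row_load cnt j <= t * G)%N.
Proof.
rewrite -(greedy_total inv) big_distrl /=; apply: leq_sum => k _.
have [wk|wk] := eqVneq (w k) 0%N; first by rewrite (greedy_supp inv wk).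
by rewrite leq_mul2l a_le ?orbT.
Qed.

Lemma row_load_out j : j \notin J0 -> row_load cnt j = 0%N.
Proof.
move=> jJ; rewrite /row_load big1 // => k _.
have [wk|wk] := eqVneq (w k) 0%N; first by rewrite (greedy_supp inv wk).
by rewrite a_out ?muln0.
Qed.

Lemma total_excess_le : (total_excess cnt s <= #|J0| * (t * G))%N.
Proof.
rewrite /total_excess (bigID (mem J0)) /= [X in (_ + X)%N]big1 ?addn0.
  rewrite -sum_nat_const; apply: leq_sum => j _.
  exact: leq_trans (leq_subr _ _) (row_load_le _).
by move=> j jJ; rewrite /excess row_load_out.
Qed.

Lemma total_le_value : (t <= value cnt)%N.
Proof.
rewrite -(greedy_total inv); apply: leq_sum => k _.
have [wk|wk] := eqVneq (w k) 0%N; first by rewrite (greedy_supp inv wk).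
by rewrite leq_pmull // lt0n.
Qed.

Lemma row_load_le_scale j : (row_load cnt j <= scale cnt s)%N.
Proof. by rewrite /scale /total_excess (bigD1 j) //= /excess; lia. Qed.
End Invariant.

Lemma price_le cnt s k : w k != 0%N -> (price cnt s k <= G * total_excess cnt s)%N.
Proof.
move=> wk; rewrite /total_excess big_distrr /=; apply: leq_sum => j _.
by rewrite mulnC leq_mul2r a_le ?orbT.
Qed.

Definition increment cnt s k : nat := (price cnt s k %/ total_excess cnt s)%N.

Lemma increment_le cnt s k : w k != 0%N -> (increment cnt s k <= G)%N.
Proof.
move=> wk; rewrite /increment; case: (posnP (total_excess cnt s)) => [->|Y_gt0].
  by rewrite divn0.
by rewrite -(leq_pmul2r Y_gt0); apply: leq_trans (leq_divM _ _) (price_le _ _ wk).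
Qed.

Lemma price_lt_increment cnt s k : w k != 0%N ->
  (price cnt s k <= increment cnt s k * total_excess cnt s + total_excess cnt s)%N.
Proof.
move=> wk; case: (posnP (total_excess cnt s)) => Y0.
  by have := price_le cnt s wk; rewrite Y0 muln0 leqn0 => /eqP ->.
by rewrite {1}(divn_eq (price cnt s k) (total_excess cnt s)) leq_add2l ltnW // ltn_mod.
Qed.

Lemma sqr_excess_step y c p g : (c <= g)%N -> (p <= g)%N ->
  ((y + c - p) ^ 2 + 2 * y * p <= y ^ 2 + 2 * y * c + g ^ 2)%N.
Proof.
move=> c_le p_le; rewrite -!mulnn; have [p_le_yc|/ltnW yc_le_p] := leqP p (y + c); last first.
  by rewrite (eqP yc_le_p); nia.
have [v [cE|pE]] : exists v, (c = p + v \/ p = c + v)%N.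
  by have [?|?] := leqP p c; [exists (c - p)%N; lia | exists (p - c)%N; lia].
  by rewrite cE (_ : y + (p + v) - p = y + v)%N; [nia | lia].
have [u yE] : exists u, y = (u + v)%N by exists (y - v)%N; lia.
by rewrite yE pE (_ : u + v + c - (c + v) = u)%N; [nia | lia].
Qed.

Section Step.
Variables (t s : nat) (cnt cnt' : K -> nat) (k0 : K).
Hypotheses (inv : greedy_inv t cnt s) (k0_cheapest : cheapest cnt s k0).
Hypothesis cnt'E : forall k, cnt' k = (cnt k + (k == k0))%N.

Let p : nat := increment cnt s k0.

Let sum_delta (f : K -> nat) : (\sum_k f k * (k == k0) = f k0)%N.
Proof.
by rewrite (bigD1 k0) //= eqxx muln1 big1 ?addn0 // => k /negbTE ->; rewrite muln0.
Qed.

Lemma row_load_step j : row_load cnt' j = (row_load cnt j + a j k0)%N.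
Proof.
rewrite -[a j k0](sum_delta (a j)) -big_split /=; apply: eq_bigr => k _.
by rewrite cnt'E mulnDl [in X in (_ + X)%N]mulnC.
Qed.

Lemma value_step : value cnt' = (value cnt + w k0)%N.
Proof.
rewrite -[w k0](sum_delta w) -big_split /=; apply: eq_bigr => k _.
by rewrite cnt'E mulnDr.
Qed.

Lemma potential_step : (t < T)%N -> (2 * T <= G)%N ->
  (\sum_j excess cnt' (s + p) j ^ 2 <= \sum_j excess cnt s j ^ 2 + 2 * #|J0| * G ^ 2)%N.
Proof.
move=> t_lt T_le; have wk0 := k0_cheapest.1.
have sum_step : (\sum_j excess cnt' (s + p) j ^ 2 + 2 * total_excess cnt s * p <=
    \sum_j excess cnt s j ^ 2 + 2 * price cnt s k0 + #|J0| * G ^ 2)%N.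
  rewrite -sum_nat_const [X in (_ <= _ + X)%N]big_mkcond /total_excess /price !big_distrr /=.
  rewrite big_distrl /= -!big_split /=; apply: leq_sum => j _.
  rewrite {1}/excess row_load_step; case: ifP => [_|/negbT jJ]; last first.
    by rewrite /excess (row_load_out inv jJ) a_out.
  rewrite [(2 * (_ * a j k0))%N]mulnA.
  apply: leq_trans (sqr_excess_step _ (a_le j wk0) (increment_le cnt s wk0)).
  by rewrite leq_add2r leq_exp2r // /excess -/p; lia.
have := total_excess_le inv; have := price_lt_increment cnt s wk0; rewrite -/p.
have : (2 * (#|J0| * (t * G)) <= #|J0| * G ^ 2)%N.
  by rewrite mulnCA leq_mul2l -mulnn; apply/orP; right; nia.
move: sum_step; set M := (#|J0| * G ^ 2)%N; rewrite -[(2 * _ * G ^ 2)%N]mulnA -/M; nia.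
Qed.

Lemma value_bound_step c z : packs c z ->
  (s + p)%:R * (\sum_k (w k)%:R * z k) <= (value cnt')%:R * c.
Proof.
move=> zc; have wz_ge0 := packs_value_ge0 zc; have [c_ge0 z_ge0 z_supp z_load] := zc.
rewrite value_step !natrD !mulrDl; apply: lerD; first exact: (greedy_value inv).
case: (posnP (total_excess cnt s)) => [Y0|Y_gt0].
  by rewrite /p /increment Y0 divn0 mul0r mulr_ge0.
have Y_gt0' : 0 < (total_excess cnt s)%:R :> F by rewrite ltr0n.
have price_bound : (price cnt s k0)%:R * (\sum_k (w k)%:R * z k) <=
    (w k0)%:R * (\sum_k (price cnt s k)%:R * z k).
  rewrite !mulr_sumr; apply: ler_sum => k _; rewrite !mulrA.
  have [wk|wk] := eqVneq (w k) 0%N; first by rewrite z_supp // !mulr0.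
  apply: ler_wpM2r => //; rewrite -!natrM ler_nat [leqRHS]mulnC.
  exact: k0_cheapest.2.
have total_price : \sum_k (price cnt s k)%:R * z k <= (total_excess cnt s)%:R * c.
  under eq_bigr do rewrite /price natr_sum mulr_suml.
  rewrite exchange_big /= /total_excess natr_sum mulr_suml; apply: ler_sum => j _.
  under eq_bigr do rewrite natrM -mulrA.
  by rewrite -mulr_sumr; apply: ler_wpM2l => //; apply: ler0n.
rewrite -(@ler_pM2l _ (total_excess cnt s)%:R) // mulrA.
apply: le_trans (_ : (price cnt s k0)%:R * (\sum_k (w k)%:R * z k) <= _).
  by apply: ler_wpM2r => //; rewrite -natrM ler_nat mulnC leq_divM.
apply: le_trans price_bound _; rewrite mulrCA.
by apply: ler_wpM2l => //; apply: ler0n.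
Qed.

Lemma greedy_step : (t < T)%N -> (2 * T <= G)%N -> greedy_inv t.+1 cnt' (s + p).
Proof.
move=> t_lt T_le; split; last exact: value_bound_step.
- rewrite -addn1 -(greedy_total inv) -[1%N](sum_delta (fun=> 1%N)) -big_split.
  by apply: eq_bigr => k _; rewrite cnt'E mul1n.
- move=> k wk; rewrite cnt'E (greedy_supp inv wk); case: eqP => // kk0.
  by move: k0_cheapest.1; rewrite -kk0 wk.
apply: leq_trans (potential_step t_lt T_le) _.
by rewrite mulSn addnC leq_add2l (greedy_potential inv).
Qed.
End Step.

(* Accuracy [1 - 1 / r] for [n] items, with a row of coefficient [G] for each item. *)
Section Accuracy.
Variables (n r s : nat) (cnt : K -> nat) (box : K -> J).
Hypothesis inv : greedy_inv T cnt s.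
Hypothesis box_coef : forall k, w k != 0%N -> a (box k) k = G.
Hypothesis active_le : (#|active w| <= n)%N.
Hypotheses (n_gt0 : (0 < n)%N) (r_gt0 : (0 < r)%N) (T_gt0 : (0 < T)%N).
Hypotheses (G_ge : (2 * r * n <= G)%N) (T_ge : (8 * r ^ 2 * n ^ 2 * #|J0| ^ 3 <= T)%N).

Lemma scale_ge : (G * T <= scale cnt s * n)%N.
Proof.
have cnt_total : (T <= \sum_(k in active w) cnt k)%N.
  rewrite -(greedy_total inv) (bigID (mem (active w))) /= [X in (_ + X)%N]big1 ?addn0 //.
  by move=> k; rewrite inE negbK => /eqP; apply: (greedy_supp inv).
apply: leq_trans (leq_mul (leqnn G) cnt_total) _; rewrite big_distrr /=.
apply: leq_trans (_ : (\sum_(k in active w) scale cnt s <= _)%N).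
  apply: leq_sum => k; rewrite inE => wk; apply: leq_trans (row_load_le_scale _ _ (box k)).
  by rewrite /row_load (bigD1 k) //= box_coef // mulnC leq_addr.
by rewrite sum_nat_const mulnC leq_mul2l active_le orbT.
Qed.

Lemma scale_gt0 : (0 < scale cnt s)%N.
Proof.
have G_gt0 : (0 < G)%N by apply: leq_trans G_ge; rewrite !muln_gt0 r_gt0.
rewrite lt0n; apply: contraTneq scale_ge => ->.
by rewrite mul0n leqn0 muln_eq0 negb_or -!lt0n G_gt0.
Qed.

Lemma total_excess_sqr : (total_excess cnt s ^ 2 <= 2 * #|J0| ^ 3 * T * G ^ 2)%N.
Proof.
have [Y_eq0|[j Y_le]] : total_excess cnt s = 0%N \/
    exists j, (total_excess cnt s <= #|J0| * excess cnt s j)%N.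
- case: (posnP #|J0|) => [J0_empty|/card_gt0P[j1 _]].
    by left; apply/eqP; rewrite -leqn0; have := total_excess_le inv; rewrite J0_empty; lia.
  right; have [j _ j_max] := @arg_maxnP _ j1 xpredT (excess cnt s) isT; exists j.
  rewrite /total_excess (bigID (mem J0)) /= [X in (_ + X)%N]big1 ?addn0.
    by rewrite -sum_nat_const; apply: leq_sum => i _; apply: j_max.
  by move=> i iJ; rewrite /excess (row_load_out inv iJ).
- by rewrite Y_eq0.
have excess_le : (excess cnt s j ^ 2 <= T * (2 * #|J0| * G ^ 2))%N.
  by apply: leq_trans (greedy_potential inv); rewrite (bigD1 j) //= leq_addr.
rewrite -(@leq_exp2r _ _ 2) // expnMn in Y_le; apply: leq_trans Y_le _.
apply: leq_trans (leq_mul (leqnn _) excess_le) _; rewrite leq_eqVlt; apply/orP; left.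
by apply/eqP; ring.
Qed.

Lemma total_excess_le_scale : (2 * r * total_excess cnt s <= scale cnt s)%N.
Proof.
rewrite -(leq_pmul2r n_gt0) -(@leq_exp2r _ _ 2) //; set Y := total_excess cnt s.
apply: leq_trans (_ : (G * T) ^ 2 <= _)%N; last by rewrite leq_exp2r // scale_ge.
have -> : ((2 * r * Y * n) ^ 2 = 4 * r ^ 2 * n ^ 2 * Y ^ 2)%N by ring.
apply: leq_trans (leq_mul (leqnn _) total_excess_sqr) _.
have -> : (4 * r ^ 2 * n ^ 2 * (2 * #|J0| ^ 3 * T * G ^ 2) =
  8 * r ^ 2 * n ^ 2 * #|J0| ^ 3 * (T * G ^ 2))%N by ring.
have -> : ((G * T) ^ 2 = T * (T * G ^ 2))%N by ring.
by rewrite leq_mul2r T_ge orbT.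
Qed.

Lemma greedy_accuracy z : packs (G%:R + n%:R) z ->
  (1 - r%:R^-1) * (\sum_k (w k)%:R * z k) <= (value cnt)%:R * G%:R / (scale cnt s)%:R.
Proof.
move=> zc; have value_ge := greedy_value inv zc; have A_ge0 := packs_value_ge0 zc.
set A := \sum_k _ in value_ge A_ge0 *; set Y := total_excess cnt s.
set C := (value cnt)%:R in value_ge *; have C_ge0 : 0 <= C by [].
have r_gt0' : 0 < r%:R :> F by rewrite ltr0n.
have scale_pos : 0 < (scale cnt s)%:R :> F by rewrite ltr0n scale_gt0.
set d := r%:R^-1; have d_gt0 : 0 < d by rewrite invr_gt0.
have d_le1 : d <= 1 by rewrite invf_le1 // ler1n.
have half_le (x y : nat) : (2 * r * x <= y)%N -> x%:R <= d / 2 * y%:R.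
  rewrite -(ler_nat F) !natrM => xy; rewrite -(@ler_pM2l _ (2 * r%:R)) ?mulr_gt0 //.
  by rewrite (_ : 2 * r%:R * (d / 2 * y%:R) = y%:R) // /d; field; rewrite gt_eqF.
have s_ge : (1 - d / 2) * (scale cnt s)%:R <= s%:R.
  have := half_le _ _ total_excess_le_scale; have -> : (scale cnt s)%:R = s%:R + Y%:R :> F.
    by rewrite natrD.
  by lra.
have G_ge' : (1 - d / 2) * (G%:R + n%:R) <= G%:R.
  have := half_le _ _ G_ge; have : 0 <= n%:R :> F by [].
  by nra.
have half_ge0 : 0 <= 1 - d / 2 by lra.
rewrite ler_pdivlMr //.
apply: le_trans (_ : (1 - d / 2) * ((1 - d / 2) * (scale cnt s)%:R * A) <= _).
  rewrite mulrAC [leRHS]mulrA [_ * (_ * (scale cnt s)%:R)]mulrA; apply: ler_wpM2r => //.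
  by apply: ler_wpM2r; [exact: ltW | have := sqr_ge0 d; lra].
apply: le_trans (_ : (1 - d / 2) * (C * (G%:R + n%:R)) <= _).
  by apply: ler_wpM2l => //; apply: le_trans value_ge; apply: ler_wpM2r.
by rewrite mulrCA; apply: ler_wpM2l.
Qed.
End Accuracy.
End Greedy.

(** ** The linear program of a candidate *)

Definition ceil_div (m d : nat) : nat := ((m + (d - 1)) %/ d)%N.

Lemma ceil_div_ge m d : (0 < d)%N -> (m <= ceil_div m d * d)%N.
Proof.
move=> d_gt0; have := divn_eq (m + (d - 1)) d; have := ltn_pmod (m + (d - 1)) d_gt0.
by rewrite /ceil_div; lia.
Qed.

Lemma ceil_div_le m d c : (m <= c * d)%N -> (ceil_div m d <= c)%N.
Proof.
case: (posnP d) => [->|d_gt0] m_le; first by rewrite /ceil_div divn0.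
by rewrite -ltnS /ceil_div ltn_divLR // mulSn; lia.
Qed.

Lemma ceil_div_le_ratio (F : realFieldType) m d :
  (ceil_div m d)%:R <= m%:R / d%:R + 1 :> F.
Proof.
case: (posnP d) => [->|d_gt0]; first by rewrite /ceil_div divn0 invr0 mulr0 add0r ler01.
have d_gt0' : 0 < d%:R :> F by rewrite ltr0n.
rewrite -(@ler_pM2r _ d%:R) // mulrDl divfK ?gt_eqF // mul1r -natrM -natrD ler_nat.
by apply: leq_trans (leq_divM _ _) _; lia.
Qed.

Inductive constraint (I K : Type) :=
| Capacity (i : I)
| Box (k : K)
| Charge
| Void.
Arguments Charge {I K}.
Arguments Void {I K}.

Section Candidates.
Variables (F : realFieldType) (I K J : finType) (sz : I -> K -> nat) (b : I -> nat).
Variables (kind : J -> constraint I K) (G T n : nat) (w : {ffun K -> nat}).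
Variables (J0 : {set J}) (box : K -> J) (charge_row : J).
Implicit Types (e k : K) (z : K -> F).

Definition capacity_coef (i : I) k : nat := ceil_div (G * sz i k) (b i).

Definition charge_limit_coef e k : nat :=
  ceil_div (G * charge_coef sz b e k) (3 * slack_prod sz b e).

Definition row_coef e (j : J) k : nat :=
  match kind j with
  | Capacity i => capacity_coef i k
  | Box k' => if k' == k then G else 0%N
  | Charge => charge_limit_coef e k
  | Void => 0%N
  end.

Lemma charge_coef_le e k : (#|rows sz e| <= 2)%N ->
  (charge_coef sz b e k <= 2 * slack_prod sz b e)%N.
Proof.
move=> e_sparse; rewrite /charge_coef; case: eqP => _; first by rewrite leq_pmull.
apply: leq_trans (_ : (\sum_(i in rows sz e) slack_prod sz b e <= _)%N); last first.
  by rewrite sum_nat_const leq_mul2r e_sparse orbT.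
apply: leq_sum => i ie; apply: leq_trans (leq_divM _ (slack sz b i e)).
by rewrite leq_mul2l geq_minr orbT.
Qed.

Lemma charge_limit_coef_le e k : (#|rows sz e| <= 2)%N -> (charge_limit_coef e k <= G)%N.
Proof.
move=> e_sparse; apply: ceil_div_le; rewrite leq_mul2l; apply/orP; right.
by apply: leq_trans (charge_coef_le k e_sparse) _; rewrite leq_mul2r orbT.
Qed.

Lemma capacity_coef_le i k : fits sz b k -> (capacity_coef i k <= G)%N.
Proof. by move=> k_fits; apply: ceil_div_le; rewrite leq_mul2l k_fits orbT. Qed.

Hypothesis w_fits : forall k, w k != 0%N -> fits sz b k.
Hypothesis w_sparse : forall k, w k != 0%N -> (#|rows sz k| <= 2)%N.
Hypothesis kind_capacity :
  forall i, (exists j, kind j = Capacity K i) \/ forall k, w k != 0%N -> sz i k = 0%N.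
Hypothesis kind_box : forall k, w k != 0%N -> kind (box k) = Box I k.
Hypothesis kind_charge : kind charge_row = Charge.
Hypothesis kind_out : forall j, j \notin J0 -> kind j = Void.

Lemma row_coef_le e j k : w e != 0%N -> w k != 0%N -> (row_coef e j k <= G)%N.
Proof.
move=> we wk; rewrite /row_coef; case: (kind j) => [i|k'||] //.
- exact: capacity_coef_le (w_fits wk).
- by case: ifP.
exact: charge_limit_coef_le (w_sparse we).
Qed.

Lemma row_coef_out e j k : j \notin J0 -> row_coef e j k = 0%N.
Proof. by move=> jJ; rewrite /row_coef (kind_out jJ). Qed.

Lemma row_coef_box e k : w k != 0%N -> row_coef e (box k) k = G.
Proof. by move=> wk; rewrite /row_coef kind_box // eqxx. Qed.

Hypotheses (active_le : (#|active w| <= n)%N) (active_neq0 : active w != set0).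

Lemma fractional_sum_le z : fractional sz b (active w) z -> \sum_k z k <= n%:R.
Proof.
move=> zw; apply: le_trans (_ : #|active w|%:R <= _); last by rewrite ler_nat.
rewrite -sumr_const [leRHS]big_mkcond; apply: ler_sum => k _.
case: ifP => [_|/negbT/(fractional_supp zw)-> //]; exact: (fractional_le1 zw).
Qed.

Lemma packs_fractional e z : w e != 0%N -> fractional sz b (active w) z ->
  charge sz b e z <= 3 -> packs (row_coef e) w (G%:R + n%:R) z.
Proof.
move=> we zw e_cheap; have z_ge0 := fractional_ge0 zw.
have Gn_ge0 : 0 <= G%:R + n%:R :> F by rewrite addr_ge0.
have rounded (c : K -> nat) d B : \sum_k (c k)%:R * z k <= B -> G%:R / d%:R * B <= G%:R ->
    \sum_k (ceil_div (G * c k) d)%:R * z k <= G%:R + n%:R.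
  move=> c_le B_le; apply: le_trans (_ : \sum_k (G%:R / d%:R * ((c k)%:R * z k) + z k) <= _).
    apply: ler_sum => k _; apply: le_trans (ler_wpM2r (z_ge0 k) (ceil_div_le_ratio _ _ _)) _.
    by rewrite natrM mulrDl mul1r lerD2r [leRHS]mulrA [_ / _ * (c k)%:R]mulrAC.
  rewrite big_split /= -mulr_sumr; apply: lerD (fractional_sum_le zw).
  by apply: le_trans B_le; apply: ler_wpM2l => //; rewrite divr_ge0.
split=> // [k wk|j]; first by apply: (fractional_supp zw); rewrite inE wk.
rewrite /row_coef; case: (kind j) => [i|k||].
- apply: rounded (fractional_load zw i) _; have [->|b_neq0] := eqVneq (b i) 0%N.
    by rewrite mulr0.
  by rewrite divfK // pnatr_eq0.
- rewrite (bigD1 k) //= eqxx big1 ?addr0 => [|f /negbTE fk]; last by rewrite eq_sym fk mul0r.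
  apply: le_trans (_ : G%:R <= _); last by rewrite lerDl.
  by rewrite ler_piMr // (fractional_le1 zw).
- have P_gt0 : 0 < (slack_prod sz b e)%:R :> F by rewrite ltr0n slack_prod_gt0.
  apply: (rounded _ _ _ (lexx _)); rewrite -scaled_charge natrM.
  rewrite [leLHS](_ : _ = G%:R * (charge sz b e z / 3)); last by field; rewrite gt_eqF.
  by rewrite ler_piMr //; lra.
by rewrite big1 // => k _; rewrite mul0r.
Qed.

Section Rounding.
Variables (e : K) (cnt : K -> nat) (s : nat).
Hypothesis we : w e != 0%N.
Hypothesis inv : greedy_inv F (row_coef e) w G J0 T cnt s.

Let L : nat := scale (row_coef e) cnt s.
Hypothesis L_gt0 : (0 < L)%N.

Definition rounding k : F := (cnt k)%:R * G%:R / L%:R.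

Let L_pos : 0 < L%:R :> F. Proof. by rewrite ltr0n. Qed.

Lemma rounding_value : \sum_k (w k)%:R * rounding k = (value w cnt)%:R * G%:R / L%:R.
Proof.
by rewrite /value natr_sum !mulr_suml; apply: eq_bigr => k _; rewrite natrM !mulrA.
Qed.

Lemma rounding_load_le j (c : K -> nat) B :
    (forall k, w k != 0%N -> (G * c k <= row_coef e j k * B)%N) ->
  \sum_k (c k)%:R * rounding k <= B%:R.
Proof.
move=> c_le; rewrite (_ : \sum_k _ = (\sum_k G * c k * cnt k)%N%:R / L%:R); last first.
  rewrite natr_sum mulr_suml; apply: eq_bigr => k _.
  by rewrite /rounding !natrM; ring.
rewrite ler_pdivrMr // -natrM ler_nat.
apply: leq_trans (_ : (B * row_load (row_coef e) cnt j <= _)%N); last first.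
  by rewrite leq_mul2l row_load_le_scale orbT.
rewrite /row_load big_distrr /=; apply: leq_sum => k _.
have [wk|wk] := eqVneq (w k) 0%N; first by rewrite (greedy_supp inv wk) muln0.
by rewrite mulnCA [leqLHS]mulnC leq_mul2l [leqRHS]mulnC c_le ?orbT.
Qed.

Lemma rounding_fractional : fractional sz b (active w) rounding.
Proof.
split=> [k|k|k|i].
- by rewrite divr_ge0 ?mulr_ge0.
- have [wk|wk] := eqVneq (w k) 0%N.
    by rewrite /rounding (greedy_supp inv wk) !mul0r ler01.
  rewrite ler_pdivrMr // mul1r -natrM ler_nat.
  apply: leq_trans (row_load_le_scale _ _ _ (box k)).
  by rewrite /row_load (bigD1 k) //= row_coef_box // leq_addr.
- by rewrite inE negbK => /eqP wk; rewrite /rounding (greedy_supp inv wk) !mul0r.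
have [[j kind_j]|i_unused] := kind_capacity i.
  apply: (@rounding_load_le j) => k wk; rewrite /row_coef kind_j /capacity_coef.
  case: (posnP (b i)) => b0; last exact: ceil_div_ge.
  by have := w_fits wk i; rewrite b0 leqn0 => /eqP ->; rewrite muln0.
rewrite /load big1 ?ler0n // => k _; have [wk|wk] := eqVneq (w k) 0%N.
  by rewrite /rounding (greedy_supp inv wk) !mul0r mulr0.
by rewrite i_unused // mul0r.
Qed.

Lemma rounding_charge : charge sz b e rounding <= 3.
Proof.
rewrite -(@ler_pM2l _ (slack_prod sz b e)%:R) ?ltr0n ?slack_prod_gt0 //.
rewrite scaled_charge -natrM mulnC; apply: (@rounding_load_le charge_row) => k _.
by rewrite /row_coef kind_charge; apply: ceil_div_ge; rewrite muln_gt0 slack_prod_gt0.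
Qed.
End Rounding.

Hypotheses (n_gt0 : (0 < n)%N) (T_gt0 : (0 < T)%N) (G_ge : (10 * n ^ 2 <= G)%N).
Hypothesis T_ge : (200 * n ^ 4 * #|J0| ^ 3 <= T)%N.

Section Accuracy.
Variables (e : K) (cnt : K -> nat) (s : nat).
Hypothesis we : w e != 0%N.
Hypothesis inv : greedy_inv F (row_coef e) w G J0 T cnt s.

Let r_gt0 : (0 < 5 * n)%N. Proof. by rewrite muln_gt0. Qed.
Let G_ge' : (2 * (5 * n) * n <= G)%N. Proof. by move: G_ge; rewrite expnS expn1; lia. Qed.
Let T_ge' : (8 * (5 * n) ^ 2 * n ^ 2 * #|J0| ^ 3 <= T)%N.
Proof.
by rewrite (_ : (8 * _ * _ * _ = 200 * n ^ 4 * #|J0| ^ 3)%N) //; ring.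
Qed.
Let coef_le j k : w k != 0%N -> (row_coef e j k <= G)%N.
Proof. exact: row_coef_le. Qed.
Let coef_out j k : w k != 0%N -> j \notin J0 -> row_coef e j k = 0%N.
Proof. by move=> _; apply: row_coef_out. Qed.

Lemma candidate_scale_gt0 : (0 < scale (row_coef e) cnt s)%N.
Proof.
exact: (scale_gt0 inv (fun k => @row_coef_box e k) active_le n_gt0 r_gt0 T_gt0 G_ge').
Qed.

Lemma candidate_accuracy z : fractional sz b (active w) z -> charge sz b e z <= 3 ->
  (1 - (5 * n)%:R^-1) * (\sum_k (w k)%:R * z k) <=
    (value w cnt)%:R * G%:R / (scale (row_coef e) cnt s)%:R.
Proof.
move=> zw e_cheap.
exact: (greedy_accuracy coef_le coef_out inv (fun k => @row_coef_box e k)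
  active_le n_gt0 r_gt0 T_gt0 G_ge' T_ge' (packs_fractional we zw e_cheap)).
Qed.
End Accuracy.

Lemma best_candidate_good (val scl : K -> nat) e0 :
    (forall e, w e != 0%N -> exists cnt s, [/\ greedy_inv F (row_coef e) w G J0 T cnt s,
       val e = value w cnt & scl e = scale (row_coef e) cnt s]) ->
    w e0 != 0%N -> (forall e, w e != 0%N -> (scl e0 * val e <= scl e * val e0)%N) ->
  good_pick sz b (3 : F) (5 * n)%:R^-1 w e0.
Proof.
move=> candidates we0 e0_best; split; first by rewrite inE.
have [cnt0 [s0 [inv0 val0 scl0]]] := candidates e0 we0.
have scl0_gt0 := candidate_scale_gt0 we0 inv0.
exists (rounding e0 cnt0 s0); split.
- exact: rounding_fractional inv0 scl0_gt0.
- exact: rounding_charge inv0 scl0_gt0.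
move=> z zw.
have fits' k : k \in active w -> fits sz b k by rewrite inE; apply: w_fits.
have sparse' k : k \in active w -> (#|rows sz k| <= 2)%N by rewrite inE; apply: w_sparse.
have [e [z' [ea z'w wz' e_cheap]]] :=
  exists_cheap_item (fun k => (w k)%:R) zw active_neq0 fits' sparse'.
have we : w e != 0%N by rewrite inE in ea.
have [cnt [s [inv val_e scl_e]]] := candidates e we.
have acc_ge0 : 0 <= 1 - (5 * n)%:R^-1 :> F.
  by rewrite subr_ge0 invf_le1 ?ltr0n ?ler1n muln_gt0.
apply: le_trans (ler_wpM2l acc_ge0 wz') _.
apply: le_trans (candidate_accuracy we inv z'w e_cheap) _.
rewrite rounding_value ler_pdivrMr ?ltr0n ?(candidate_scale_gt0 we inv) //.
rewrite mulrAC ler_pdivlMr ?ltr0n // -!natrM ler_nat -val0 -scl0 -val_e -scl_e.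
by rewrite -!mulnA mulnCA [leqRHS]mulnCA leq_mul2l mulnC [leqRHS]mulnC e0_best ?orbT.
Qed.
End Candidates.

Local Close Scope ring_scope.

(** * Multiplicities as sums of truncated powers of two *)

Definition part (U l : nat) : nat := minn (2 ^ l) (U - (2 ^ l - 1)).

Lemma part_le U l : part U l <= U.
Proof. exact: leq_trans (geq_minr _ _) (leq_subr _ _). Qed.

Lemma sum_part U N : \sum_(0 <= l < N) part U l = minn U (2 ^ N - 1).
Proof.
elim: N => [|N IH]; first by rewrite big_nil subnn minn0.
rewrite big_nat_recr //= IH /part expnS; have : 0 < 2 ^ N by rewrite expn_gt0.
by move: (2 ^ N) => t; lia.
Qed.

Lemma part_subset_sum U N y : y <= minn U (2 ^ N - 1) ->
  exists d : nat -> bool, \sum_(0 <= l < N) d l * part U l = y.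
Proof.
elim: N y => [|N IH] y.
  by rewrite subnn minn0 leqn0 => /eqP ->; exists xpred0; rewrite big_nil.
have pow_gt0 : 0 < 2 ^ N by rewrite expn_gt0.
rewrite expnS => y_le; pose top := ~~ (y <= minn U (2 ^ N - 1)).
have [|d d_sum] := IH (y - top * part U N).
  by move: y_le; rewrite /top /part; case: leqP; move: (2 ^ N) pow_gt0 => t; lia.
exists (fun l => if l == N then top else d l); rewrite big_nat_recr //= eqxx.
rewrite (_ : \sum_(0 <= l < N) _ = y - top * part U N); last first.
  by rewrite -d_sum big_nat [RHS]big_nat; apply: eq_bigr => l /andP[_ lN]; rewrite ltn_eqF.
by rewrite subnK //; move: y_le; rewrite /top /part; case: leqP; move: (2 ^ N) pow_gt0 => t; lia.
Qed.

Lemma sum_block N q j (f : nat -> nat) : 0 < N -> j.+1 * N <= q ->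
  \sum_(0 <= k < q | k %/ N == j) f k = \sum_(0 <= l < N) f (j * N + l).
Proof.
move=> N_gt0 j_le; transitivity (\sum_(j * N <= k < j.+1 * N) f k); last first.
  by rewrite -{1}[j * N]add0n big_addn mulSnr addKn; apply: eq_bigr => l _; rewrite addnC.
rewrite (big_nat_widen _ _ _ _ _ j_le) (@big_nat_widenl _ _ _ (j * N) 0) //.
by apply: eq_bigl => k; rewrite /= -leq_divRL // -ltn_divLR // ltnS eqn_leq.
Qed.

Lemma bernoulli (F : realFieldType) (e : F) r : (0 <= e <= 1 -> 1 - r%:R * e <= (1 - e) ^+ r)%R.
Proof.
move=> /andP[e_ge0 e_le1]; elim: r => [|r IH]; first by rewrite mul0r subr0 expr0.
rewrite exprS; apply: le_trans (_ : (1 - e) * (1 - r%:R * e) <= _)%R; last first.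
  by apply: ler_wpM2l IH; rewrite subr_ge0.
have : (0 <= r%:R * (e * e))%R by rewrite !mulr_ge0 ?ler0n.
by rewrite -natr1; lra.
Qed.

Definition loss (F : realFieldType) (N : nat) : F := ((5 * (N * N))%:R^-1)%R.

Section BinaryItems.
Variables (q N n : nat) (a : nat -> nat -> nat) (b c U : nat -> nat).
Implicit Types (S : {set 'I_q}) (y : nat -> nat).

(* Item [k] stands for [item_part k] copies of variable [k %/ N]. *)
Definition item_part (k : nat) : nat := part (U (k %/ N)) (k %% N).

Definition item_size (i k : 'I_q) : nat := item_part k * a i (k %/ N).

Definition item_fits (k : 'I_q) : bool := [forall i : 'I_q, item_size i k <= b i].

Definition item_weight : {ffun 'I_q -> nat} :=
  [ffun k : 'I_q => if item_fits k then item_part k * c (k %/ N) else 0].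

Definition copies S (j : nat) : nat := \sum_(k in S | k %/ N == j) item_part k.

Hypotheses (N_gt0 : 0 < N) (n_le : n * N <= q).

Let block_le j : j < n -> j.+1 * N <= q.
Proof. by move=> j_lt; apply: leq_trans n_le; rewrite leq_mul2r j_lt orbT. Qed.

Lemma item_partE j l : l < N -> item_part (j * N + l) = part (U j) l.
Proof. by move=> lN; rewrite /item_part divnMDl // modnMDl divn_small ?modn_small ?addn0. Qed.

Lemma copiesE S (d : nat -> nat -> bool) j : j < n ->
    (forall k : 'I_q, k %/ N = j -> (k \in S) = d j (k %% N)) ->
  copies S j = \sum_(0 <= l < N) d j l * part (U j) l.
Proof.
move=> j_lt S_d; pose f k := d j (k %% N) * item_part k.
transitivity (\sum_(0 <= k < q | k %/ N == j) f k).
  rewrite big_mkord /copies big_mkcondl; apply: eq_bigr => k /eqP/S_d ->.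
  by rewrite /f; case: (d j _); rewrite ?mul1n.
rewrite sum_block ?block_le // big_nat [RHS]big_nat; apply: eq_bigr => l /andP[_ lN].
by rewrite /f item_partE // modnMDl modn_small.
Qed.

Lemma sum_copies S (g : nat -> nat) : (forall j, n <= j -> g j = 0) ->
  \sum_(k in S) item_part k * g (k %/ N) = \sum_(0 <= j < n) g j * copies S j.
Proof.
move=> g_out; rewrite big_mkord; under [RHS]eq_bigr => j _ do rewrite big_distrr /=.
rewrite (exchange_big_dep (mem S)) /=; last by move=> j k _ /andP[].
apply: eq_bigr => k kS; rewrite kS /=.
under eq_bigl => j do rewrite eq_sym.
rewrite (big_ord1_eq _ (fun j => g j * item_part k)).
by case: ltnP => [_|/g_out ->]; rewrite ?muln0 // mulnC.
Qed.

Lemma copies_le S j : j < n -> copies S j <= U j.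
Proof.
move=> j_lt; apply: leq_trans (geq_minl (U j) (2 ^ N - 1)); rewrite -sum_part.
apply: (@leq_trans (copies setT j)).
  rewrite /copies big_mkcondl [leqRHS]big_mkcondl; apply: leq_sum => k _.
  by rewrite inE; case: (k \in S).
rewrite (@copiesE _ (fun _ _ => true)) // => [|k _]; last by rewrite inE.
by apply: leq_sum => l _; rewrite mul1n.
Qed.

Lemma exists_copies y : (forall j, j < n -> y j <= minn (U j) (2 ^ N - 1)) ->
  exists2 S : {set 'I_q},
    forall k, k \in S -> k %/ N < n & forall j, j < n -> copies S j = y j.
Proof.
move=> y_le; have /fin_all_exists[d d_sum] (j : 'I_n) := part_subset_sum (y_le _ (ltn_ord j)).
pose digit j l := oapp (fun j' : 'I_n => d j' l) false (insub j).
exists [set k : 'I_q | digit (k %/ N) (k %% N)] => [k|j j_lt].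
  by rewrite inE /digit; case: insubP => //= j' /[swap] _; rewrite ltn_ord.
rewrite (@copiesE _ digit) // => [|k <-]; last by rewrite inE.
by rewrite -(d_sum (Ordinal j_lt)) /digit; apply: eq_bigr => l _; rewrite insubT.
Qed.

Hypotheses (a_out : forall i j, n <= j -> a i j = 0) (c_out : forall j, n <= j -> c j = 0).

Definition within y : Prop := forall i, i < q -> \sum_(0 <= j < n) a i j * y j <= b i.

Lemma size_in_copies i S : size_in item_size i S = \sum_(0 <= j < n) a i j * copies S j.
Proof. by rewrite -(sum_copies S (a_out i)). Qed.

Lemma weight_copies S : S \subset active item_weight ->
  weight item_weight S = \sum_(0 <= j < n) c j * copies S j.
Proof.
move=> S_active; rewrite -(sum_copies S c_out); apply: eq_bigr => k /(subsetP S_active).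
by rewrite inE ffunE; case: ifP.
Qed.

Lemma item_fits_of_copies y S k : within y -> (forall j, j < n -> copies S j = y j) ->
  k \in S -> k %/ N < n -> item_fits k.
Proof.
move=> y_within S_y kS k_lt; apply/forallP => i; apply: leq_trans (y_within i (ltn_ord i)).
rewrite (bigD1_seq (k %/ N)) ?mem_index_iota ?iota_uniq //=; apply: leq_trans (leq_addr _ _).
rewrite /item_size mulnC leq_mul2l -S_y // /copies (bigD1 k) ?kS ?eqxx //= leq_addr orbT //.
Qed.

Lemma weight_of_copies y S : within y -> (forall k, k \in S -> k %/ N < n) ->
    (forall j, j < n -> copies S j = y j) ->
  weight item_weight S = \sum_(0 <= j < n) c j * y j.
Proof.
move=> y_within S_lt S_y; transitivity (\sum_(0 <= j < n) c j * copies S j).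
  rewrite -(sum_copies S c_out); apply: eq_bigr => k kS.
  by rewrite ffunE (item_fits_of_copies y_within S_y) ?S_lt.
by rewrite big_nat [RHS]big_nat; apply: eq_bigr => j /andP[_ /S_y ->].
Qed.

Section Ratio.
Variables (F : realFieldType) (S : {set 'I_q}).
Hypothesis card_active : #|active item_weight| <= N * N.
Hypothesis S_solved : solved item_size b (3 : F)%R (loss F N) item_weight S.

Lemma copies_within : within (copies S).
Proof.
by move=> i i_lt; have := solved_feasible (Ordinal i_lt) S_solved; rewrite size_in_copies.
Qed.

Lemma copies_approx y : within y -> (forall j, j < n -> y j <= minn (U j) (2 ^ N - 1)) ->
  4 * \sum_(0 <= j < n) c j * y j <= 15 * \sum_(0 <= j < n) c j * copies S j.
Proof.
move=> y_within /exists_copies[Y Y_lt Y_y].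
have M_gt0 : (0 < (5 * (N * N))%:R :> F)%R by rewrite ltr0n !muln_gt0 N_gt0.
have loss01 : (0 <= loss F N <= 1)%R by rewrite invr_ge0 ltW //= invf_le1 // ler1n -(ltr0n F).
have active_fits k : k \in active item_weight -> fits item_size b k.
  by rewrite inE ffunE; case: ifP => // /forallP.
pose z k : F := ((k \in Y) && (k \in active item_weight))%:R%R.
have z_frac : fractional item_size b (active item_weight) z.
  split=> [k|k|k /negbTE k_out|i]; rewrite /z ?ler0n ?k_out ?andbF //.
    by case: (_ && _).
  apply: (@le_trans _ _ (size_in item_size i Y)%:R%R).
    rewrite /load /size_in [in leRHS]big_mkcond natr_sum; apply: ler_sum => k _.
    by case: (k \in Y); case: (k \in active _); rewrite /= ?mulr0 ?mulr1 ?ler0n.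
  rewrite ler_nat size_in_copies; apply: leq_trans (y_within i (ltn_ord i)).
  by rewrite big_nat [leqRHS]big_nat; apply: leq_sum => j /andP[_ /Y_y ->].
have z_value : (\sum_k (item_weight k)%:R * z k = (weight item_weight Y)%:R)%R.
  rewrite /weight [in RHS]big_mkcond natr_sum; apply: eq_bigr => k _; rewrite /z inE.
  by case: (k \in Y); case: eqP => [->|_]; rewrite /= ?mulr0 ?mulr1.
have := solved_ratio (ler0n F 3) loss01 S_solved active_fits z_frac.
rewrite z_value (weight_of_copies y_within Y_lt Y_y) (weight_copies (solved_active S_solved)).
set value_y := \sum_(0 <= j < n) _; set value_S := \sum_(0 <= j < n) _ => ratio.
have accuracy : (4 / 5 <= (1 - loss F N) ^+ #|active item_weight|)%R.
  apply: le_trans (bernoulli #|active item_weight| loss01).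
  have : (#|active item_weight|%:R * loss F N <= 1 / 5)%R.
    rewrite ler_pdivrMr // natrM mulrA divfK ?mul1r ?ler_nat //.
    by rewrite pnatr_eq0.
  by lra.
rewrite -(ler_nat F) !natrM.
have : (4 / 5 * value_y%:R <= 3 * value_S%:R :> F)%R.
  by apply: le_trans (ler_wpM2r (ler0n _ _) accuracy) ratio.
by lra.
Qed.
End Ratio.
End BinaryItems.

(** * A loop language and its compilation to the random access machine *)

(* Variable 0 holds the common bound of all loops and big operators, and variable
   1 the cap to which every stored value is truncated, so that all values keep
   polynomial bit length.  Array 0 is the input and the output; its indices are
   truncated to the length [L] of the input. *)
Inductive bigop_kind := BSum | BProd.

Inductive expr :=
| Var (x : nat)
| Cst (c : nat)
| Bin (o : arith) (a b : expr)
| Rd (k : nat) (a : expr)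
| Ite (c a b : expr)
| Big (o : bigop_kind) (x : nat) (e : expr).

Inductive prog :=
| Wr (k : nat) (a e : expr)
| PSeq (p1 p2 : prog)
| For (x : nat) (p : prog).

Definition env := nat -> nat.
Definition memory := nat -> nat -> nat.

Definition updm (A : memory) (k i v : nat) : memory :=
  fun k' => if k' == k then upd (A k) i v else A k'.

Definition clamp (L k i : nat) : nat := if k == 0 then minn i L else i.

Fixpoint evalE (L : nat) (s : env) (A : memory) (e : expr) : nat :=
  match e with
  | Var x => s x
  | Cst c => c
  | Bin o a b => eval_arith o (evalE L s A a) (evalE L s A b)
  | Rd k a => A k (clamp L k (evalE L s A a))
  | Ite c a b => if evalE L s A c != 0 then evalE L s A a else evalE L s A b
  | Big BSum x e => \sum_(0 <= i < s 0) evalE L (upd s x i) A e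
  | Big BProd x e => \prod_(0 <= i < s 0) evalE L (upd s x i) A e
  end.

(* The loops run downwards, as the compiled [While] tests its counter against 0. *)
Fixpoint loop (T : Type) (n : nat) (f : nat -> T -> T) (x : T) : T :=
  if n is n'.+1 then loop n' f (f n' x) else x.

Fixpoint evalP (L : nat) (p : prog) (s : env) (A : memory) : memory :=
  match p with
  | Wr k a e => updm A k (clamp L k (evalE L s A a)) (minn (evalE L s A e) (s 1))
  | PSeq p1 p2 => evalP L p2 s (evalP L p1 s A)
  | For x p => loop (s 0) (fun i A' => evalP L p (upd s x i) A') A
  end.

Definition nkeys := 32.

Fixpoint wfE (e : expr) : bool :=
  match e with
  | Var _ | Cst _ => true
  | Bin _ a b => wfE a && wfE b
  | Rd k a => (k < nkeys) && wfE a
  | Ite c a b => [&& wfE c, wfE a & wfE b]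
  | Big _ x e => (x != 0) && wfE e
  end.

Fixpoint wfP (p : prog) : bool :=
  match p with
  | Wr k a e => [&& k < nkeys, wfE a & wfE e]
  | PSeq p1 p2 => wfP p1 && wfP p2
  | For x p => (x != 0) && wfP p
  end.

(* Register 0 holds [L], the even registers hold the variables, and the odd ones
   are the stack of temporaries. *)
Definition rv (x : nat) : nat := x.*2.+2.
Definition rt (t : nat) : nat := t.*2.+1.

(* Array 0 occupies the addresses up to [L], and the others are interleaved above. *)
Definition address (L k i : nat) : nat :=
  if k == 0 then i else i * nkeys + k.+1 + L.

Definition mov (r r' : nat) : cmd := Seq (Const r 0) (Arith Defs.Add r r' r).

Definition comp_address (t k : nat) : cmd :=
  if k == 0 then
    Seq (Arith Defs.Sub (rt t.+1) (rt t) 0) (Arith Defs.Sub (rt t) (rt t) (rt t.+1))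
  else
    Seq (Const (rt t.+1) nkeys)
   (Seq (Arith Defs.Mul (rt t) (rt t) (rt t.+1))
   (Seq (Const (rt t.+1) k.+1)
   (Seq (Arith Defs.Add (rt t) (rt t) (rt t.+1))
        (Arith Defs.Add (rt t) (rt t) 0)))).

Definition comp_for (t x : nat) (body : cmd) : cmd :=
  Seq (mov (rt t) (rv x))
 (Seq (mov (rv x) (rv 0))
 (Seq (While (rv x)
         (Seq (Seq (Const (rt t.+1) 1) (Arith Defs.Sub (rv x) (rv x) (rt t.+1))) body))
      (mov (rv x) (rt t)))).

Definition bigop_idx (o : bigop_kind) : nat := if o is BSum then 0 else 1.
Definition bigop_arith (o : bigop_kind) : arith := if o is BSum then Defs.Add else Defs.Mul.

Fixpoint compE (t : nat) (e : expr) : cmd :=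
  match e with
  | Var x => mov (rt t) (rv x)
  | Cst c => Const (rt t) c
  | Bin o a b => Seq (compE t a) (Seq (compE t.+1 b) (Arith o (rt t) (rt t) (rt t.+1)))
  | Rd k a => Seq (compE t a) (Seq (comp_address t k) (Read (rt t) (rt t)))
  | Ite c a b => Seq (compE t c) (If (rt t) (compE t a) (compE t b))
  | Big o x e =>
      Seq (Const (rt t) (bigop_idx o))
          (comp_for t.+1 x
             (Seq (compE t.+2 e) (Arith (bigop_arith o) (rt t) (rt t) (rt t.+2))))
  end.

Fixpoint compP (t : nat) (p : prog) : cmd :=
  match p with
  | Wr k a e =>
      Seq (Seq (compE t a) (comp_address t k))
     (Seq (compE t.+1 e)
     (Seq (Arith Defs.Sub (rt t.+2) (rt t.+1) (rv 1))
     (Seq (Arith Defs.Sub (rt t.+1) (rt t.+1) (rt t.+2))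
          (Write (rt t) (rt t.+1)))))
  | PSeq p1 p2 => Seq (compP t p1) (compP t p2)
  | For x p => comp_for t x (compP t.+1 p)
  end.

(* With at most [q] iterations per loop and stored values below [2 ^ W], [bitsE]
   bounds the bit length of a value, and [timeE] and [timeP] bound the cost. *)
Section Bounds.
Variables (q W : nat).

Fixpoint bitsE (e : expr) : nat :=
  match e with
  | Var _ => W
  | Cst c => c.+1
  | Bin _ a b => (bitsE a + bitsE b).+1
  | Rd _ a => W
  | Ite c a b => bitsE a + bitsE b
  | Big _ _ e => q.+1 * (bitsE e).+1
  end.

Definition time_address (k bits : nat) : nat := 8 * (bits + W + nkeys + k).

Definition time_for (time_body : nat) : nat := 3 * (W + 2) + q * (2 * W + 2 + time_body) + 1.

Fixpoint timeE (e : expr) : nat :=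
  match e with
  | Var _ => W + 2
  | Cst c => c.+1
  | Bin _ a b => timeE a + (timeE b + (bitsE a + bitsE b))
  | Rd k a => timeE a + (time_address k (bitsE a) + (bitsE a + W + 6 + W))
  | Ite c a b => timeE c + (bitsE c + (timeE a + timeE b))
  | Big o x e => 1 + time_for (timeE e + (q.+1 * (bitsE e).+1 + bitsE e))
  end.

Fixpoint timeP (p : prog) : nat :=
  match p with
  | Wr k a e =>
      timeE a + time_address k (bitsE a) + (timeE e + (bitsE a + 5 * bitsE e + 2 * W + 6))
  | PSeq p1 p2 => timeP p1 + timeP p2
  | For x p => time_for (timeP p)
  end.
End Bounds.

Lemma bitlen_le v b : v < 2 ^ b -> 0 < b -> bitlen v <= b.
Proof.
case: v => [|v] v_lt b_gt0; first by rewrite /bitlen trunc_log0.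
by rewrite /bitlen -(@ltn_exp2l 2) // (leq_ltn_trans _ v_lt) // trunc_logP.
Qed.

Lemma evalE_ext L A e s s' : s =1 s' -> evalE L s A e = evalE L s' A e.
Proof.
elim: e s s' => //= [o a IHa b IHb|k a IHa|c IHc a IHa b IHb|o x e IH] s s' ss'.
- by rewrite (IHa _ _ ss') (IHb _ _ ss').
- by rewrite (IHa _ _ ss').
- by rewrite (IHa _ _ ss') (IHb _ _ ss') (IHc _ _ ss').
have upd_ss' i : upd s x i =1 upd s' x i by move=> y; rewrite /upd ss'.
by case: o; rewrite ss'; apply: eq_bigr => i _; apply: IH.
Qed.

Lemma evalP_ext L p s s' A : s =1 s' -> evalP L p s A = evalP L p s' A.
Proof.
elim: p s s' A => [k a e|p1 IH1 p2 IH2|x p IH] s s' A ss' /=.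
- by rewrite (evalE_ext _ _ a ss') (evalE_ext _ _ e ss') ss'.
- by rewrite (IH1 _ _ _ ss') (IH2 _ _ _ ss').
rewrite ss'; elim: (s' 0) A => //= n IHn A.
by rewrite IHn; congr loop; apply: IH => y; rewrite /upd ss'.
Qed.

(** ** Reasoning about the machine *)

Definition runs (c : cmd) (s : state) (T : nat) (Q : state -> Prop) : Prop :=
  exists k s', [/\ exec c s k s', k <= T & Q s'].

Lemma runs_mono c s T T' (Q Q' : state -> Prop) :
  T <= T' -> (forall s', Q s' -> Q' s') -> runs c s T Q -> runs c s T' Q'.
Proof.
move=> TT' QQ' [k [s' [e kT Qs']]]; exists k, s'; split=> //; last exact: QQ'.
exact: leq_trans kT TT'.
Qed.

Lemma runs_seq c1 c2 s T1 T2 Q :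
  runs c1 s T1 (fun s1 => runs c2 s1 T2 Q) -> runs (Seq c1 c2) s (T1 + T2) Q.
Proof.
move=> [k1 [s1 [e1 k1T [k2 [s2 [e2 k2T Qs2]]]]]]; exists (k1 + k2), s2; split=> //.
  exact: ExecSeq e1 e2.
exact: leq_add.
Qed.

Lemma runs_const r v s T (Q : state -> Prop) :
  bitlen v <= T -> Q (set_reg s r v) -> runs (Const r v) s T Q.
Proof. by exists (bitlen v), (set_reg s r v); split=> //; constructor. Qed.

Lemma runs_arith o r r1 r2 s T (Q : state -> Prop) :
    bitlen (reg s r1) + bitlen (reg s r2) <= T ->
    Q (set_reg s r (eval_arith o (reg s r1) (reg s r2))) ->
  runs (Arith o r r1 r2) s T Q.
Proof. by move=> cost_le Qs; eexists; eexists; split; [constructor | |]. Qed.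

Lemma runs_read r ra s T (Q : state -> Prop) :
    bitlen (reg s ra) + bitlen (ram s (reg s ra)) <= T ->
    Q (set_reg s r (ram s (reg s ra))) ->
  runs (Read r ra) s T Q.
Proof. by move=> cost_le Qs; eexists; eexists; split; [constructor | |]. Qed.

Lemma runs_write ra r s T (Q : state -> Prop) :
    bitlen (reg s ra) + bitlen (reg s r) <= T -> Q (set_ram s (reg s ra) (reg s r)) ->
  runs (Write ra r) s T Q.
Proof. by move=> cost_le Qs; eexists; eexists; split; [constructor | |]. Qed.

Lemma runs_if r c1 c2 s T Q :
  runs (if reg s r != 0 then c1 else c2) s T Q ->
  runs (If r c1 c2) s (bitlen (reg s r) + T) Q.
Proof.
case: ifP => [r_neq0|/negbFE/eqP r_eq0] [k [s' [e kT Qs']]];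
  exists (bitlen (reg s r) + k), s'; split; rewrite ?leq_add2l //.
- exact: ExecIfTrue.
- exact: ExecIfFalse.
Qed.

Lemma runs_while_stop r c s T (Q : state -> Prop) :
  reg s r = 0 -> 0 < T -> Q s -> runs (While r c) s T Q.
Proof.
move=> r_eq0 T_gt0 Qs; exists (bitlen (reg s r)), s; split=> //; last by rewrite r_eq0.
exact: ExecWhileFalse.
Qed.

Lemma runs_while_step r c s T1 T2 T Q :
    reg s r != 0 -> bitlen (reg s r) + T1 + T2 <= T ->
    runs c s T1 (fun s1 => runs (While r c) s1 T2 Q) ->
  runs (While r c) s T Q.
Proof.
move=> r_neq0 cost_le [k1 [s1 [e1 k1T [k2 [s2 [e2 k2T Qs2]]]]]].
exists (bitlen (reg s r) + k1 + k2), s2; split=> //; first exact: ExecWhileTrue e1 e2.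
by apply: leq_trans cost_le; apply: leq_add => //; rewrite leq_add2l.
Qed.

Definition agree (X : pred nat) (s s' : state) : Prop :=
  forall r, ~~ X r -> reg s' r = reg s r.

Definition temps (t : nat) : pred nat := [pred r | odd r && (rt t <= r)].

Definition temps_or (t x : nat) : pred nat := [pred r | (r == rv x) || temps t r].

Lemma agree_trans X s1 s2 s3 : agree X s1 s2 -> agree X s2 s3 -> agree X s1 s3.
Proof. by move=> s12 s23 r Xr; rewrite s23 // s12. Qed.

Lemma agree_sub (X Y : pred nat) s1 s2 : {subset X <= Y} -> agree X s1 s2 -> agree Y s1 s2.
Proof. by move=> XY s12 r Yr; apply: s12; apply: contra Yr; apply: XY. Qed.

Lemma agree_set_reg (X : pred nat) s r v : X r -> agree X s (set_reg s r v).
Proof. by move=> Xr r' Xr'; rewrite /= /upd; case: eqP => // rr'; rewrite rr' Xr in Xr'. Qed.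

Lemma temps_rt t u : temps t (rt u) = (t <= u).
Proof. by rewrite /temps /rt /=; lia. Qed.

Lemma temps_rv t x : temps t (rv x) = false.
Proof. by rewrite /temps /rv /=; lia. Qed.

Lemma agree_set_temp t u s s1 v : t <= u -> agree (temps t) s s1 ->
  agree (temps t) s (set_reg s1 (rt u) v).
Proof.
by move=> tu ss1; apply: (agree_trans ss1); apply: agree_set_reg; rewrite temps_rt.
Qed.

Lemma rv_inj x y : (rv x == rv y) = (x == y).
Proof. by rewrite /rv; lia. Qed.

Lemma rt_inj x y : (rt x == rt y) = (x == y).
Proof. by rewrite /rt; lia. Qed.

Lemma rv_rt x t : (rv x == rt t) = false.
Proof. by rewrite /rv /rt; lia. Qed.

Lemma rt_rv x t : (rt t == rv x) = false.
Proof. by rewrite /rv /rt; lia. Qed.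

Lemma succ_eqF n : (n.+1 == n) = false.
Proof. by lia. Qed.

Lemma eq_succF n : (n == n.+1) = false.
Proof. by lia. Qed.

Lemma succ2_eqF n : (n.+2 == n) = false.
Proof. by lia. Qed.

Lemma eq_succ2F n : (n == n.+2) = false.
Proof. by lia. Qed.

Definition regE := (rv_inj, rt_inj, rv_rt, rt_rv, eqSS, succ_eqF, eq_succF, succ2_eqF,
  eq_succ2F, eqxx).

Lemma sub_temps t t' : t <= t' -> {subset temps t' <= temps t}.
Proof. by move=> tt' r; rewrite !inE /rt; lia. Qed.

Lemma sub_temps_or t x : {subset temps t <= temps_or t x}.
Proof. by move=> r tr; apply/orP; right. Qed.

Lemma runs_mov r r' s b (Q : state -> Prop) :
    r != r' -> reg s r' < 2 ^ b -> 0 < b ->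
    (forall s', agree (pred1 r) s s' -> reg s' r = reg s r' -> ram s' = ram s -> Q s') ->
  runs (mov r r') s (b + 2) Q.
Proof.
move=> rr' r'_lt b_gt0 Qs; apply: (@runs_mono _ _ (1 + (b + 1)) _ Q); [lia | by [] |].
apply: runs_seq; apply: runs_const => //.
have r'E : reg (set_reg s r 0) r' = reg s r' by rewrite /= /upd eq_sym (negbTE rr').
apply: runs_arith; first by rewrite r'E /= /upd eqxx leq_add ?bitlen_le.
apply: Qs => //; last by rewrite r'E /= /upd !eqxx addn0.
by apply: (@agree_trans _ _ (set_reg s r 0)); apply: agree_set_reg; rewrite /= eqxx.
Qed.

Section CountingLoop.
Variables (t x W Tb : nat) (body : cmd) (Inv : nat -> state -> Prop).

Definition decrement (i : nat) (s : state) : state :=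
  set_reg (set_reg s (rt t.+1) 1) (rv x) i.

Lemma runs_countdown s n :
    reg s (rv x) = n -> n < 2 ^ W -> 0 < W -> Inv n s ->
    (forall i s1, i < n -> Inv i.+1 s1 -> runs body (decrement i s1) Tb
       (fun s2 => [/\ Inv i s2, reg s2 (rv x) = i & reg s2 (rt t) = reg s1 (rt t)])) ->
  runs (While (rv x)
      (Seq (Seq (Const (rt t.+1) 1) (Arith Defs.Sub (rv x) (rv x) (rt t.+1))) body))
    s (n * (2 * W + 2 + Tb) + 1) (fun s' => Inv 0 s' /\ reg s' (rt t) = reg s (rt t)).
Proof.
move=> + + W_gt0; elim: n s => [|n IH] s sn n_lt inv step.
  by apply: runs_while_stop; rewrite // addn1.
have bits_n : bitlen n.+1 <= W by apply: bitlen_le.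
apply: (@runs_while_step _ _ _ (1 + (W + 1) + Tb) (n * (2 * W + 2 + Tb) + 1)).
- by rewrite sn.
- by rewrite sn mulSn; lia.
apply: runs_seq; apply: runs_seq; apply: runs_const => //.
set s1 := set_reg s _ 1; have s1x : reg s1 (rv x) = n.+1 by rewrite /s1 /= /upd !regE.
apply: runs_arith; first by rewrite s1x /s1 /= /upd !regE leq_add.
have -> : set_reg s1 (rv x) (eval_arith Defs.Sub (reg s1 (rv x)) (reg s1 (rt t.+1))) =
    decrement n s.
  by rewrite s1x /s1 /= /upd !regE subn1.
apply: runs_mono (step n s (ltnSn n) inv) => // s2 [inv2 s2x s2t].
apply: runs_mono (IH s2 s2x (ltnW n_lt) inv2 _) => // [s3 [inv3 ->] //|i s3 i_lt].
by apply: step; apply: ltnW.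
Qed.

Lemma runs_for s n (Q : state -> Prop) : x != 0 ->
    reg s (rv 0) = n -> n < 2 ^ W -> reg s (rv x) < 2 ^ W -> 0 < W ->
    (forall s1, agree (temps_or t x) s s1 -> ram s1 = ram s -> Inv n s1) ->
    (forall i s1, i < n -> Inv i.+1 s1 -> runs body (decrement i s1) Tb
       (fun s2 => [/\ Inv i s2, reg s2 (rv x) = i & reg s2 (rt t) = reg s1 (rt t)])) ->
    (forall s1 s2, Inv 0 s1 -> agree (pred1 (rv x)) s1 s2 -> reg s2 (rv x) = reg s (rv x) ->
       ram s2 = ram s1 -> Q s2) ->
  runs (comp_for t x body) s (time_for n W Tb) Q.
Proof.
move=> x_neq0 sn n_lt sx_lt W_gt0 entry step exit.
apply: (@runs_mono _ _ (W + 2 + (W + 2 + (n * (2 * W + 2 + Tb) + 1 + (W + 2)))) _ Q) => //.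
  by rewrite /time_for; lia.
apply: runs_seq; apply: runs_mov; rewrite ?regE // => s1 s01 s1t s1m.
have s1_0 : reg s1 (rv 0) = n by rewrite s01 /= ?regE.
apply: runs_seq; apply: runs_mov; rewrite ?s1_0 ?regE // => s2 s12 s2x s2m.
have s2t : reg s2 (rt t) = reg s (rv x) by rewrite s12 /= ?regE.
apply: runs_seq; apply: runs_mono (runs_countdown s2x n_lt W_gt0 _ step) => //; last first.
  apply: entry; last by rewrite s2m.
  apply: (agree_trans (agree_sub _ s01)); last first.
    by apply: agree_sub s12 => r; rewrite !inE => ->.
  by move=> r /eqP->; apply: sub_temps_or; rewrite [_ \in _]temps_rt.
move=> s3 [inv3 s3t]; rewrite s2t in s3t.
apply: runs_mov; rewrite ?s3t ?regE // => s4 s34 s4x s4m.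
exact: exit inv3 s34 s4x s4m.
Qed.
End CountingLoop.

(** ** Correctness of the compiler *)

Lemma bitsE_gt0 q W e : 0 < W -> 0 < bitsE q W e.
Proof. by move=> W_gt0; elim: e => //=; lia. Qed.

Lemma sum_lt_exp2 q m n b (f : nat -> nat) : n <= q -> (forall i, i < n -> f i < 2 ^ b) ->
  \sum_(m <= i < n) f i < 2 ^ (q.+1 * b.+1).
Proof.
move=> nq f_lt; have : \sum_(m <= i < n) f i <= (n - m) * 2 ^ b.
  rewrite -sum_nat_const_nat big_nat [leqRHS]big_nat.
  by apply: leq_sum => i /andP[_ /f_lt/ltnW].
move/leq_ltn_trans; apply; have n_lt : n < 2 ^ n by apply: ltn_expl.
have : (n - m) * 2 ^ b < 2 ^ (n + b) by rewrite expnD ltn_pmul2r ?expn_gt0; lia.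
by move/leq_trans; apply; rewrite leq_exp2l //; nia.
Qed.

Lemma prod_lt_exp2 q m n b (f : nat -> nat) : n <= q -> (forall i, i < n -> f i < 2 ^ b) ->
  \prod_(m <= i < n) f i < 2 ^ (q.+1 * b.+1).
Proof.
move=> nq f_lt; have : \prod_(m <= i < n) f i <= 2 ^ ((n - m) * b).
  rewrite mulnC expnM -prod_nat_const_nat big_nat [leqRHS]big_nat.
  by apply: leq_prod => i /andP[_ /f_lt/ltnW].
by move/leq_ltn_trans; apply; rewrite ltn_exp2l //; nia.
Qed.

Section Compiler.
Variables (q W L : nat).
Hypotheses (qW : q < 2 ^ W) (LW : L < 2 ^ W) (W_gt0 : 0 < W).
Implicit Types (A B : memory) (s : state) (t x : nat).

Definition bounded_env (s : env) : Prop := s 0 <= q /\ forall x, s x < 2 ^ W.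

Definition bounded_mem (A : memory) : Prop := forall k i, A k i < 2 ^ W.

Definition represents (A : memory) (s : state) : Prop :=
  reg s 0 = L /\ forall k i, k < nkeys -> (k == 0 -> i <= L) ->
    ram s (address L k i) = A k i.

Definition env_of (s : state) : env := fun x => reg s (rv x).

Definition ready (A : memory) (s : state) : Prop :=
  [/\ bounded_mem A, bounded_env (env_of s) & represents A s].

Lemma bounded_upd (s : env) x i : bounded_env s -> i < q -> bounded_env (upd s x i).
Proof.
case=> s0 s_lt iq; split; first by rewrite /upd; case: eqP => // _; lia.
by move=> y; rewrite /upd; case: eqP => // _; lia.
Qed.

Lemma bounded_env_ext (s s' : env) : s =1 s' -> bounded_env s -> bounded_env s'.
Proof. by move=> ss' [s0 s_lt]; split => [|x]; rewrite -ss'. Qed.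

Lemma env_agree t s s' : agree (temps t) s s' -> env_of s' =1 env_of s.
Proof. by move=> ss' x; rewrite /env_of ss' // temps_rv. Qed.

Lemma represents_agree X A s s' : ~~ X 0 -> agree X s s' -> ram s' = ram s ->
  represents A s -> represents A s'.
Proof. by move=> X0 ss' mem_eq [L_reg A_ram]; split; rewrite ?mem_eq ?ss'. Qed.

Lemma ready_agree t A s s' : agree (temps t) s s' -> ram s' = ram s ->
  ready A s -> ready A s'.
Proof.
move=> ss' mem_eq [bA bs As]; split=> //; last exact: represents_agree ss' mem_eq As.
by apply: bounded_env_ext bs => x; rewrite (env_agree ss').
Qed.

Lemma evalE_lt A e (s : env) : bounded_mem A -> bounded_env s ->
  evalE L s A e < 2 ^ bitsE q W e.
Proof.
move=> bA; elim: e s => /= [x|c|o a IHa b IHb|k a IHa|c IHc a IHa b IHb|o x e IH] s bs.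
- by case: bs.
- exact: leq_trans (ltn_expl _ _) (leq_pexp2l _ (leqnSn _)).
- rewrite expnS expnD; have := IHa s bs; have := IHb s bs.
  set u := evalE _ _ _ a; set v := evalE _ _ _ b.
  by case: o => /=; try nia; have := leq_div u v; nia.
- exact: bA.
- by case: ifP => _; [apply: leq_trans (IHa s bs) _ | apply: leq_trans (IHb s bs) _];
    rewrite leq_pexp2l ?leq_addr ?leq_addl.
have [s0_le _] := bs; have e_lt i : i < s 0 -> evalE L (upd s x i) A e < 2 ^ bitsE q W e.
  by move=> i_lt; apply: IH; apply: bounded_upd => //; apply: leq_trans s0_le.
by case: o; [apply: sum_lt_exp2 | apply: prod_lt_exp2].
Qed.

Lemma evalE_bitlen A e (s : env) : bounded_mem A -> bounded_env s ->
  bitlen (evalE L s A e) <= bitsE q W e.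
Proof. by move=> bA bs; apply: bitlen_le (evalE_lt _ bA bs) (bitsE_gt0 q e W_gt0). Qed.

Lemma bounded_evalP p (s : env) A : bounded_env s -> bounded_mem A ->
  bounded_mem (evalP L p s A).
Proof.
elim: p s A => [k a e|p1 IH1 p2 IH2|x p IH] s A bs bA /=.
- move=> k' i; rewrite /updm /upd; case: eqP => // _; case: eqP => // _.
  by apply: leq_ltn_trans (geq_minr _ _) _; case: bs.
- by apply: IH2 => //; apply: IH1.
have : s 0 <= q by case: bs.
elim: (s 0) A bA => //= n IHn A bA nq; apply: IHn; last exact: ltnW.
by apply: IH => //; apply: bounded_upd.
Qed.

Lemma clamp_le k i : k == 0 -> clamp L k i <= L.
Proof. by rewrite /clamp => ->; apply: geq_minr. Qed.

Lemma address_inj k i k' i' : k < nkeys -> k' < nkeys -> (k == 0 -> i <= L) ->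
  (k' == 0 -> i' <= L) -> (address L k i == address L k' i') = (k == k') && (i == i').
Proof. by rewrite /address /nkeys; case: eqP => ?; case: eqP => ? *; lia. Qed.

Lemma address_lt k i b : k < nkeys -> i < 2 ^ b ->
  address L k (clamp L k i) < 2 ^ (b + W + 6).
Proof.
move=> k_lt i_lt; rewrite !expnD (_ : 2 ^ 6 = 64) // /address /clamp.
move: (2 ^ b) (2 ^ W) i_lt LW k_lt => B V i_lt L_lt; rewrite /nkeys => k_lt.
by case: eqP => _; nia.
Qed.

Lemma represents_updm A s k i v : represents A s -> k < nkeys -> (k == 0 -> i <= L) ->
  represents (updm A k i v) (set_ram s (address L k i) v).
Proof.
case=> L_reg A_ram k_lt i_le; split=> //= k' i' k'_lt i'_le.
rewrite /updm /upd address_inj // eq_sym; case: eqP => [->|_] /=; last exact: A_ram.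
by rewrite eq_sym; case: ifP => // _; apply: A_ram.
Qed.

Definition yields t (v : nat) s s' : Prop :=
  [/\ reg s' (rt t) = v, agree (temps t) s s' & ram s' = ram s].

Lemma runs_comp_address t k b s : k < nkeys -> reg s (rt t) < 2 ^ b -> 0 < b ->
    reg s 0 = L ->
  runs (comp_address t k) s (time_address W k b)
    (yields t (address L k (clamp L k (reg s (rt t)))) s).
Proof.
move=> k_lt; set i := reg s (rt t) => i_lt b_gt0 L_reg.
have bits_i : bitlen i <= b by apply: bitlen_le.
have bits_L : bitlen L <= W by apply: bitlen_le.
have rt_neq0 u : (0 == rt u) = false by rewrite /rt; lia.
rewrite /comp_address /address /clamp /time_address; case: eqP => _.
  have bits_iL : bitlen (i - L) <= b by apply: bitlen_le => //; lia.
  apply: (@runs_mono _ _ ((b + W) + (b + b)) _ _ _ _ (fun _ => id)); first by lia.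
  apply: runs_seq; apply: runs_arith; first by rewrite L_reg leq_add.
  apply: runs_arith; first by rewrite /= /upd !regE -/i L_reg leq_add.
  split; [|by repeat apply: agree_set_temp|by []].
  by rewrite /= /upd !regE -/i L_reg; lia.
have bits_k : bitlen k.+1 <= 6.
  by apply: bitlen_le => //; rewrite (_ : 2 ^ 6 = 64) //; move: k_lt; rewrite /nkeys; lia.
have bits_ik : bitlen (i * nkeys) <= b + 6.
  by apply: bitlen_le; [rewrite expnD /nkeys; lia | lia].
have bits_ikk : bitlen (i * nkeys + k.+1) <= b + 6.
  by apply: bitlen_le; [move: k_lt; rewrite expnD /nkeys; lia | lia].
apply: (@runs_mono _ _ (6 + (b + 6 + (6 + (b + 6 + 6 + (b + 6 + W)))))
  _ _ _ _ (fun _ => id)); first by rewrite /nkeys; lia.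
apply: runs_seq; apply: runs_const => //.
apply: runs_seq; apply: runs_arith; first by rewrite /= /upd !regE -/i leq_add.
apply: runs_seq; apply: runs_const => //.
apply: runs_seq; apply: runs_arith; first by rewrite /= /upd !regE -/i leq_add.
apply: runs_arith; first by rewrite /= /upd !regE !rt_neq0 -/i L_reg leq_add.
split; [|by repeat apply: agree_set_temp|by []].
by rewrite /= /upd !regE !rt_neq0 -/i L_reg.
Qed.

Section Iteration.
Variables (t x n : nat) (s s1 : state).
Hypothesis loop_agree : agree (temps_or t x) s s1.

Lemma env_decrement t' i : env_of (decrement t' x i s1) =1 upd (env_of s) x i.
Proof.
move=> y; rewrite /env_of /= /upd !regE; case: eqVneq => // yx.
by apply: loop_agree; rewrite /temps_or /= rv_inj (negbTE yx) temps_rv.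
Qed.

Lemma ready_decrement t' i A : bounded_env (env_of s) -> i < q -> bounded_mem A ->
  represents A s1 -> ready A (decrement t' x i s1).
Proof.
move=> bs iq bA [L_reg A_ram]; split=> //.
by apply: bounded_env_ext (bounded_upd x bs iq) => y; rewrite env_decrement.
Qed.

Lemma agree_restore s2 : agree (pred1 (rv x)) s1 s2 -> reg s2 (rv x) = reg s (rv x) ->
  agree (temps t) s s2.
Proof.
move=> s12 s2x r r_temp; have [->|rx] := eqVneq r (rv x); first exact: s2x.
by rewrite s12 // loop_agree // /temps_or /= negb_or rx.
Qed.
End Iteration.

Lemma time_for_le n T : n <= q -> time_for n W T <= time_for q W T.
Proof. by move=> nq; rewrite /time_for leq_add2r leq_add2l leq_mul2r nq orbT. Qed.

Section Expressions.
Variable A : memory.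

Definition compilesE (e : expr) : Prop := forall t s, ready A s ->
  runs (compE t e) s (timeE q W e) (yields t (evalE L (env_of s) A e) s).

Lemma compiles_var x : compilesE (Var x).
Proof.
move=> t s [_ [_ s_lt] _]; apply: (@runs_mov _ _ _ W); rewrite ?regE //.
  exact: s_lt.
move=> s1 s01 s1t s1m; split=> //.
by apply: agree_sub s01 => r /eqP->; rewrite [_ \in _]temps_rt.
Qed.

Lemma compiles_cst c : compilesE (Cst c).
Proof.
move=> t s _; apply: runs_const.
  by apply: bitlen_le => //; apply: leq_trans (ltn_expl _ _) (leq_pexp2l _ (leqnSn _)).
by split; [rewrite /= /upd eqxx | exact: agree_set_temp |].
Qed.

Lemma compiles_bin o a b : compilesE a -> compilesE b -> compilesE (Bin o a b).
Proof.
move=> run_a run_b t s sA; have [bA bs _] := sA.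
apply: runs_seq; apply: runs_mono (leqnn _) _ (run_a t s sA) => s1 [s1t s01 s1m].
have s1A := ready_agree s01 s1m sA.
apply: runs_seq; apply: runs_mono (leqnn _) _ (run_b t.+1 s1 s1A) => s2 [s2t s12 s2m].
have s2a : reg s2 (rt t) = evalE L (env_of s) A a by rewrite s12 ?temps_rt ?ltnn.
rewrite (evalE_ext _ _ _ (env_agree s01)) in s2t.
apply: runs_arith; first by rewrite s2a s2t leq_add ?evalE_bitlen.
split; [by rewrite /= /upd eqxx s2a s2t | | by rewrite /= s2m].
exact: agree_set_temp (agree_trans s01 (agree_sub (sub_temps (leqnSn t)) s12)).
Qed.

Lemma compiles_rd k a : k < nkeys -> compilesE a -> compilesE (Rd k a).
Proof.
move=> k_lt run_a t s sA; have [bA bs _] := sA.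
apply: runs_seq; apply: runs_mono (leqnn _) _ (run_a t s sA) => s1 [s1t s01 s1m].
have [_ _ [L_reg A_ram]] := ready_agree s01 s1m sA.
apply: runs_seq.
apply: runs_mono (leqnn _) _ (runs_comp_address k_lt _ (bitsE_gt0 q a W_gt0) L_reg); last first.
  by rewrite s1t evalE_lt.
move=> s2 [s2t s12 s2m]; rewrite s1t in s2t.
have read_eq : ram s2 (reg s2 (rt t)) = evalE L (env_of s) A (Rd k a).
  by rewrite s2m s2t A_ram //; apply: clamp_le.
apply: runs_read; rewrite read_eq ?s2t.
  by rewrite leq_add ?bitlen_le ?address_lt ?evalE_lt ?ltn_addl.
split; [by rewrite /= /upd eqxx | | by rewrite /= s2m].
exact: agree_set_temp (agree_trans s01 s12).
Qed.

Lemma compiles_ite c a b :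
  compilesE c -> compilesE a -> compilesE b -> compilesE (Ite c a b).
Proof.
move=> run_c run_a run_b t s sA /=; have [bA bs _] := sA.
apply: runs_seq; apply: runs_mono (leqnn _) _ (run_c t s sA) => s1 [s1t s01 s1m].
have s1A := ready_agree s01 s1m sA; have env1 := env_agree s01.
apply: runs_mono _ (fun _ => id) (runs_if (T := timeE q W a + timeE q W b) _).
  by rewrite s1t leq_add2r evalE_bitlen.
rewrite s1t; case: ifP => _.
  apply: runs_mono (leq_addr _ _) _ (run_a t s1 s1A) => s2 [s2t s12 s2m].
  rewrite (evalE_ext _ _ _ env1) in s2t.
  by split=> //; [exact: agree_trans s12 | rewrite s2m].
apply: runs_mono (leq_addl _ _) _ (run_b t s1 s1A) => s2 [s2t s12 s2m].
rewrite (evalE_ext _ _ _ env1) in s2t.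
by split=> //; [exact: agree_trans s12 | rewrite s2m].
Qed.

Section BigOperator.
Variables (o : bigop_kind) (x t : nat) (e : expr) (s : state).
Hypotheses (run_e : compilesE e) (x_neq0 : x != 0) (sA : ready A s).

Let n : nat := env_of s 0.

Definition iterand (i : nat) : nat := evalE L (upd (env_of s) x i) A e.

Definition partial_big (i : nat) : nat :=
  if o is BSum then \sum_(i <= j < n) iterand j else \prod_(i <= j < n) iterand j.

Definition big_inv (i : nat) (s1 : state) : Prop :=
  [/\ reg s1 (rt t) = partial_big i, agree (temps_or t x) s s1 & ram s1 = ram s].

Let n_le : n <= q. Proof. by case: sA => _ []. Qed.

Lemma iterand_lt i : i < n -> iterand i < 2 ^ bitsE q W e.
Proof.
have [bA bs _] := sA; move=> i_lt.
by apply: evalE_lt (bounded_upd _ bs (leq_trans i_lt n_le)).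
Qed.

Lemma partial_big_bitlen i : bitlen (partial_big i) <= q.+1 * (bitsE q W e).+1.
Proof.
apply: bitlen_le; rewrite ?muln_gt0 // /partial_big; have := iterand_lt.
by case: (o); [apply: sum_lt_exp2 | apply: prod_lt_exp2].
Qed.

Lemma partial_bigS i : i < n ->
  partial_big i = eval_arith (bigop_arith o) (partial_big i.+1) (iterand i).
Proof.
by move=> i_lt; rewrite /partial_big; case: (o); rewrite /= big_ltn // 1?addnC 1?mulnC.
Qed.

Lemma big_inv_init s1 : agree (temps_or t.+1 x) (set_reg s (rt t) (bigop_idx o)) s1 ->
  ram s1 = ram s -> big_inv n s1.
Proof.
move=> s's1 s1m; split=> //.
  rewrite s's1 /= /upd ?eqxx; last by rewrite /temps_or /= rt_rv temps_rt ltnn.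
  by rewrite /partial_big; case: (o); rewrite big_geq.
apply: (@agree_trans _ _ (set_reg s (rt t) (bigop_idx o))).
  by apply: agree_set_reg; rewrite /temps_or /= temps_rt leqnn orbT.
apply: agree_sub s's1 => r /orP[rx|/(sub_temps (leqnSn t)) rt_r]; apply/orP; [by left | by right].
Qed.

Lemma big_inv_step i s1 : i < n -> big_inv i.+1 s1 ->
  runs (Seq (compE t.+2 e) (Arith (bigop_arith o) (rt t) (rt t) (rt t.+2)))
    (decrement t.+1 x i s1) (timeE q W e + (q.+1 * (bitsE q W e).+1 + bitsE q W e))
    (fun s2 => [/\ big_inv i s2, reg s2 (rv x) = i & reg s2 (rt t.+1) = reg s1 (rt t.+1)]).
Proof.
move=> i_lt [s1t s01 s1m]; have [bA bs As] := sA; have iq := leq_trans i_lt n_le.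
have s1A : represents A s1 by apply: represents_agree s01 s1m As; rewrite /temps_or.
apply: runs_seq.
apply: runs_mono (leqnn _) _ (run_e t.+2 (ready_decrement s01 t.+1 bs iq bA s1A)).
move=> s2 [s2t s12 s2m]; rewrite (evalE_ext _ _ _ (env_decrement s01 _ _)) -/(iterand i) in s2t.
have s2_acc : reg s2 (rt t) = partial_big i.+1.
  by rewrite s12 ?temps_rt 1?ltnNge ?leqW //= /upd !regE.
apply: runs_arith.
  by rewrite s2_acc s2t leq_add ?partial_big_bitlen ?bitlen_le ?iterand_lt ?bitsE_gt0.
split; last 2 first.
- by rewrite /= /upd !regE s12 ?temps_rv //= /upd !regE.
- by rewrite /= /upd !regE s12 ?temps_rt ?ltnn //= /upd !regE.
split; [by rewrite /= /upd eqxx s2_acc s2t -partial_bigS | | by rewrite /= s2m].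
move=> r r_temp; have [r_x r_t] := norP r_temp.
have r_neq u : t <= u -> r != rt u by move=> tu; apply: contraNneq r_t => ->; rewrite temps_rt.
have r_t2 : ~~ temps t.+2 r by apply: contra r_t; apply: (sub_temps (leqW (leqnSn t))).
rewrite /= /upd (negbTE (r_neq t _)) // s12 // /= /upd (negbTE r_x).
by rewrite (negbTE (r_neq t.+2 _)) ?s01 // leqW.
Qed.

Lemma runs_big : runs (compE t (Big o x e)) s (timeE q W (Big o x e))
  (yields t (evalE L (env_of s) A (Big o x e)) s).
Proof.
have [_ [_ s_lt] _] := sA.
have -> : evalE L (env_of s) A (Big o x e) = partial_big 0 by rewrite /partial_big /=; case: (o).
apply: runs_seq; apply: runs_const; first by case: (o).
have var_eq y : reg (set_reg s (rt t) (bigop_idx o)) (rv y) = reg s (rv y).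
  by rewrite /= /upd rv_rt.
apply: runs_mono (time_for_le _ n_le) (fun _ => id) _.
apply: (@runs_for t.+1 x W _ _ big_inv) => //.
- exact: s_lt.
- by rewrite var_eq; apply: s_lt.
- exact: big_inv_init.
- exact: big_inv_step.
move=> s1 s2 [s1t s01 s1m] s12 s2x s2m; split; last by rewrite s2m.
  by rewrite s12 //= rt_rv.
by apply: agree_restore s01 _ s12 _; rewrite s2x var_eq.
Qed.
End BigOperator.

Lemma runs_compE e : wfE e -> compilesE e.
Proof.
elim: e => [x|c|o a IHa b IHb|k a IHa|c IHc a IHa b IHb|o x e IH] /=.
- by move=> _; apply: compiles_var.
- by move=> _; apply: compiles_cst.
- by case/andP=> /IHa run_a /IHb run_b; apply: compiles_bin.
- by case/andP=> k_lt /IHa run_a; apply: compiles_rd.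
- by case/and3P=> /IHc run_c /IHa run_a /IHb run_b; apply: compiles_ite.
by case/andP=> x_neq0 /IH run_e t s sA; apply: runs_big.
Qed.
End Expressions.

Definition compilesP (p : prog) : Prop := forall A t s, ready A s ->
  runs (compP t p) s (timeP q W p)
    (fun s' => represents (evalP L p (env_of s) A) s' /\ agree (temps t) s s').

Lemma compiles_wr k a e : k < nkeys -> wfE a -> wfE e -> compilesP (Wr k a e).
Proof.
move=> k_lt wa we A t s sA; have [bA bs As] := sA.
set i := evalE L (env_of s) A a; set v := evalE L (env_of s) A e; set cap := env_of s 1.
have i_lt : i < 2 ^ bitsE q W a by apply: evalE_lt.
have v_lt : v < 2 ^ bitsE q W e by apply: evalE_lt.
have cap_lt : cap < 2 ^ W by case: bs => _; apply.
apply: runs_seq; apply: runs_seq; apply: runs_mono (leqnn _) _ (runs_compE wa t sA).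
move=> s1 [s1t s01 s1m]; have [_ _ [L_reg _]] := ready_agree s01 s1m sA.
apply: runs_mono (leqnn _) _ (runs_comp_address k_lt _ (bitsE_gt0 q a W_gt0) L_reg); last first.
  by rewrite s1t.
move=> s2 [s2t s12 s2m]; rewrite s1t -/i in s2t.
have s02 := agree_trans s01 s12; have s02m : ram s2 = ram s by rewrite s2m.
apply: runs_seq; apply: runs_mono (leqnn _) _ (runs_compE we t.+1 (ready_agree s02 s02m sA)).
move=> s3 [s3t s23 s3m]; rewrite (evalE_ext _ _ _ (env_agree s02)) -/v in s3t.
have s03 := agree_trans s02 (agree_sub (sub_temps (leqnSn t)) s23).
have s3_addr : reg s3 (rt t) = address L k (clamp L k i) by rewrite s23 ?temps_rt ?ltnn.
have s3_cap : reg s3 (rv 1) = cap by apply: env_agree s03 1.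
have [bits_v bits_cap] : bitlen v <= bitsE q W e /\ bitlen cap <= W.
  by split; apply: bitlen_le; rewrite ?bitsE_gt0.
have bits_sub u : bitlen (v - u) <= bitsE q W e.
  by apply: bitlen_le (bitsE_gt0 q e W_gt0); apply: leq_ltn_trans (leq_subr _ _) v_lt.
have bits_addr := bitlen_le (address_lt k_lt i_lt) (ltn_addl _ (isT : 0 < 6)).
apply: (@runs_mono _ _ ((bitsE q W e + W) + ((bitsE q W e + bitsE q W e) +
  (bitsE q W a + W + 6 + bitsE q W e))) _ _ _ _ (fun _ => id)); first by lia.
apply: runs_seq; apply: runs_arith; first by rewrite s3t s3_cap leq_add.
rewrite s3t s3_cap; set s4 := set_reg s3 _ _.
have [s4t s4t'] : reg s4 (rt t.+1) = v /\ reg s4 (rt t.+2) = v - cap.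
  by rewrite /s4 /= /upd !regE.
apply: runs_seq; apply: runs_arith; first by rewrite s4t s4t' leq_add.
rewrite s4t s4t'; set s5 := set_reg s4 _ _.
have s5_addr : reg s5 (rt t) = address L k (clamp L k i) by rewrite /s5 /= /upd !regE.
have s5_val : reg s5 (rt t.+1) = minn v cap by rewrite /s5 /= /upd !regE /=; lia.
apply: runs_write; rewrite s5_addr s5_val.
  by rewrite leq_add // (_ : minn v cap = v - (v - cap)) //; lia.
have s05 : agree (temps t) s s5.
  by apply: agree_set_temp (leqnSn t) (agree_set_temp _ (leqW (leqnSn t)) s03).
split; last exact: s05.
apply: represents_updm (clamp_le _) => //.
by apply: represents_agree s05 _ As; rewrite //= s3m.
Qed.

Lemma compiles_pseq p1 p2 : compilesP p1 -> compilesP p2 -> compilesP (PSeq p1 p2).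
Proof.
move=> run1 run2 A t s sA; have [bA bs _] := sA.
apply: runs_seq; apply: runs_mono (leqnn _) _ (run1 A t s sA) => s1 [s1A s01].
have env1 := env_agree s01.
apply: runs_mono (leqnn _) _ (run2 _ t s1 _) => [s2 [s2A s12]|].
  by rewrite (evalP_ext _ _ _ env1) in s2A; split; [exact: s2A | exact: agree_trans s01 s12].
split=> //; first exact: bounded_evalP.
by apply: bounded_env_ext bs => y; rewrite env1.
Qed.

Section ForLoop.
Variables (x t : nat) (p : prog) (A : memory) (s : state).
Hypotheses (run_p : compilesP p) (x_neq0 : x != 0) (sA : ready A s).

Let n : nat := env_of s 0.
Let body (i : nat) (B : memory) : memory := evalP L p (upd (env_of s) x i) B.

Definition for_inv (i : nat) (s1 : state) : Prop := exists B,
  [/\ bounded_mem B, represents B s1, loop i body B = loop n body A & agree (temps_or t x) s s1].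

Let n_le : n <= q. Proof. by case: sA => _ []. Qed.

Lemma for_inv_step i s1 : i < n -> for_inv i.+1 s1 ->
  runs (compP t.+1 p) (decrement t x i s1) (timeP q W p)
    (fun s2 => [/\ for_inv i s2, reg s2 (rv x) = i & reg s2 (rt t) = reg s1 (rt t)]).
Proof.
move=> i_lt [B [bB s1B loopE s01]]; have [_ bs _] := sA; have iq := leq_trans i_lt n_le.
apply: runs_mono (leqnn _) _ (run_p t.+1 (ready_decrement s01 t bs iq bB s1B)).
move=> s2 [s2B s12]; rewrite (evalP_ext _ _ _ (env_decrement s01 t i)) -/(body i B) in s2B.
split; last 2 first.
- by rewrite s12 ?temps_rv //= /upd eqxx.
- by rewrite s12 ?temps_rt ?ltnn //= /upd !regE.
exists (body i B); split=> //; first exact: bounded_evalP (bounded_upd x bs iq) bB.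
move=> r r_temp; have [r_x r_t] := norP r_temp.
rewrite s12; last by apply: contra r_t; apply: sub_temps (leqnSn t) r.
rewrite /= /upd (negbTE r_x) ifN ?s01 //.
by apply: contraNneq r_t => ->; rewrite temps_rt.
Qed.

Lemma runs_For : runs (compP t (For x p)) s (timeP q W (For x p))
  (fun s' => represents (evalP L (For x p) (env_of s) A) s' /\ agree (temps t) s s').
Proof.
have [bA [_ s_lt] As] := sA.
apply: runs_mono (time_for_le _ n_le) (fun _ => id) _.
apply: (@runs_for t x W _ _ for_inv) => //; [exact: s_lt | exact: s_lt | | exact: for_inv_step |].
  move=> s1 s01 s1m; exists A; split=> //; apply: represents_agree s01 s1m As.
  by rewrite /temps_or.
move=> s1 s2 [B [_ s1B loopE s01]] s12 s2x s2m; split; last exact: agree_restore s01 _ s12 s2x.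
by rewrite /= -/n -loopE /=; apply: represents_agree s12 s2m s1B.
Qed.
End ForLoop.

Lemma runs_compP p : wfP p -> compilesP p.
Proof.
elim: p => [k a e|p1 IH1 p2 IH2|x p IH] /=.
- by case/and3P; apply: compiles_wr.
- by case/andP=> /IH1 run1 /IH2 run2; apply: compiles_pseq.
by case/andP=> x_neq0 /IH run_p A t s sA; apply: runs_For.
Qed.
End Compiler.

Definition poly_bounded (f : nat -> nat) : Prop :=
  exists p : {poly nat}, forall x, f x <= p.[x]%R.

Lemma poly_bounded_const c : poly_bounded (fun=> c).
Proof. by exists (c%:P)%R => x; rewrite hornerC. Qed.

Lemma poly_bounded_id : poly_bounded id.
Proof. by exists 'X%R => x; rewrite hornerX. Qed.

Lemma poly_bounded_add f g :
  poly_bounded f -> poly_bounded g -> poly_bounded (fun x => f x + g x).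
Proof. by case=> p fp [r gr]; exists (p + r)%R => x; rewrite hornerD leq_add. Qed.

Lemma poly_bounded_mul f g :
  poly_bounded f -> poly_bounded g -> poly_bounded (fun x => f x * g x).
Proof. by case=> p fp [r gr]; exists (p * r)%R => x; rewrite hornerM leq_mul. Qed.

Lemma poly_bounded_succ f : poly_bounded f -> poly_bounded (fun x => (f x).+1).
Proof. by case=> p fp; exists (p + 1)%R => x; rewrite hornerD hornerC natrDE addn1 ltnS. Qed.

Lemma poly_bounded_exp f n : poly_bounded f -> poly_bounded (fun x => f x ^ n).
Proof.
case: n => [|n] [p fp]; first by exists 1%R => x; rewrite hornerC.
by exists (p ^+ n.+1)%R => x; rewrite horner_exp natrXE leq_exp2r.
Qed.

Lemma leq_horner_nat (p : {poly nat}) x y : x <= y -> p.[x]%R <= p.[y]%R.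
Proof.
move=> xy; elim/poly_ind: p => [|p c IH]; first by rewrite !horner0.
by rewrite !hornerMXaddC; apply: leq_add => //; apply: leq_mul.
Qed.

Ltac solve_poly_bounded := repeat first
  [ assumption | apply: poly_bounded_const | apply: poly_bounded_id
  | apply: poly_bounded_succ | apply: poly_bounded_mul | apply: poly_bounded_add ].

Lemma poly_bounded_bitsE e : poly_bounded (fun q => bitsE q q.+1 e).
Proof. by elim: e => /= *; solve_poly_bounded. Qed.

Lemma poly_bounded_timeE e : poly_bounded (fun q => timeE q q.+1 e).
Proof.
by elim: e => /= *; rewrite /time_for /time_address;
  repeat first [apply: poly_bounded_bitsE | progress solve_poly_bounded].
Qed.

Lemma poly_bounded_timeP p : poly_bounded (fun q => timeP q q.+1 p).
Proof.
by elim: p => /= *; rewrite /time_for /time_address;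
  repeat first [apply: poly_bounded_bitsE | apply: poly_bounded_timeE
               | progress solve_poly_bounded].
Qed.

(** ** The complete machine *)

Definition nbits (v : nat) : nat := if v == 0 then 0 else bitlen v.

Lemma nbits_half v : 0 < v -> nbits v = (nbits (v %/ 2)).+1.
Proof.
rewrite /nbits /bitlen => v_gt0; rewrite (negbTE (lt0n_neq0 v_gt0)).
case: eqP => half0; first by have -> : v = 1 by lia.
by rewrite trunc_log2S ?divn2 //; lia.
Qed.

Lemma nbits_lt v : v < 2 ^ nbits v.
Proof. by rewrite /nbits; case: eqP => [->//|_]; apply: trunc_log_ltn. Qed.

Lemma nbits_le v b : v < 2 ^ b -> nbits v <= b.
Proof.
rewrite /nbits; case: eqP => // v_neq0 v_lt; apply: bitlen_le => //.
by case: b v_lt => //; rewrite expn0; lia.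
Qed.

Definition count_bits : cmd :=
  While (rt 0)
    (Seq (Const (rt 1) 2) (Seq (Arith Defs.Div (rt 0) (rt 0) (rt 1))
    (Seq (Const (rt 1) 1) (Arith Defs.Add (rv 2) (rv 2) (rt 1))))).

Lemma runs_count_bits W s v : reg s (rt 0) = v -> v < 2 ^ W ->
    reg s (rv 2) + nbits v < 2 ^ W -> 0 < W ->
  runs count_bits s (nbits v * (3 * W + 6) + 1)
    (fun s' => [/\ env_of s' =1 upd (env_of s) 2 (reg s (rv 2) + nbits v),
       reg s' 0 = reg s 0 & ram s' = ram s]).
Proof.
move=> + + + W_gt0; elim/ltn_ind: v s => v IH s sv v_lt sum_lt.
case: (posnP v) => [v0|v_gt0].
  rewrite v0 in sv *; apply: runs_while_stop; rewrite ?addn1 // addn0.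
  by split=> // x; rewrite /upd; case: eqP => [->|].
have bits_v : bitlen v <= W by apply: bitlen_le.
have bits_s : bitlen (reg s (rv 2)) <= W by apply: bitlen_le => //; lia.
rewrite (nbits_half v_gt0) in sum_lt *.
apply: (@runs_while_step _ _ _ (2 + (W + 2 + (1 + (W + 1)))) (nbits (v %/ 2) * (3 * W + 6) + 1)).
- by rewrite sv -lt0n.
- by rewrite sv mulSn; lia.
apply: runs_seq; apply: runs_const => //.
apply: runs_seq; apply: runs_arith; first by rewrite /= /upd !regE sv leq_add.
apply: runs_seq; apply: runs_const => //.
apply: runs_arith; first by rewrite /= /upd !regE leq_add.
set s' := set_reg _ (rv 2) _.
have s'v : reg s' (rt 0) = v %/ 2 by rewrite /s' /= /upd !regE sv.
have s'2 : reg s' (rv 2) = reg s (rv 2) + 1 by rewrite /s' /= /upd !regE.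
apply: runs_mono (leqnn _) _ (IH _ _ s' s'v _ _) => [s1 [s1_env s1_L s1m]|||].
- split=> // x.
  rewrite s1_env s'2 /upd; case: (x =P 2) => [_|x2]; first by rewrite -addnA.
  by rewrite /env_of /s' /= /upd !regE; case: eqP.
- by lia.
- by apply: leq_ltn_trans (leq_div _ _) v_lt.
- by rewrite s'2 -addnA add1n.
Qed.

Definition assign (x : nat) (e : expr) : cmd := Seq (compE 0 e) (mov (rv x) (rt 0)).

Definition set_length (e : expr) : cmd := Seq (compE 0 e) (mov 0 (rt 0)).

Definition time_assign (q W : nat) (e : expr) : nat := timeE q W e + (bitsE q W e + 2).

(* The input fills the addresses below its length, so it is also the initial memory
   of the loop programs. *)
Definition input_mem (input : seq nat) (L : nat) : memory :=
  fun k i => nth 0 input (address L k i).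

Section Assignments.
Variables (input : seq nat) (q W : nat).
Hypotheses (qW : q < 2 ^ W) (W_gt0 : 0 < W) (input_lt : forall i, nth 0 input i < 2 ^ W).

Definition at_env (L : nat) (v : env) (s : state) : Prop :=
  [/\ reg s 0 = L, env_of s =1 v & ram s = nth 0 input].

Lemma at_env_ready L v s : bounded_env q W v -> at_env L v s ->
  ready q W L (input_mem input L) s.
Proof.
move=> bv [sL sv sm]; split=> [k i||].
- exact: input_lt.
- by apply: bounded_env_ext bv => x; rewrite sv.
- by split=> // k i _ _; rewrite sm.
Qed.

Lemma runs_eval L v s e : L < 2 ^ W -> wfE e -> bounded_env q W v -> at_env L v s ->
  runs (compE 0 e) s (timeE q W e)
    (fun s' => at_env L v s' /\ reg s' (rt 0) = evalE L v (input_mem input L) e).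
Proof.
move=> L_lt we bv at_s; have [sL sv sm] := at_s.
apply: runs_mono (leqnn _) _ (runs_compE qW L_lt W_gt0 we 0 (at_env_ready bv at_s)).
move=> s1 [s1t s01 s1m]; rewrite (evalE_ext _ _ _ sv) in s1t; split=> //.
by split; [rewrite s01 | move=> x; rewrite (env_agree s01) sv | rewrite s1m].
Qed.

Lemma runs_eval_mov r L v s e (Q : state -> Prop) :
    L < 2 ^ W -> wfE e -> bounded_env q W v -> at_env L v s -> r != rt 0 ->
    (forall s1 s2, at_env L v s1 -> agree (pred1 r) s1 s2 ->
       reg s2 r = evalE L v (input_mem input L) e -> ram s2 = nth 0 input -> Q s2) ->
  runs (Seq (compE 0 e) (mov r (rt 0))) s (time_assign q W e) Q.
Proof.
move=> L_lt we bv at_s r_neq final.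
apply: runs_seq; apply: runs_mono (leqnn _) _ (runs_eval L_lt we bv at_s) => s1 [at_s1 s1t].
have [_ _ s1m] := at_s1.
apply: runs_mov r_neq _ (bitsE_gt0 q e W_gt0) _.
  by rewrite s1t; apply: evalE_lt => // k i; apply: input_lt.
by move=> s2 s12 s2r s2m; apply: (final _ _ at_s1 s12); rewrite ?s2r ?s2m.
Qed.

Lemma runs_assign x e L v v' s :
    L < 2 ^ W -> wfE e -> bounded_env q W v -> at_env L v s ->
    v' =1 upd v x (evalE L v (input_mem input L) e) ->
  runs (assign x e) s (time_assign q W e) (at_env L v').
Proof.
move=> L_lt we bv at_s v'E; apply: (runs_eval_mov L_lt we bv at_s); first by rewrite rv_rt.
move=> s1 s2 [s1L s1v _] s12 s2x s2m; split=> //; first by rewrite s12.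
move=> y; rewrite v'E /env_of /upd; case: (y =P x) => [->//|yx].
by rewrite s12 /= ?rv_inj; [apply: s1v | apply/eqP].
Qed.

Lemma runs_assign_seq x e c L v v' s T Q :
    L < 2 ^ W -> wfE e -> bounded_env q W v -> at_env L v s ->
    v' =1 upd v x (evalE L v (input_mem input L) e) ->
    (forall s', at_env L v' s' -> runs c s' T Q) ->
  runs (Seq (assign x e) c) s (time_assign q W e + T) Q.
Proof.
move=> L_lt we bv at_s v'E run_c; apply: runs_seq.
exact: runs_mono (leqnn _) run_c (runs_assign L_lt we bv at_s v'E).
Qed.

Lemma runs_set_length e L v s : L < 2 ^ W -> wfE e -> bounded_env q W v -> at_env L v s ->
  runs (set_length e) s (time_assign q W e) (at_env (evalE L v (input_mem input L) e) v).
Proof.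
move=> L_lt we bv at_s; apply: (runs_eval_mov L_lt we bv at_s) => //.
move=> s1 s2 [_ s1v _] s12 s2_0 s2m; split=> // y.
by rewrite /env_of s12 //; apply: s1v.
Qed.
End Assignments.

Definition e_length : expr :=
  Bin Defs.Mul (Cst 2) (Bin Defs.Add (Bin Defs.Add (Bin Defs.Add (Bin Defs.Add
    (Bin Defs.Mul (Var 3) (Var 4)) (Var 3)) (Var 4)) (Var 4)) (Cst 1)).

Definition e_input_prod : expr := Big BProd 5 (Bin Defs.Add (Rd 0 (Var 5)) (Cst 1)).

Definition e_size : expr := Bin Defs.Add (Bin Defs.Add (Var 2) (Var 0)) (Cst 100).

Definition e_square (e : expr) : expr := Bin Defs.Mul e e.

Definition e_bound : expr := e_square (e_square (e_square (e_square (Var 2)))).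

Definition e_cap : expr := Big BProd 5 (Cst 2).

Definition machine (p : prog) : cmd :=
  Seq (Const 0 1)
 (Seq (assign 3 (Rd 0 (Cst 0)))
 (Seq (assign 4 (Rd 0 (Cst 1)))
 (Seq (set_length e_length)
 (Seq (assign 0 e_length)
 (Seq (compE 0 e_input_prod)
 (Seq count_bits
 (Seq (assign 2 e_size)
 (Seq (assign 0 e_bound)
 (Seq (assign 1 e_cap)
      (compP 0 p)))))))))).

Definition time_machine (p : prog) (q : nat) : nat :=
  1 + (time_assign q q.+1 (Rd 0 (Cst 0)) + (time_assign q q.+1 (Rd 0 (Cst 1))
  + (time_assign q q.+1 e_length + (time_assign q q.+1 e_length
  + (timeE q q.+1 e_input_prod + (q * (3 * q.+1 + 6) + 1
  + (time_assign q q.+1 e_size + (time_assign q q.+1 e_bound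
  + (time_assign q q.+1 e_cap + timeP q q.+1 p))))))))).

Section Machine.
Variable input : seq nat.

Definition in_m : nat := nth 0 input 0.
Definition in_n : nat := nth 0 input 1.
Definition in_L : nat := size input.
Definition input_prod : nat := \prod_(0 <= a < in_L) (nth 0 input a + 1).

(* [in_N] exceeds both the number of cells and the bit length of any product of
   distinct cells of the input.  The exponent 16 covers the number of rounds of
   the linear programming subroutine and the growth of the weights. *)
Definition in_N : nat := nbits input_prod + in_L + 100.
Definition in_q : nat := in_N ^ 16.

Definition env0 : env := fun x =>
  match x with
  | 0 => in_q | 1 => 2 ^ in_q | 2 => in_N | 3 => in_m | 4 => in_n | _ => 0
  end.

Definition mem0 : memory := input_mem input in_L.

Lemma in_N_ge100 : 100 <= in_N.
Proof. by rewrite /in_N leq_addl. Qed.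

Lemma in_L_le_N : in_L <= in_N.
Proof. by rewrite /in_N -addnA addnCA leq_addr. Qed.

Lemma in_N_le_q : in_N <= in_q.
Proof. by rewrite -[leqLHS]expn1 leq_pexp2l //; have := in_N_ge100; lia. Qed.

Lemma input_prod_lt : input_prod < 2 ^ in_N.
Proof.
by apply: leq_trans (nbits_lt _) _; rewrite leq_exp2l // /in_N -addnA leq_addr.
Qed.

Lemma input_lt a : nth 0 input a < 2 ^ in_N.
Proof.
case: (ltnP a in_L) => aL; last by rewrite nth_default // expn_gt0.
apply: leq_trans input_prod_lt; rewrite ltnS /input_prod.
rewrite (bigD1_seq a) ?mem_index_iota ?iota_uniq //= -[leqLHS]muln1 leq_mul ?leq_addr //.
by apply: prodn_gt0 => i; rewrite addn1.
Qed.

Lemma in_N_le_bits : in_N <= 2 * bitsize input + 101.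
Proof.
have L_le : in_L <= bitsize input.
  by rewrite /in_L -sum1_size; apply: leq_sum => i _; apply: ltn0Sn.
have prod_le : input_prod <= 2 ^ bitsize input.
  rewrite /input_prod -(big_nth 0 xpredT (fun v => v + 1)) /bitsize expn_sum.
  by apply: leq_prod => i _; rewrite addn1; apply: trunc_log_ltn.
have := @nbits_le _ (bitsize input).+1 (leq_ltn_trans prod_le _).
by rewrite ltn_exp2l // => /(_ (ltnSn _)); rewrite /in_N; lia.
Qed.

(* Variable 1 is set last. *)
Definition prologue_env (a b c d : nat) : env := fun x =>
  match x with 0 => a | 2 => b | 3 => c | 4 => d | _ => 0 end.

Lemma lt_exp_in_q v : v <= in_q -> v < 2 ^ in_q.+1.
Proof. by move=> v_le; apply: leq_ltn_trans (leqW v_le) (ltn_expl _ _). Qed.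

Lemma bounded_prologue_env a b c d : a <= in_q -> b <= in_q -> c <= in_q -> d <= in_q ->
  bounded_env in_q in_q.+1 (prologue_env a b c d).
Proof. by move=> *; split=> // -[|[|[|[|[|x]]]]]; apply: lt_exp_in_q. Qed.

Lemma bounded_env0 : in_m <= in_q -> in_n <= in_q -> bounded_env in_q in_q.+1 env0.
Proof.
move=> m_le n_le; split=> // -[|[|[|[|[|x]]]]] /=; try exact: lt_exp_in_q.
- by rewrite ltn_exp2l.
- exact: lt_exp_in_q in_N_le_q.
Qed.

Hypothesis lengthE : in_L = 2 * (in_m * in_n + in_m + in_n + in_n + 1).

Lemma in_sizes_lt : in_m < in_L /\ in_n < in_L.
Proof. by rewrite lengthE; set mn := in_m * in_n; lia. Qed.

Lemma in_L_le_q : in_L <= in_q.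
Proof. exact: leq_trans in_L_le_N in_N_le_q. Qed.

Lemma evalE_length L a b : evalE L (prologue_env a b in_m in_n) (input_mem input L) e_length = in_L.
Proof. by rewrite lengthE. Qed.

Lemma evalE_input_prod b c d :
  evalE in_L (prologue_env in_L b c d) (input_mem input in_L) e_input_prod = input_prod.
Proof.
rewrite /= /input_prod big_nat [RHS]big_nat; apply: eq_bigr => a /andP[_ a_lt].
by rewrite /input_mem /address /clamp /= /upd /= (minn_idPl (ltnW a_lt)).
Qed.

Lemma evalE_bound c d L A : evalE L (prologue_env in_L in_N c d) A e_bound = in_q.
Proof. by rewrite /= !mulnn -!expnM. Qed.

Lemma evalE_cap c d L A : evalE L (prologue_env in_q in_N c d) A e_cap = 2 ^ in_q.
Proof. by rewrite /= prod_nat_const_nat subn0. Qed.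

Let qW : in_q < 2 ^ in_q.+1. Proof. exact: lt_exp_in_q. Qed.
Let in_lt i : nth 0 input i < 2 ^ in_q.+1.
Proof. by apply: leq_trans (input_lt i) _; rewrite leq_exp2l // leqW // in_N_le_q. Qed.

Lemma runs_bounds c s T Q :
    at_env input in_L (prologue_env in_L 0 in_m in_n) s ->
    (forall s', at_env input in_L env0 s' -> runs c s' T Q) ->
  runs (Seq (compE 0 e_input_prod) (Seq count_bits (Seq (assign 2 e_size)
      (Seq (assign 0 e_bound) (Seq (assign 1 e_cap) c))))) s
    (timeE in_q in_q.+1 e_input_prod + (in_q * (3 * in_q.+1 + 6) + 1
      + (time_assign in_q in_q.+1 e_size + (time_assign in_q in_q.+1 e_bound
      + (time_assign in_q in_q.+1 e_cap + T))))) Q.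
Proof.
move=> at_s run_c; have L_le := in_L_le_q; have L_lt := lt_exp_in_q L_le.
have [m_lt n_lt] := in_sizes_lt; have N_le := in_N_le_q.
have m_le := leq_trans (ltnW m_lt) L_le; have n_le := leq_trans (ltnW n_lt) L_le.
have bits_le : nbits input_prod <= in_q by apply: leq_trans N_le; rewrite /in_N; lia.
have bounded a b : a <= in_q -> b <= in_q ->
    bounded_env in_q in_q.+1 (prologue_env a b in_m in_n).
  by move=> *; apply: bounded_prologue_env.
apply: runs_seq.
apply: runs_mono (leqnn _) _ (runs_eval (e := e_input_prod) qW isT in_lt L_lt isT
  (bounded _ 0 L_le isT) at_s).
move=> s1 [[s1L s1v s1m]]; rewrite evalE_input_prod => s1_prod.
have s1_2 : reg s1 (rv 2) = 0 by have := s1v 2.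
apply: runs_seq; apply: runs_mono _ _ (@runs_count_bits in_q.+1 s1 input_prod _ _ _ _) => //.
- by rewrite leq_add2r leq_mul2r bits_le orbT.
- move=> s2 [s2v s2L s2m].
  have at_s2 : at_env input in_L (prologue_env in_L (nbits input_prod) in_m in_n) s2.
    split; rewrite ?s2L ?s2m // => x; rewrite s2v s1_2 /upd s1v.
    by case: x => [|[|[|[|[|x]]]]].
  apply: (runs_assign_seq (v' := prologue_env in_L in_N in_m in_n) qW isT in_lt L_lt _ _ at_s2)
    => //.
  + exact: bounded.
  + by case=> [|[|[|[|[|x]]]]].
  move=> s3 at_s3.
  apply: (runs_assign_seq (v' := prologue_env in_q in_N in_m in_n) qW isT in_lt L_lt _ _ at_s3)
    => //.
  + exact: bounded.
  + by rewrite evalE_bound; case=> [|[|[|[|[|x]]]]].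
  move=> s4 at_s4.
  apply: (runs_assign_seq (v' := env0) qW isT in_lt L_lt _ _ at_s4 _ run_c) => //.
  + exact: bounded.
  by rewrite evalE_cap; case=> [|[|[|[|[|x]]]]].
- apply: leq_trans input_prod_lt _; rewrite leq_exp2l //; exact: leqW.
- by rewrite s1_2; apply: lt_exp_in_q.
Qed.

Lemma runs_machine p t : wfP p ->
  runs (machine p) (init input t) (time_machine p in_q)
    (fun s => forall j, j <= in_L -> ram s j = evalP in_L p env0 mem0 0 j).
Proof.
move=> wp; have L_le := in_L_le_q; have L_lt := lt_exp_in_q L_le.
have [m_lt n_lt] := in_sizes_lt; have m_le := leq_trans (ltnW m_lt) L_le.
have n_le := leq_trans (ltnW n_lt) L_le.
have lt1 : 1 < 2 ^ in_q.+1 by rewrite expnS; have := expn_gt0 2 in_q; lia.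
apply: runs_seq; apply: runs_const => //; set s0 := set_reg _ _ _.
have at_s0 : at_env input 1 (prologue_env 0 0 0 0) s0 by split=> // -[|[|[|[|[|x]]]]].
apply: (runs_assign_seq (v' := prologue_env 0 0 in_m 0) qW isT in_lt lt1 _ _ at_s0) => //.
- exact: bounded_prologue_env.
- by case=> [|[|[|[|[|x]]]]].
move=> s1 at_s1.
apply: (runs_assign_seq (v' := prologue_env 0 0 in_m in_n) qW isT in_lt lt1 _ _ at_s1) => //.
- exact: bounded_prologue_env.
- by case=> [|[|[|[|[|x]]]]].
move=> s2 at_s2; have b2 : bounded_env in_q in_q.+1 (prologue_env 0 0 in_m in_n).
  exact: bounded_prologue_env.
apply: runs_seq.
apply: runs_mono (leqnn _) _ (runs_set_length (e := e_length) qW isT in_lt lt1 isT b2 at_s2).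
move=> s3; rewrite evalE_length => at_s3.
apply: (runs_assign_seq (v' := prologue_env in_L 0 in_m in_n) qW isT in_lt L_lt _ b2 at_s3) => //.
  by rewrite evalE_length; case=> [|[|[|[|[|x]]]]].
move=> s4 at_s4; apply: (runs_bounds at_s4) => s5 at_s5.
have [_ s5v _] := at_s5; have b5 := bounded_env0 m_le n_le.
apply: runs_mono (leqnn _) _ (runs_compP qW L_lt isT wp 0 (at_env_ready in_lt b5 at_s5)).
move=> s6 [[_ s6A] _] j j_le; rewrite -(evalP_ext _ _ _ s5v).
exact: (s6A 0 j isT (fun _ => j_le)).
Qed.
End Machine.

Lemma machine_poly_time p : wfP p -> exists T : {poly nat}, forall input t,
    in_L input = 2 * (in_m input * in_n input + in_m input + in_n input + in_n input + 1) ->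
  runs (machine p) (init input t) (T.[bitsize input])%R (fun s => forall j, j <= in_L input ->
    ram s j = evalP (in_L input) p (env0 input) (mem0 input) 0 j).
Proof.
move=> wp; have [T T_ge] : poly_bounded (time_machine p).
  rewrite /time_machine /time_assign.
  by repeat first [apply: poly_bounded_timeE | apply: poly_bounded_timeP
                  | apply: poly_bounded_bitsE | progress solve_poly_bounded].
have [B B_ge] : poly_bounded (fun N => (2 * N + 101) ^ 16).
  by apply: poly_bounded_exp; solve_poly_bounded.
exists (T \Po B)%R => input t lengthE.
apply: runs_mono _ (fun _ => id) (runs_machine lengthE t wp).
apply: leq_trans (T_ge _) _; rewrite horner_comp; apply: leq_horner_nat.
by apply: leq_trans (B_ge _); rewrite leq_exp2r // in_N_le_bits.
Qed.

(** * Tabulation and ratio minimisation *)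

Declare Scope expr_scope.
Delimit Scope expr_scope with X.
Bind Scope expr_scope with expr.

Coercion Cst : nat >-> expr.

Definition lt_expr (a b : expr) : expr := Ite (Bin Defs.Sub b a) 1 0.
Definition eq_expr (a b : expr) : expr :=
  Ite (Bin Defs.Sub a b) 0 (Ite (Bin Defs.Sub b a) 0 1).

Notation "$ x" := (Var x) (at level 1, format "$ x") : expr_scope.
Notation "a + b" := (Bin Defs.Add a b) : expr_scope.
Notation "a - b" := (Bin Defs.Sub a b) : expr_scope.
Notation "a * b" := (Bin Defs.Mul a b) : expr_scope.
Notation "a %/ b" := (Bin Defs.Div a b) : expr_scope.
Notation "a < b" := (lt_expr a b) : expr_scope.
Notation "a == b" := (eq_expr a b) : expr_scope.
Notation "k @[ a ]" := (Rd k a) (at level 2, a at level 200, format "k @[ a ]") : expr_scope.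
Notation "k @[ a , b ]" := (Rd k (Bin Defs.Add (Bin Defs.Mul a (Var 0)) b))
  (at level 2, a at level 200, b at level 200, format "k @[ a ,  b ]") : expr_scope.

Definition tab (x k : nat) (e : expr) : prog := For x (Wr k (Var x) e).

Definition tab2 (x y k : nat) (e : expr) : prog :=
  For x (For y (Wr k ($x * $0 + $y) e)).

Fixpoint reads (e : expr) : seq nat :=
  match e with
  | Var _ | Cst _ => [::]
  | Bin _ a b => reads a ++ reads b
  | Rd k a => k :: reads a
  | Ite c a b => reads c ++ reads a ++ reads b
  | Big _ _ e => reads e
  end.

Fixpoint writes (p : prog) : seq nat :=
  match p with
  | Wr k _ _ => [:: k]
  | PSeq p1 p2 => writes p1 ++ writes p2
  | For _ p => writes p
  end.

Lemma loop_inv (T : Type) (P : nat -> T -> Prop) n f x :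
  P n x -> (forall i y, i < n -> P i.+1 y -> P i (f i y)) -> P 0 (loop n f x).
Proof.
elim: n x => //= n IH x Px step; apply: IH; first exact: step.
by move=> i y i_lt; apply: step; apply: ltnW.
Qed.

Lemma upd_same (f : nat -> nat) a v : upd f a v a = v.
Proof. by rewrite /upd eqxx. Qed.

Lemma upd_other (f : nat -> nat) a v a' : a' != a -> upd f a v a' = f a'.
Proof. by rewrite /upd => /negbTE ->. Qed.

(* The values of [lt_expr] and [eq_expr]. *)
Lemma lt_testE (a b : nat) : (if b - a != 0 then 1 else 0) = (a < b).
Proof. by rewrite subn_eq0 -ltnNge; case: ltnP. Qed.

Lemma eq_testE (a b : nat) : (if a - b != 0 then 0 else if b - a != 0 then 0 else 1) = (a == b).
Proof. by rewrite !subn_eq0; case: ltngtP. Qed.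

Section Evaluation.
Variable L : nat.
Implicit Types (s : env) (A : memory).

Lemma evalE_frame s A A' e : {in reads e, A =1 A'} -> evalE L s A e = evalE L s A' e.
Proof.
elim: e s => //= [o a IHa b IHb|k a IHa|c IHc a IHa b IHb|o x e IH] s AA'.
- by rewrite IHa ?IHb // => k ka; apply: AA'; rewrite mem_cat ka ?orbT.
- by rewrite IHa ?AA' ?mem_head // => k' k'a; apply: AA'; rewrite inE k'a orbT.
- by rewrite IHc ?IHa ?IHb // => k ka; apply: AA'; rewrite !mem_cat ka ?orbT.
by case: o; apply: eq_bigr => i _; apply: IH.
Qed.

Lemma evalP_frame p s A k : k \notin writes p -> evalP L p s A k = A k.
Proof.
elim: p s A => [k' a e|p1 IH1 p2 IH2|x p IH] s A /=.
- by rewrite inE /updm => /negbTE ->.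
- by rewrite mem_cat negb_or => /andP[kp1 kp2]; rewrite IH2 // IH1.
by move=> kp; apply: (@loop_inv _ (fun _ A' => A' k = A k)) => // i A' _ <-; apply: IH.
Qed.

Lemma updm_eq A k i v : updm A k i v k i = v.
Proof. by rewrite /updm eqxx /upd eqxx. Qed.

Lemma updm_neq A k i v j : j != i -> updm A k i v k j = A k j.
Proof. by rewrite /updm eqxx /upd => /negbTE ->. Qed.

Lemma updm_other A k i v k' : k' != k -> updm A k i v k' = A k'.
Proof. by rewrite /updm => /negbTE ->. Qed.

(* For array 0 the bound [i < L] excludes the cell that receives the clamped writes. *)
Lemma evalP_tab x k e s A i : 1 < x -> k \notin reads e -> i < s 0 -> (k == 0 -> i < L) ->
  evalP L (tab x k e) s A k i = minn (evalE L (upd s x i) A e) (s 1).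
Proof.
move=> x_gt1 k_reads i_lt i_L.
pose P t A' := (forall k', k' != k -> A' k' = A k') /\
  (t <= i -> A' k i = minn (evalE L (upd s x i) A e) (s 1)).
suff [_] : P 0 (evalP L (tab x k e) s A) by apply.
apply: loop_inv; first by split=> //; rewrite leqNgt i_lt.
move=> t A' t_lt [A'_other A'_i] /=; split=> [k' k'k|ti].
  by rewrite updm_other // A'_other.
have x_neq1 : 1 != x by rewrite ltn_eqF.
rewrite upd_same (upd_other s t x_neq1) (@evalE_frame (upd s x t) A' A); last first.
  by move=> k' k'e; rewrite A'_other //; apply: contraNneq k_reads => <-.
have clamp_i j : clamp L k j = i -> j = i.
  by rewrite /clamp; case: eqP => // k0; move: i_L; rewrite k0 => /(_ isT); lia.
have clampK : clamp L k i = i.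
  by rewrite /clamp; case: eqP => // k0; apply/minn_idPl/ltnW/i_L; rewrite k0.
have [<-|it] := eqVneq i t; first by rewrite clampK updm_eq.
rewrite updm_neq; last by apply: contraNneq it => /esym/clamp_i ->.
by apply: A'_i; lia.
Qed.

Lemma evalP_tab2 q x y k e s A i j : s 0 = q -> 1 < x -> 1 < y -> x != y ->
    k \notin reads e -> i < q -> j < q -> k != 0 ->
  evalP L (tab2 x y k e) s A k (i * q + j) =
    minn (evalE L (upd (upd s x i) y j) A e) (s 1).
Proof.
move=> <- x_gt1 y_gt1 xy k_reads i_lt j_lt k_neq0.
have [x_neq0 x_neq1] : 0 != x /\ 1 != x by split; lia.
have [y_neq0 y_neq1] : 0 != y /\ 1 != y by split; lia.
pose P t A' := (forall k', k' != k -> A' k' = A k') /\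
  (t <= i -> A' k (i * s 0 + j) = minn (evalE L (upd (upd s x i) y j) A e) (s 1)).
suff [_] : P 0 (evalP L (tab2 x y k e) s A) by apply.
apply: loop_inv; first by split=> //; rewrite leqNgt i_lt.
move=> t A' t_lt [A'_other A'_i].
pose P' u B := (forall k', k' != k -> B k' = A k') /\
  (t <= i -> u <= j \/ t < i -> B k (i * s 0 + j) = minn (evalE L (upd (upd s x i) y j) A e) (s 1)).
suff [B_other B_ij] : P' 0 (evalP L (For y (Wr k ($x * $0 + $y) e)) (upd s x t) A').
  by split=> // ti; apply: B_ij => //; left.
rewrite /= upd_other //; apply: loop_inv.
  by split=> // ti [|/A'_i //]; lia.
move=> u B u_lt [B_other B_ij] /=; split=> [k' k'k|ti uj]; first by rewrite updm_other // B_other.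
rewrite (@evalE_frame _ B A); last first.
  by move=> k' k'e; rewrite B_other //; apply: contraNneq k_reads => <-.
have -> : clamp L k (upd (upd s x t) y u x * upd (upd s x t) y u 0 + upd (upd s x t) y u y) =
    t * s 0 + u.
  by rewrite /clamp (negbTE k_neq0) (upd_other _ _ xy) !upd_same !upd_other.
have -> : upd (upd s x t) y u 1 = s 1 by rewrite !upd_other.
have [ti_eq|ti_neq] := eqVneq t i; last first.
  rewrite updm_neq; last by apply/eqP; nia.
  by apply: B_ij => //; right; lia.
have [uj_eq|uj_neq] := eqVneq u j; first by rewrite ti_eq uj_eq updm_eq.
rewrite updm_neq; last by rewrite ti_eq eqn_add2l eq_sym.
by apply: B_ij => //; left; lia.
Qed.

Definition ARG := 16.

Definition argmin_ratio_step (x num den : nat) : prog :=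
  Wr ARG 0 (Ite den@[$x]
    (Ite den@[ARG@[0]]
       (Ite (num@[$x] * den@[ARG@[0]] < num@[ARG@[0]] * den@[$x]) $x ARG@[0])
       $x)
    ARG@[0]).

Definition argmin_ratio (x num den : nat) : prog :=
  PSeq (Wr ARG 0 0) (For x (argmin_ratio_step x num den)).

Definition better_ratio (num den : nat -> nat) (i k : nat) : nat :=
  if den i == 0 then k else
  if (den k == 0) || (num i * den k < num k * den i) then i else k.

Lemma better_ratio_min num den i k (X : pred nat) :
    (forall j, X j -> den j != 0 -> den k != 0 /\ num k * den j <= num j * den k) ->
    let k' := better_ratio num den i k in
  forall j, (j == i) || X j -> den j != 0 -> den k' != 0 /\ num k' * den j <= num j * den k'.
Proof.
move=> k_min /= j jX dj; rewrite /better_ratio.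
have [di|di] := eqVneq (den i) 0.
  by case/orP: jX => [/eqP ji|/k_min]; [rewrite ji di in dj | apply].
have [dk|dk] := eqVneq (den k) 0; rewrite /=.
  case/orP: jX => [/eqP -> //|/k_min/(_ dj)[]]; by rewrite dk.
case: ltnP => [ik|ki]; case/orP: jX => [/eqP -> //|/k_min/(_ dj)[_ kj]] //; split=> //.
rewrite -(leq_pmul2r (_ : 0 < den k)) ?lt0n //.
have := leq_mul (ltnW ik) (leqnn (den j)); have := leq_mul kj (leqnn (den i)).
by move: (num i) (num j) (num k) => a b c; nia.
Qed.

Lemma evalP_argmin_ratio_step x num den s A :
    num != 0 -> den != 0 -> better_ratio (A num) (A den) (s x) (A ARG 0) <= s 1 ->
  evalP L (argmin_ratio_step x num den) s A =
    updm A ARG 0 (better_ratio (A num) (A den) (s x) (A ARG 0)).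
Proof.
move=> num0 den0 /minn_idPl <-; congr updm; rewrite /= /better_ratio.
rewrite lt_testE /clamp (negbTE num0) (negbTE den0).
by case: (A den (s x) == 0) => //=; case: (A den _ == 0) => //=; case: (_ < _).
Qed.

Lemma evalP_argmin_ratio x num den s A :
    1 < x -> num != ARG -> den != ARG -> num != 0 -> den != 0 -> 0 < s 0 <= s 1 ->
    let k := evalP L (argmin_ratio x num den) s A ARG 0 in
  k < s 0 /\ forall j, j < s 0 -> A den j != 0 ->
    A den k != 0 /\ A num k * A den j <= A num j * A den k.
Proof.
move=> x_gt1 num_neq den_neq num0 den0 /andP[q_gt0 q_le].
pose P t A' := [/\ A' num = A num, A' den = A den, A' ARG 0 < s 0 &
  forall j, t <= j < s 0 -> A den j != 0 ->
    A den (A' ARG 0) != 0 /\ A num (A' ARG 0) * A den j <= A num j * A den (A' ARG 0)].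
suff [_ _ k_lt k_min] : P 0 (evalP L (argmin_ratio x num den) s A) by split.
apply: loop_inv.
  by split=> /=; rewrite ?updm_eq ?min0n ?updm_other // => j /andP[j_ge j_lt]; lia.
move=> t A' t_lt [A'_num A'_den k_lt k_min]; set k := A' ARG 0 in k_lt k_min.
have new_lt : better_ratio (A num) (A den) t k < s 0.
  by rewrite /better_ratio; case: ifP => // _; case: ifP.
have step := @evalP_argmin_ratio_step x num den (upd s x t) A' num0 den0.
rewrite upd_same upd_other ?ltn_eqF // A'_num A'_den -/k in step.
change (P t (evalP L (argmin_ratio_step x num den) (upd s x t) A')).
rewrite {}step; last exact: leq_trans (ltnW new_lt) q_le.
split; rewrite ?updm_eq ?updm_other // => j /andP[tj j_lt].
apply: (better_ratio_min (X := [pred j | t < j < s 0])); first by move=> i; apply: k_min.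
by rewrite inE j_lt andbT eq_sym -leq_eqVlt.
Qed.
End Evaluation.

(** * The greedy program *)

Notation vi := 5 (only parsing).
Notation vj := 6 (only parsing).
Notation vk := 7 (only parsing).
Notation vt := 8 (only parsing).

(* The current weights and linear program, the state of the greedy algorithm, and
   its excesses and prices. *)
Notation WW := 8 (only parsing).
Notation ROW := 14 (only parsing).
Notation CNT := 15 (only parsing).
Notation SCALE := 17 (only parsing).
Notation EXC := 18 (only parsing).
Notation PRICE := 19 (only parsing).

Definition excess_prog : prog :=
  tab vj EXC (Big BSum vk (CNT@[$vk] * ROW@[$vj, $vk]) - SCALE@[0]).

Definition price_prog : prog := tab vk PRICE (Big BSum vj (EXC@[$vj] * ROW@[$vj, $vk])).

Definition select_prog : prog := PSeq excess_prog (PSeq price_prog (argmin_ratio vk PRICE WW)).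

Definition greedy_step_prog : prog :=
  PSeq select_prog
 (PSeq (Wr SCALE 0 (SCALE@[0] + PRICE@[ARG@[0]] %/ Big BSum vj EXC@[$vj]))
       (Wr CNT ARG@[0] (CNT@[ARG@[0]] + 1))).

Definition greedy_prog : prog :=
  PSeq (tab vk CNT 0) (PSeq (Wr SCALE 0 0) (PSeq (For vt greedy_step_prog) excess_prog)).

Section GreedyRun.
Variables (F : realFieldType) (L q cap : nat).
Variables (a : 'I_q -> 'I_q -> nat) (w : {ffun 'I_q -> nat}) (G : nat) (J0 : {set 'I_q}).
Hypothesis a_le : forall j k, w k != 0 -> a j k <= G.
Hypothesis a_out : forall j k, w k != 0 -> j \notin J0 -> a j k = 0.
Hypothesis active_exists : exists k, w k != 0.
Hypotheses (G_ge : 2 * q <= G) (cap_ge : G * (q * (q * G)) <= cap).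
Implicit Types (s : env) (A : memory).

Definition greedy_data A : Prop := (forall k : 'I_q, A WW k = w k) /\
  forall j k : 'I_q, w k != 0 -> A ROW (j * q + k) = a j k.

Definition cnt_of A (k : 'I_q) : nat := A CNT k.

Definition greedy_state t A : Prop :=
  [/\ greedy_data A, greedy_inv F a w G J0 t (cnt_of A) (A SCALE 0) & A SCALE 0 <= t * G].

Definition excess_table A : Prop :=
  forall j : 'I_q, A EXC j = excess a (cnt_of A) (A SCALE 0) j.

Lemma q_gt0 : 0 < q.
Proof. by case: active_exists => k _; apply: leq_ltn_trans (ltn_ord k). Qed.

Lemma greedy_data_frame p s A : WW \notin writes p -> ROW \notin writes p ->
  greedy_data A -> greedy_data (evalP L p s A).
Proof. by move=> WW_p ROW_p [A_w A_a]; split=> *; rewrite evalP_frame; auto. Qed.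

Section Step.
Variables (t : nat) (s : env) (A : memory).
Hypotheses (s0 : s 0 = q) (s1 : s 1 = cap) (t_le : t <= q) (A_state : greedy_state t A).

Let A_data : greedy_data A. Proof. by case: A_state. Qed.
Let A_inv : greedy_inv F a w G J0 t (cnt_of A) (A SCALE 0). Proof. by case: A_state. Qed.

Lemma qG_le_cap : q * G <= cap.
Proof. by apply: leq_trans cap_ge; have := q_gt0; nia. Qed.

Lemma row_load_le_cap j : row_load a (cnt_of A) j <= cap.
Proof.
apply: leq_trans (row_load_le a_le A_inv j) (leq_trans _ qG_le_cap).
by rewrite leq_mul2r t_le orbT.
Qed.

Lemma evalP_excess : excess_table (evalP L excess_prog s A).
Proof.
move=> j; rewrite /excess_prog evalP_tab ?s0 // s1.
rewrite (_ : evalE _ _ _ _ = excess a (cnt_of A) (A SCALE 0) j).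
  rewrite (minn_idPl (leq_trans (leq_subr _ _) (row_load_le_cap j))).
  by rewrite /excess /row_load /cnt_of !evalP_frame.
rewrite /= /clamp /= /upd /= s0 big_mkord; congr (_ - _); apply: eq_bigr => k _.
have [wk|wk] := eqVneq (w k) 0; last by rewrite /cnt_of (proj2 A_data).
by have := greedy_supp A_inv wk; rewrite /cnt_of => ->.
Qed.

Lemma total_excess_le_cap : total_excess a (cnt_of A) (A SCALE 0) <= q * (q * G).
Proof.
apply: leq_trans (total_excess_le a_le a_out A_inv) _; apply: leq_mul.
  by rewrite -[leqRHS]card_ord max_card.
by rewrite leq_mul2r t_le orbT.
Qed.

Lemma evalP_price B (k : 'I_q) : greedy_data B -> w k != 0 ->
    (forall j : 'I_q, B EXC j = excess a (cnt_of A) (A SCALE 0) j) ->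
  evalP L price_prog s B PRICE k = price a (cnt_of A) (A SCALE 0) k.
Proof.
move=> [_ B_a] wk B_exc; rewrite /price_prog evalP_tab ?s0 // s1.
rewrite (_ : evalE _ _ _ _ = price a (cnt_of A) (A SCALE 0) k).
  apply/minn_idPl; apply: leq_trans (price_le a_le _ _ wk) (leq_trans _ cap_ge).
  by rewrite leq_mul2l total_excess_le_cap orbT.
rewrite /= /clamp /= /upd /= s0 big_mkord; apply: eq_bigr => j _.
by rewrite B_exc B_a.
Qed.

Lemma evalP_select : let A' := evalP L select_prog s A in
  exists k0 : 'I_q, [/\ A' ARG 0 = k0, cheapest a w (cnt_of A) (A SCALE 0) k0,
    A' PRICE k0 = price a (cnt_of A) (A SCALE 0) k0 &
    forall j : 'I_q, A' EXC j = excess a (cnt_of A) (A SCALE 0) j].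
Proof.
have -> : evalP L select_prog s A = evalP L (argmin_ratio vk PRICE WW) s
  (evalP L price_prog s (evalP L excess_prog s A)) by [].
set B := evalP L price_prog s _; set A' := evalP L _ s B.
have B_exc (j : 'I_q) : B EXC j = excess a (cnt_of A) (A SCALE 0) j.
  by rewrite /B evalP_frame // evalP_excess /cnt_of !evalP_frame.
have B_w (k : 'I_q) : B WW k = w k by rewrite /B !evalP_frame // (proj1 A_data).
have B_price (k : 'I_q) : w k != 0 -> B PRICE k = price a (cnt_of A) (A SCALE 0) k.
  move=> wk; apply: evalP_price => //; first exact: greedy_data_frame.
  by move=> j; rewrite evalP_excess /cnt_of ?evalP_frame.
have q_cap : 0 < s 0 <= s 1.
  by rewrite s0 s1 q_gt0 (leq_trans _ qG_le_cap) // leq_pmulr //; have := q_gt0; lia.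
have [k0_lt k0_min] := @evalP_argmin_ratio L vk PRICE WW s B isT isT isT isT isT q_cap.
rewrite -/A' s0 in k0_lt k0_min; pose k0 := Ordinal k0_lt.
have [k wk] := active_exists; have [] := k0_min k (ltn_ord k); rewrite B_w // => wk0 _.
have {}wk0 : w k0 != 0 by rewrite -B_w.
exists k0; split=> // [||j]; last by rewrite /A' evalP_frame.
  split=> // j wj; have [|_] := k0_min j (ltn_ord j); rewrite B_w //.
  by rewrite (B_w k0) B_price // (B_price k0).
by rewrite /A' evalP_frame // B_price.
Qed.

Lemma evalP_greedy_step : t < q -> greedy_state t.+1 (evalP L greedy_step_prog s A).
Proof.
move=> t_lt; have [k0 [argE k0_cheap priceE excE]] := evalP_select.
set B := evalP L select_prog s A in argE priceE excE.
have B_keep k : k \notin writes select_prog -> B k = A k by apply: evalP_frame.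
set p := increment a (cnt_of A) (A SCALE 0) k0.
have scale_le : A SCALE 0 + p <= t.+1 * G.
  by rewrite mulSn addnC leq_add ?(increment_le a_le _ _ k0_cheap.1) //; case: A_state.
have scale_cap : A SCALE 0 + p <= cap.
  by apply: leq_trans scale_le (leq_trans _ qG_le_cap); rewrite leq_mul2r t_lt orbT.
have cnt_cap : A CNT k0 + 1 <= cap.
  apply: (@leq_trans q); last first.
    by apply: leq_trans qG_le_cap; rewrite leq_pmulr //; have := q_gt0; lia.
  by have := cnt_le A_inv k0; rewrite /cnt_of; lia.
have -> : evalP L greedy_step_prog s A =
    updm (updm B SCALE 0 (A SCALE 0 + p)) CNT k0 (A CNT k0 + 1).
  rewrite -(minn_idPl scale_cap) -(minn_idPl cnt_cap) -s1 -argE -(B_keep CNT) //.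
  rewrite -(B_keep SCALE) // (_ : p = B PRICE (B ARG 0) %/ \sum_(0 <= j < s 0) B EXC j) //.
  rewrite argE priceE s0 big_mkord /p /increment /total_excess.
  by under [in RHS]eq_bigr do rewrite excE.
split; [| |by rewrite updm_other // updm_eq].
  by split=> [k|j k wk]; rewrite !updm_other // B_keep // (proj1 A_data, proj2 A_data).
rewrite updm_other // updm_eq; apply: (greedy_step a_le a_out A_inv k0_cheap _ t_lt) => // k.
rewrite /cnt_of; case: (eqVneq k k0) => [->|kk0]; first by rewrite updm_eq.
by rewrite updm_neq // updm_other // B_keep // addn0.
Qed.
End Step.

Lemma evalP_greedy s A : s 0 = q -> s 1 = cap -> greedy_data A ->
  let A' := evalP L greedy_prog s A in greedy_state q A' /\ excess_table A'.
Proof.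
move=> s0 s1 A_data.
set A1 := evalP L (tab vk CNT 0) s A; set A2 := evalP L (Wr SCALE 0 0) s A1.
set A3 := evalP L (For vt greedy_step_prog) s A2.
have -> : evalP L greedy_prog s A = evalP L excess_prog s A3 by [].
suff A3_state : greedy_state q A3.
  split; last by move=> j; rewrite (evalP_excess s0 s1 (leqnn q) A3_state) /cnt_of !evalP_frame.
  have [A3_data A3_inv A3_le] := A3_state.
  by split; [exact: greedy_data_frame | rewrite /cnt_of !evalP_frame | rewrite evalP_frame].
rewrite -[q]subn0 /A3 /= s0.
apply: (@loop_inv _ (fun t B => greedy_state (q - t) B)).
  rewrite subnn; split; last by rewrite /A2 /= updm_eq min0n.
    by do 2!apply: greedy_data_frame => //.
  rewrite /A2 /= updm_eq min0n; apply: greedy_init => k.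
  by rewrite /cnt_of updm_other // /A1 evalP_tab ?s0 ?min0n.
move=> t B t_lt B_state; rewrite -(subnSK t_lt); apply: evalP_greedy_step => //.
- exact: leq_subr.
by lia.
Qed.
End GreedyRun.

(** * The rounds of the local ratio algorithm *)

Notation ve := 9 (only parsing).
Notation vr := 10 (only parsing).

(* The integral instance, the tables of the local ratio charges and of the linear
   programs, the value and scale of every candidate, the stack of picked items,
   where 0 marks a round without pick, and the selection. *)
Notation BB := 3 (only parsing).
Notation SZ := 7 (only parsing).
Notation PROD := 10 (only parsing).
Notation COEF := 11 (only parsing).
Notation CAPC := 12 (only parsing).
Notation LIM := 13 (only parsing).
Notation VAL := 20 (only parsing).
Notation SCL := 21 (only parsing).
Notation NEXT := 22 (only parsing).
Notation STK := 23 (only parsing).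
Notation SEL := 24 (only parsing).

Definition row_prog : prog :=
  tab2 vj vk ROW
    (Ite ($vj < $2) CAPC@[$vj, $vk]
    (Ite ($vj < $2 + $2 * $2) (Ite ($vj - $2 == $vk) (4 * $0) 0)
    (Ite ($vj == $2 + $2 * $2) LIM@[$ve, $vk] 0))).

Definition score_prog : prog :=
  PSeq (Wr VAL $ve (Ite WW@[$ve] (Big BSum vk (WW@[$vk] * CNT@[$vk])) 0))
       (Wr SCL $ve (SCALE@[0] + Big BSum vj EXC@[$vj])).

Definition candidate_prog : prog := PSeq row_prog (PSeq greedy_prog score_prog).

Definition pick_prog : prog := PSeq (For ve candidate_prog) (argmin_ratio ve SCL VAL).

Definition push_prog : prog := Wr STK $vr (Ite WW@[ARG@[0]] (ARG@[0] + 1) 0).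

Definition next_prog : prog :=
  tab vk NEXT (PROD@[ARG@[0]] * WW@[$vk] - WW@[ARG@[0]] * COEF@[ARG@[0], $vk]).

Definition reweight_prog : prog := PSeq next_prog (tab vk WW NEXT@[$vk]).

Definition round_prog : prog := PSeq pick_prog (PSeq push_prog reweight_prog).

(* Both loops run downwards, so the index [q - 1 - r] visits the last round first. *)
Definition insert_prog : prog :=
  Wr SEL (STK@[$0 - 1 - $vr] - 1)
    (Ite STK@[$0 - 1 - $vr]
       (Ite (Big BSum vi (BB@[$vi] < Big BSum vk (SEL@[$vk] * SZ@[$vi, $vk])
                                     + SZ@[$vi, STK@[$0 - 1 - $vr] - 1]))
          SEL@[STK@[$0 - 1 - $vr] - 1] 1)
       SEL@[STK@[$0 - 1 - $vr] - 1]).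

Definition run_prog : prog :=
  PSeq (For vr round_prog) (PSeq (tab vk SEL 0) (For vr insert_prog)).

Lemma card_ord_lt q t : #|[set k : 'I_q | k < t]| <= t.
Proof.
have [tq|qt] := leqP t q; last by apply: leq_trans (max_card _) _; rewrite card_ord ltnW.
by rewrite -sum1dep_card (big_ord_narrow tq) sum_nat_const card_ord; lia.
Qed.

Section Run.
Variables (F : realFieldType) (L q cap N : nat).
Variables (sz : 'I_q -> 'I_q -> nat) (b : 'I_q -> nat) (R0 : {set 'I_q}).
Implicit Types (i j e k : 'I_q) (s : env) (A : memory).

Definition ord_sub_N (j : 'I_q) : 'I_q := Ordinal (leq_ltn_trans (leq_subr N j) (ltn_ord j)).

Definition row_kind (j : 'I_q) : constraint 'I_q 'I_q :=
  if j < N then Capacity _ j else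
  if j < N + N * N then Box _ (ord_sub_N j) else
  if j == N + N * N :> nat then Charge else Void.

Definition used_rows : {set 'I_q} := [set j : 'I_q | j < N + N * N + 1].

Hypothesis R0_fits : forall k, k \in R0 -> fits sz b k.
Hypothesis R0_sparse : forall k, k \in R0 -> #|rows sz k| <= 2.
Hypothesis R0_rows : forall i k, k \in R0 -> N <= i -> sz i k = 0.
Hypothesis R0_lt : forall k, k \in R0 -> k < N * N.
Hypotheses (N_gt0 : 0 < N) (q_ge : 200 * (N * N) ^ 4 * (N + N * N + 1) ^ 3 <= q).
Hypothesis cap_ge : 4 * q * (q * (q * (4 * q))) <= cap.

Definition runenv s : Prop := [/\ s 0 = q, s 1 = cap & s 2 = N].

Lemma runenv_upd s x v : 2 < x -> runenv s -> runenv (upd s x v).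
Proof. by move=> x_gt2 [s0 s1 s2]; split; rewrite upd_other ?ltn_eqF // (ltn_trans _ x_gt2). Qed.

Lemma rows_lt_q : N + N * N < q.
Proof.
apply: leq_trans q_ge; have : 0 < (N * N) ^ 4 by rewrite expn_gt0 muln_gt0 N_gt0.
have : (N + N * N + 1) <= (N + N * N + 1) ^ 3 by rewrite -[leqLHS]expn1 leq_pexp2l ?addn1.
by set x := (N * N) ^ 4; set y := _ ^ 3; nia.
Qed.

Lemma q_pos : 0 < q.
Proof. exact: leq_ltn_trans rows_lt_q. Qed.

Lemma G_ge : 10 * (N * N) ^ 2 <= 4 * q.
Proof.
apply: leq_trans (leq_pmull q _) => //; apply: leq_trans q_ge.
have : (N * N) ^ 2 <= (N * N) ^ 4 by rewrite leq_pexp2l ?muln_gt0 ?N_gt0.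
have : 0 < (N + N * N + 1) ^ 3 by rewrite expn_gt0 addn1.
by set x := (N * N) ^ 4; set y := (N * N) ^ 2; set z := _ ^ 3; nia.
Qed.

Lemma G_le_cap : 4 * q <= cap.
Proof. by apply: leq_trans cap_ge; rewrite leq_pmulr // !muln_gt0 q_pos. Qed.

Lemma q_le_cap : q <= cap.
Proof. by apply: leq_trans G_le_cap; rewrite leq_pmull. Qed.

Lemma scale_le_cap : q * (4 * q) + q * (q * (4 * q)) <= cap.
Proof. by apply: leq_trans cap_ge; have := q_pos; nia. Qed.

Section Weights.
Variable w : {ffun 'I_q -> nat}.
Hypothesis w_active : active w \subset R0.

Let w_R0 k : w k != 0 -> k \in R0.
Proof. by move=> wk; apply: (subsetP w_active); rewrite inE. Qed.

Let w_fits k : w k != 0 -> fits sz b k.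
Proof. by move/w_R0/R0_fits. Qed.

Let w_sparse k : w k != 0 -> #|rows sz k| <= 2.
Proof. by move/w_R0/R0_sparse. Qed.

Lemma card_active_le : #|active w| <= N * N.
Proof.
apply: leq_trans (card_ord_lt q _); apply: subset_leq_card.
by apply/subsetP => k; rewrite !inE => /w_R0/R0_lt.
Qed.

Lemma card_used_rows : #|used_rows| <= N + N * N + 1.
Proof. exact: card_ord_lt. Qed.

Lemma row_kind_capacity i : (exists j, row_kind j = Capacity _ i) \/
  forall k, w k != 0 -> sz i k = 0.
Proof.
have [i_lt|N_le] := ltnP i N; first by left; exists i; rewrite /row_kind i_lt.
by right=> k /w_R0 kR; apply: R0_rows.
Qed.

Definition box_row (k : 'I_q) : 'I_q := insubd k (N + k).

Lemma row_kind_box k : w k != 0 -> row_kind (box_row k) = Box _ k.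
Proof.
move/w_R0/R0_lt => k_lt; have k_row : N + k < q.
  by apply: leq_trans rows_lt_q; rewrite ltnS leq_add2l ltnW.
rewrite /row_kind /box_row val_insubd k_row ltnNge leq_addr /= ltn_add2l k_lt.
by congr Box; apply: val_inj; rewrite /= val_insubd k_row addKn.
Qed.

Definition charge_row : 'I_q := Ordinal rows_lt_q.

Lemma row_kind_charge : row_kind charge_row = Charge.
Proof. by rewrite /row_kind /= ltnNge leq_addr /= ltnn eqxx. Qed.

Lemma row_kind_out j : j \notin used_rows -> row_kind j = Void.
Proof. by rewrite inE /row_kind -leqNgt => ?; rewrite !ifF //; lia. Qed.

Definition coef e : 'I_q -> 'I_q -> nat := row_coef sz b row_kind (4 * q) e.

Let coef_le e j k : w e != 0 -> w k != 0 -> coef e j k <= 4 * q.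
Proof. exact: row_coef_le. Qed.

Let coef_out e j k : w k != 0 -> j \notin used_rows -> coef e j k = 0.
Proof. by move=> _; apply: (row_coef_out _ _ _ row_kind_out). Qed.

Definition lp_tables A : Prop :=
  (forall i k, k \in R0 -> A CAPC (i * q + k) = capacity_coef sz b (4 * q) i k) /\
  (forall e k, e \in R0 -> k \in R0 -> A LIM (e * q + k) = charge_limit_coef sz b (4 * q) e k).

Lemma evalP_row s A e j k : runenv s -> s ve = e -> lp_tables A -> w e != 0 -> w k != 0 ->
  evalP L row_prog s A ROW (j * q + k) = coef e j k.
Proof.
move=> [s0 s1 s2] se [A_cap A_lim] we wk.
rewrite /row_prog (evalP_tab2 _ _ s0) // s1.
rewrite -[RHS](minn_idPl (leq_trans (coef_le j we wk) G_le_cap)); congr minn.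
rewrite /= !lt_testE !eq_testE /clamp /= /upd /= s0 s2 se A_cap ?A_lim ?w_R0 //.
rewrite !eqb0 !negbK /coef /row_coef /row_kind; case: (j < N) => //.
by case: (j < N + N * N) => //; case: (_ == N + N * N).
Qed.

Definition candidate_state e (cnt : 'I_q -> nat) (sc : nat) : Prop :=
  greedy_inv F (coef e) w (4 * q) used_rows q cnt sc.

Variable w_max : nat.
Hypotheses (w_le : forall k, w k <= w_max) (w_max_cap : w_max * q <= cap).

Lemma value_le_cap e cnt sc : candidate_state e cnt sc -> value w cnt <= cap.
Proof.
move=> inv; apply: (@leq_trans (w_max * \sum_k cnt k)); last by rewrite (greedy_total inv).
by rewrite big_distrr; apply: leq_sum => k _; rewrite leq_mul2r w_le orbT.
Qed.

Definition weights A : Prop := forall k, A WW k = w k.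

Lemma evalP_candidate_active s A e :
    runenv s -> s ve = e -> lp_tables A -> weights A -> w e != 0 ->
    let A' := evalP L candidate_prog s A in
  exists cnt sc,
    [/\ candidate_state e cnt sc, A' VAL e = value w cnt & A' SCL e = scale (coef e) cnt sc].
Proof.
move=> rs se A_lp A_w we; have [s0 s1 _] := rs.
set B := evalP L row_prog s A; set C := evalP L greedy_prog s B.
have B_data : greedy_data (coef e) w B.
  by split=> [k|j k wk]; [rewrite /B evalP_frame | apply: evalP_row].
have e_le j k := @coef_le e j k we; have e_out := @coef_out e.
have [[[C_w _] C_inv C_scale] C_exc] := evalP_greedy F L e_le e_out
  (ex_intro _ e we) (leq_mul (isT : 2 <= 4) (leqnn q)) cap_ge s0 s1 B_data.
rewrite -/C in C_w C_inv C_scale C_exc.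
set cnt := cnt_of C in C_inv C_exc; set sc := C SCALE 0 in C_inv C_scale C_exc.
have value_cap : value w cnt <= cap := value_le_cap C_inv.
have scale_cap : scale (coef e) cnt sc <= cap.
  apply: leq_trans scale_le_cap; apply: leq_add => //.
  apply: leq_trans (total_excess_le e_le e_out C_inv) _.
  by rewrite leq_mul2r -[X in _ <= X]card_ord max_card orbT.
have valueE : \sum_(0 <= k < s 0) C WW k * C CNT k = value w cnt.
  by rewrite s0 big_mkord; apply: eq_bigr => k _; rewrite C_w.
have excE : \sum_(0 <= j < s 0) C EXC j = total_excess (coef e) cnt sc.
  by rewrite s0 big_mkord; apply: eq_bigr => j _; rewrite C_exc.
have -> : evalP L candidate_prog s A = evalP L score_prog s C by [].
exists cnt, sc; split=> //; rewrite /score_prog /= /clamp /= se.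
  by rewrite updm_other // updm_eq s1 C_w we valueE; apply/minn_idPl.
by rewrite updm_eq s1 excE; apply/minn_idPl.
Qed.

Definition candidate_entry e A : Prop := w e != 0 -> exists cnt sc,
  [/\ candidate_state e cnt sc, A VAL e = value w cnt & A SCL e = scale (coef e) cnt sc].

Lemma evalP_candidate_other s A e k : s ve = e -> k != e ->
  let A' := evalP L candidate_prog s A in A' VAL k = A VAL k /\ A' SCL k = A SCL k.
Proof.
move=> se ke; set C := evalP L greedy_prog s (evalP L row_prog s A).
have -> : evalP L candidate_prog s A = evalP L score_prog s C by [].
rewrite /score_prog /= /clamp /= se updm_other // !updm_neq // updm_other //.
by rewrite /C !evalP_frame.
Qed.

Lemma evalP_candidate_inactive s A e : s ve = e -> weights A -> w e = 0 ->
  evalP L candidate_prog s A VAL e = 0.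
Proof.
move=> se A_w we; set C := evalP L greedy_prog s (evalP L row_prog s A).
have -> : evalP L candidate_prog s A = evalP L score_prog s C by [].
have C_w : C WW e = 0 by rewrite /C !evalP_frame // A_w.
by rewrite /score_prog /= /clamp /= se updm_other // updm_eq C_w min0n.
Qed.

Lemma evalP_candidates s A : runenv s -> lp_tables A -> weights A ->
    let A' := evalP L (For ve candidate_prog) s A in
  forall e, (w e = 0 -> A' VAL e = 0) /\ candidate_entry e A'.
Proof.
move=> rs A_lp A_w.
pose P t A' := (forall x : nat, x \notin writes candidate_prog -> A' x = A x) /\
  forall e, t <= e -> (w e = 0 -> A' VAL e = 0) /\ candidate_entry e A'.
suff [_ entries] : P 0 (evalP L (For ve candidate_prog) s A) by move=> A' e; apply: entries.
apply: loop_inv; first by case: rs => -> _ _; split=> // e; rewrite leqNgt ltn_ord.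
move=> t B t_lt [B_keep B_entries]; rewrite (_ : s 0 = q) in t_lt; last by case: rs.
change (P t (evalP L candidate_prog (upd s ve t) B)).
have B_w : weights B by move=> k; rewrite B_keep.
have B_lp : lp_tables B by rewrite /lp_tables !B_keep.
have rs' : runenv (upd s ve t) by apply: runenv_upd.
split=> [x xw|e te]; first by rewrite evalP_frame // B_keep.
have [et|et] := eqVneq e (Ordinal t_lt).
  have se : upd s ve t ve = e by rewrite upd_same et.
  by split=> [|we]; [apply: evalP_candidate_inactive | apply: evalP_candidate_active].
have [VAL_e SCL_e] := @evalP_candidate_other _ B (Ordinal t_lt) _ (upd_same s ve t) et.
rewrite /candidate_entry VAL_e SCL_e; apply: B_entries.
by rewrite ltn_neqAle te andbT eq_sym; apply: contraNneq et => et; apply/eqP/val_inj.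
Qed.

Lemma evalP_pick s A : runenv s -> lp_tables A -> weights A ->
    let A' := evalP L pick_prog s A in
  exists e, A' ARG 0 = e /\ (active w != set0 -> good_pick sz b (3 : F)%R (loss F N) w e).
Proof.
move=> rs A_lp A_w; have entries := evalP_candidates rs A_lp A_w; have [s0 s1 _] := rs.
set B := evalP L _ s A in entries.
have q_cap : 0 < s 0 <= s 1 by rewrite s0 s1 q_pos q_le_cap.
have [e_lt e_best] := @evalP_argmin_ratio L ve SCL VAL s B isT isT isT isT isT q_cap.
have -> : evalP L pick_prog s A = evalP L (argmin_ratio ve SCL VAL) s B by [].
set k := evalP L _ s B ARG 0 in e_lt e_best *; rewrite s0 in e_lt e_best.
exists (Ordinal e_lt); split=> // active_neq0.
have VAL_neq0 e : w e != 0 -> B VAL e != 0.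
  move=> /(proj2 (entries e))[cnt [sc [inv -> _]]].
  by rewrite -lt0n (leq_trans q_pos (total_le_value inv)).
have we0 : w (Ordinal e_lt) != 0.
  have /set0Pn[e] := active_neq0; rewrite inE => we.
  have [VAL_k _] := e_best e (ltn_ord e) (VAL_neq0 e we).
  by apply: contraNneq VAL_k => /(proj1 (entries (Ordinal e_lt))) /= ->.
apply: (best_candidate_good w_fits w_sparse row_kind_capacity row_kind_box row_kind_charge
  row_kind_out card_active_le active_neq0 _ q_pos G_ge _ (val := B VAL) (scl := B SCL)) => //.
- by rewrite muln_gt0 N_gt0.
- apply: leq_trans q_ge; rewrite leq_mul2l; apply/orP; right.
  by rewrite leq_exp2r // card_used_rows.
- by move=> e /(proj2 (entries e)).
by move=> e we; have [_] := e_best e (ltn_ord e) (VAL_neq0 e we).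
Qed.
End Weights.

Definition charge_tables A : Prop :=
  (forall e, e \in R0 -> A PROD e = slack_prod sz b e) /\
  (forall e k, e \in R0 -> A COEF (e * q + k) = charge_coef sz b e k).

Definition code (o : option 'I_q) : nat := if o is Some e then e.+1 else 0.

Definition next_weights (w : {ffun 'I_q -> nat}) (o : option 'I_q) : {ffun 'I_q -> nat} :=
  if o is Some e then local_step sz b e w else w.

Definition round_ok (w : {ffun 'I_q -> nat}) (o : option 'I_q) : Prop :=
  if o is Some e then good_pick sz b (3 : F)%R (loss F N) w e else active w = set0.

Variable P : nat.
Hypothesis slack_prod_le : forall e, e \in R0 -> slack_prod sz b e <= P.
Hypothesis q_le_P : q <= P.

Lemma P_gt0 : 0 < P.
Proof. exact: leq_trans q_pos q_le_P. Qed.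

Lemma evalP_reweight w w_max s A e : runenv s -> active w \subset R0 ->
    (active w != set0 -> e \in active w) -> (forall k, w k <= w_max) -> w_max * P <= cap ->
    charge_tables A -> weights w A -> A ARG 0 = e ->
  weights (local_step sz b e w) (evalP L reweight_prog s A).
Proof.
move=> [s0 s1 _] w_active ea w_le w_max_cap [A_prod A_coef] A_w A_arg k.
have nextE : A PROD e * w k - w e * A COEF (e * q + k) = local_step sz b e w k.
  have [/setP w0|/ea e_active] := eqVneq (active w) set0.
    by have := (w0 e, w0 k); rewrite !inE ffunE => -[/negbFE/eqP-> /negbFE/eqP->]; lia.
  by rewrite ffunE A_prod ?A_coef // (subsetP w_active).
have step_cap : local_step sz b e w k <= cap.
  have [wk|wk] := eqVneq (w k) 0; first by rewrite ffunE wk muln0.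
  have /ea e_active : active w != set0 by apply/set0Pn; exists k; rewrite inE.
  apply: leq_trans (local_step_le sz b e w k) (leq_trans _ w_max_cap).
  by rewrite mulnC leq_mul ?slack_prod_le // (subsetP w_active).
set B := evalP L next_prog s A.
have B_next : B NEXT k = local_step sz b e w k.
  rewrite /B /next_prog evalP_tab ?s0 //= /clamp /= /upd /= s0 s1 A_arg !A_w nextE.
  exact/minn_idPl.
have -> : evalP L reweight_prog s A = evalP L (tab vk WW NEXT@[$vk]) s B by [].
rewrite evalP_tab ?s0 //= /clamp /= upd_same B_next s1; exact/minn_idPl.
Qed.

Lemma local_step_inactive w e : active w = set0 -> local_step sz b e w = w.
Proof.
move=> /setP w0; apply/ffunP => k; rewrite ffunE.
by have := (w0 e, w0 k); rewrite !inE => -[/negbFE/eqP-> /negbFE/eqP->]; lia.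
Qed.

Lemma evalP_round w w_max s A r : runenv s -> s vr = r -> active w \subset R0 ->
    (forall k, w k <= w_max) -> w_max * P <= cap ->
    charge_tables A -> lp_tables A -> weights w A ->
    let A' := evalP L round_prog s A in
  exists o, [/\ round_ok w o, weights (next_weights w o) A', A' STK r = code o &
    forall r', r' != r -> A' STK r' = A STK r'].
Proof.
move=> rs sr w_active w_le w_max_cap A_charge A_lp A_w; have [s0 s1 _] := rs.
have value_cap : w_max * q <= cap by apply: leq_trans w_max_cap; rewrite leq_mul2l q_le_P orbT.
have [e [e_arg e_good]] := evalP_pick w_active w_le value_cap rs A_lp A_w.
set B := evalP L pick_prog s A in e_arg.
have B_w : weights w B by move=> k; rewrite /B evalP_frame.
have -> : evalP L round_prog s A = evalP L reweight_prog s (evalP L push_prog s B) by [].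
set C := evalP L push_prog s B; set o := if w e == 0 then None else Some e.
have code_cap : code o <= cap.
  by apply: leq_trans q_le_cap; rewrite /o; case: ifP => // _; apply: ltn_ord.
have C_stk : C STK r = code o.
  rewrite /C /push_prog /= /clamp /= sr updm_eq e_arg B_w s1 addn1.
  by rewrite -[RHS](minn_idPl code_cap) /o; case: eqP.
have C_w : weights (local_step sz b e w) (evalP L reweight_prog s C).
  apply: evalP_reweight w_le w_max_cap _ _ _ => //.
    by move/e_good => [].
  by rewrite /charge_tables /C !evalP_frame // /B !evalP_frame.
have o_ok : round_ok w o /\ next_weights w o = local_step sz b e w.
  rewrite /o; have [w0|/e_good e_pick] := eqVneq (active w) set0; last first.
    by move: (proj1 e_pick); rewrite inE => /negbTE ->.
  have /eqP -> : w e == 0 by move/setP/(_ e): w0; rewrite !inE => /negbFE.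
  by rewrite eqxx /= local_step_inactive.
exists o; rewrite !(@evalP_frame _ reweight_prog) // o_ok.2; split=> // [|r' r'r].
  exact: o_ok.1.
by rewrite /C /push_prog /= /clamp /= sr updm_neq // /B evalP_frame.
Qed.

Section Rounds.
Variables (w0 : {ffun 'I_q -> nat}) (W0 : nat).
Hypotheses (w0_active : active w0 \subset R0) (w0_le : forall k, w0 k <= W0).
Hypothesis W0_cap : W0 * P ^ (N * N) * P <= cap.

Record rounds_done t (es : seq (option 'I_q)) (w : {ffun 'I_q -> nat}) A : Prop := RoundsDone {
  done_size : size es = q - t;
  done_stack : forall l : nat, l < q - t -> A STK (q - 1 - l) = code (nth None es l);
  done_weights : weights w A;
  done_active : active w \subset R0;
  done_card : #|active w| <= t;
  done_le : forall k, w k <= W0 * P ^ (N * N - #|active w|);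
  done_solved : forall S, solved sz b (3 : F)%R (loss F N) w S ->
    solved sz b (3 : F)%R (loss F N) w0 (unwind sz b es S)
}.

Lemma rounds_done0 A : weights w0 A -> rounds_done q [::] w0 A.
Proof.
move=> A_w; split; rewrite ?subnn //.
  by rewrite -[leqRHS]card_ord max_card.
by move=> k; apply: leq_trans (w0_le k) _; rewrite leq_pmulr // expn_gt0 P_gt0.
Qed.

Lemma next_weights_le t es w A o : rounds_done t es w A -> round_ok w o ->
  forall k, next_weights w o k <= W0 * P ^ (N * N - #|active (next_weights w o)|).
Proof.
move=> A_done; case: o => [e|_] /= => [[e_active _] k|]; last exact: done_le A_done.
have eR := subsetP (done_active A_done) e e_active.
apply: leq_trans (local_step_le sz b e w k) _.
apply: leq_trans (leq_mul (slack_prod_le eR) (done_le A_done k)) _.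
rewrite mulnCA leq_mul2l -expnS leq_pexp2l ?P_gt0 ?orbT //.
have lt_active := card_active_local_step sz b e_active.
exact: ltn_sub2l (leq_trans lt_active (card_active_le (done_active A_done))) lt_active.
Qed.

Lemma rounds_done_step t es w A A' o : t < q -> rounds_done t.+1 es w A -> round_ok w o ->
    weights (next_weights w o) A' -> A' STK t = code o ->
    (forall r, r != t -> A' STK r = A STK r) ->
  rounds_done t (rcons es o) (next_weights w o) A'.
Proof.
move=> t_lt A_done o_ok A'_w stk_t stk_other; have es_size := done_size A_done.
split=> //; first by rewrite size_rcons es_size; lia.
- move=> l l_lt; rewrite nth_rcons es_size; case: (ltngtP l (q - t.+1)) => [l_old|?|->].
  + by rewrite stk_other ?(done_stack A_done) //; apply/eqP; lia.
  + by lia.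
  by rewrite -stk_t; congr (A' _ _); lia.
- case: o o_ok {A'_w stk_t} => [e|] _ /=; last exact: done_active A_done.
  apply: subset_trans (active_local_step sz b e w) (subset_trans (subD1set _ _) _).
  exact: done_active A_done.
- case: o o_ok {A'_w stk_t} => [e [e_active _]|->] /=; last by rewrite cards0.
  exact: leq_trans (card_active_local_step sz b e_active) (done_card A_done).
- exact: next_weights_le A_done o_ok.
move=> S S_solved; rewrite /unwind foldr_rcons; apply: (done_solved A_done).
by case: o o_ok S_solved {A'_w stk_t} => [e|_] //= e_pick; apply: SolvedStep.
Qed.

Lemma evalP_rounds s A : runenv s -> charge_tables A -> lp_tables A -> weights w0 A ->
  exists es w, rounds_done 0 es w (evalP L (For vr round_prog) s A).
Proof.
move=> rs A_charge A_lp A_w; have [s0 _ _] := rs.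
pose inv t A' := (forall x : nat, x \notin writes round_prog -> A' x = A x) /\
  exists es w, rounds_done t es w A'.
suff [_] : inv 0 (evalP L (For vr round_prog) s A) by [].
apply: loop_inv.
  by rewrite s0; split=> //; exists [::], w0; apply: rounds_done0.
rewrite s0 => t B t_lt [B_keep [es [w B_done]]].
change (inv t (evalP L round_prog (upd s vr t) B)).
split=> [x xw|]; first by rewrite evalP_frame // B_keep.
have w_cap : W0 * P ^ (N * N - #|active w|) * P <= cap.
  by apply: leq_trans W0_cap; rewrite !leq_mul2r leq_mul2l leq_pexp2l ?P_gt0 ?leq_subr ?orbT.
have [||o [o_ok o_w stk_t stk_other]] := evalP_round (runenv_upd t (isT : 2 < vr) rs)
  (upd_same s vr t) (done_active B_done) (done_le B_done) w_cap _ _ (done_weights B_done).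
- by rewrite /charge_tables !B_keep.
- by rewrite /lp_tables !B_keep.
by exists (rcons es o), (next_weights w o); apply: rounds_done_step B_done _ _ _ _.
Qed.

Definition size_tables A : Prop :=
  (forall i, A BB i = b i) /\ forall i k, A SZ (i * q + k) = sz i k.

Definition selects (S : {set 'I_q}) A : Prop := forall k, A SEL k = (k \in S).

Lemma evalP_insert s A S r o : runenv s -> s vr = r -> A STK (q - 1 - r) = code o ->
    size_tables A -> selects S A ->
  selects (unwind sz b [:: o] S) (evalP L insert_prog s A).
Proof.
move=> [s0 s1 _] sr A_stk [A_b A_sz] A_sel.
have cap_gt0 : 0 < cap := leq_trans q_pos q_le_cap.
rewrite /insert_prog /= /clamp /= /upd /= s0 s1 sr A_stk.
case: o A_stk => [e|] _ /= k; last first.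
  have [k0|k0] := eqVneq (k : nat) 0; last by rewrite updm_neq.
  rewrite k0 updm_eq; have := A_sel k; rewrite k0 => ->; apply/minn_idPl.
  exact: leq_trans (leq_b1 _) cap_gt0.
rewrite subn1 /= -[RHS](minn_idPl (leq_trans (leq_b1 _) cap_gt0)).
have blockedE : (\sum_(0 <= i < q) (if \sum_(0 <= k < q) A SEL k * A SZ (i * q + k) +
    A SZ (i * q + e) - A BB i != 0 then 1 else 0) == 0) =
    [forall i, size_in sz i S + sz i e <= b i].
  rewrite big_mkord sum_nat_eq0; apply: eq_forallb => i /=.
  rewrite A_sz A_b -subn_eq0 big_mkord (_ : \sum_(k < q) _ = size_in sz i S); last first.
    rewrite /size_in [RHS]big_mkcond /=; apply: eq_bigr => j _.
    by rewrite A_sel A_sz; case: (j \in S); rewrite ?mul1n.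
  by case: (_ - b i == 0).
rewrite blockedE /insert; case: [forall i, _] => /=; have [->|ke] := eqVneq k e.
- by rewrite updm_eq setU11.
- by rewrite updm_neq // A_sel in_setU1 (negbTE ke) (minn_idPl (leq_trans (leq_b1 _) cap_gt0)).
- by rewrite updm_eq A_sel.
by rewrite updm_neq // A_sel (minn_idPl (leq_trans (leq_b1 _) cap_gt0)).
Qed.

Lemma evalP_run s A : runenv s -> charge_tables A -> lp_tables A -> size_tables A ->
    weights w0 A ->
  exists S, solved sz b (3 : F)%R (loss F N) w0 S /\ selects S (evalP L run_prog s A).
Proof.
move=> rs A_charge A_lp A_sz A_w; have [s0 s1 _] := rs.
have [es [w B_done]] := evalP_rounds rs A_charge A_lp A_w.
set B := evalP L (For vr round_prog) s A in B_done; set C := evalP L (tab vk SEL 0) s B.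
have -> : evalP L run_prog s A = evalP L (For vr insert_prog) s C by [].
have active0 : active w = set0.
  by apply/eqP; rewrite -cards_eq0 -leqn0 (done_card B_done).
exists (unwind sz b es set0); split; first exact/(done_solved B_done)/SolvedNil.
have es_size : size es = q by rewrite (done_size B_done) subn0.
pose inv t A' := (forall x : nat, x != SEL -> A' x = C x) /\
  selects (unwind sz b (drop t es) set0) A'.
suff [_] : inv 0 (evalP L (For vr insert_prog) s C) by rewrite drop0.
apply: loop_inv.
  split=> // k; rewrite s0 drop_oversize ?in_set0; last by rewrite -[leqRHS]es_size.
  by rewrite /C evalP_tab ?s0 //= min0n.
rewrite s0 => t D t_lt [D_keep D_sel].
change (inv t (evalP L insert_prog (upd s vr t) D)).
split=> [x x_SEL|]; first by rewrite evalP_frame ?D_keep // inE.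
rewrite (drop_nth None) ?es_size //.
apply: (evalP_insert (runenv_upd t (isT : 2 < vr) rs) (upd_same s vr t)) D_sel.
  by rewrite D_keep // /C evalP_frame // (done_stack B_done) ?subn0.
by rewrite /size_tables !D_keep // /C !evalP_frame // /B !evalP_frame.
Qed.
End Rounds.
End Run.

(** * The charge tables *)

Notation SLACK := 9 (only parsing).

Definition min_expr (a b : expr) : expr := Ite (a < b)%X a b.

Definition ceil_expr (a b : expr) : expr := ((a + (b - 1)) %/ b)%X.

Definition slack_prog : prog :=
  tab2 vi vk SLACK (Ite (BB@[$vi] - SZ@[$vi, $vk]) (BB@[$vi] - SZ@[$vi, $vk]) 1).

Definition slack_prod_prog : prog :=
  tab ve PROD (Big BProd vi (Ite SZ@[$vi, $ve] SLACK@[$vi, $ve] 1)).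

Definition charge_coef_prog : prog :=
  tab2 ve vk COEF (Ite ($vk == $ve) PROD@[$ve] (Big BSum vi (Ite SZ@[$vi, $ve]
    (PROD@[$ve] %/ SLACK@[$vi, $ve] * min_expr SZ@[$vi, $vk] SLACK@[$vi, $ve]) 0))).

Definition capacity_prog : prog :=
  tab2 vi vk CAPC (ceil_expr (4 * $0 * SZ@[$vi, $vk]) BB@[$vi]).

Definition limit_prog : prog :=
  tab2 ve vk LIM (ceil_expr (4 * $0 * COEF@[$ve, $vk]) (3 * PROD@[$ve])).

Definition tables_prog : prog :=
  PSeq slack_prog (PSeq slack_prod_prog (PSeq charge_coef_prog
 (PSeq capacity_prog limit_prog))).

Section Tables.
Variables (L q cap : nat) (sz : 'I_q -> 'I_q -> nat) (b : 'I_q -> nat) (R0 : {set 'I_q}).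
Variables (s : env) (P : nat).
Hypothesis R0_fits : forall k, k \in R0 -> fits sz b k.
Hypothesis R0_sparse : forall k, k \in R0 -> #|rows sz k| <= 2.
Hypothesis slack_prod_le : forall e, e \in R0 -> slack_prod sz b e <= P.
Hypotheses (s0 : s 0 = q) (s1 : s 1 = cap).
Hypotheses (b_cap : forall i, b i < cap) (P_cap : 2 * P <= cap) (G_cap : 4 * q <= cap).
Implicit Types (i e k : 'I_q) (A : memory).

Lemma evalP_slack A i k : size_tables sz b A ->
  evalP L slack_prog s A SLACK (i * q + k) = slack sz b i k.
Proof.
move=> [A_b A_sz]; rewrite /slack_prog (evalP_tab2 _ _ s0) //= /clamp /= /upd /= s0 s1 A_b A_sz.
have := b_cap i; rewrite /slack.
have -> : (if b i - sz i k != 0 then b i - sz i k else 1) = maxn 1 (b i - sz i k).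
  by case: eqP => /=; lia.
by move=> b_lt; apply/minn_idPl; lia.
Qed.

Lemma evalP_slack_prod A e : size_tables sz b A ->
    (forall i k, A SLACK (i * q + k) = slack sz b i k) -> e \in R0 ->
  evalP L slack_prod_prog s A PROD e = slack_prod sz b e.
Proof.
move=> [_ A_sz] A_slack eR; rewrite /slack_prod_prog evalP_tab ?s0 //= /clamp /= /upd /= s0 s1.
have prod_cap : slack_prod sz b e <= cap.
  by apply: leq_trans (slack_prod_le eR) (leq_trans _ P_cap); rewrite leq_pmull.
rewrite -[RHS](minn_idPl prod_cap); congr minn.
rewrite big_mkord /slack_prod [RHS]big_mkcond; apply: eq_bigr => i _.
by rewrite inE A_sz A_slack.
Qed.

Lemma evalP_charge_coef A e k : size_tables sz b A ->
    (forall i k, A SLACK (i * q + k) = slack sz b i k) ->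
    A PROD e = slack_prod sz b e -> e \in R0 ->
  evalP L charge_coef_prog s A COEF (e * q + k) = charge_coef sz b e k.
Proof.
move=> [_ A_sz] A_slack A_prod eR; rewrite /charge_coef_prog (evalP_tab2 _ _ s0) //=.
rewrite /clamp /= /upd /= s0 s1.
have coef_cap : charge_coef sz b e k <= cap.
  apply: leq_trans (charge_coef_le b k (R0_sparse eR)) (leq_trans _ P_cap).
  by rewrite leq_mul2l slack_prod_le.
rewrite -[RHS](minn_idPl coef_cap); congr minn; rewrite eq_testE A_prod.
rewrite eqb0 negbK /charge_coef; case: (k == e :> nat) (val_eqE k e) => <- //.
rewrite big_mkord [RHS]big_mkcond; apply: eq_bigr => i _.
rewrite inE !A_sz !A_slack lt_testE eqb0 negbK.
by case: (sz i e == 0) => //=; case: ltnP.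
Qed.

Lemma evalP_capacity A i k : size_tables sz b A -> k \in R0 ->
  evalP L capacity_prog s A CAPC (i * q + k) = capacity_coef sz b (4 * q) i k.
Proof.
move=> [A_b A_sz] kR; rewrite /capacity_prog (evalP_tab2 _ _ s0) //=.
rewrite /clamp /= /upd /= s0 s1 A_b A_sz; apply/minn_idPl.
exact: leq_trans (capacity_coef_le (4 * q) i (R0_fits kR)) G_cap.
Qed.

Lemma evalP_limit A e k : charge_tables sz b R0 A -> e \in R0 ->
  evalP L limit_prog s A LIM (e * q + k) = charge_limit_coef sz b (4 * q) e k.
Proof.
move=> [A_prod A_coef] eR; rewrite /limit_prog (evalP_tab2 _ _ s0) //=.
rewrite /clamp /= /upd /= s0 s1 A_prod // A_coef //; apply/minn_idPl.
exact: leq_trans (charge_limit_coef_le b (4 * q) k (R0_sparse eR)) G_cap.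
Qed.

Lemma evalP_tables A : size_tables sz b A -> let A' := evalP L tables_prog s A in
  charge_tables sz b R0 A' /\ lp_tables sz b R0 A'.
Proof.
move=> A_size; set A1 := evalP L slack_prog s A; set A2 := evalP L slack_prod_prog s A1.
set A3 := evalP L charge_coef_prog s A2; set A4 := evalP L capacity_prog s A3.
have -> : evalP L tables_prog s A = evalP L limit_prog s A4 by [].
have slackE i k : A1 SLACK (i * q + k) = slack sz b i k by apply: evalP_slack.
have prodE e : e \in R0 -> A2 PROD e = slack_prod sz b e.
  by apply: evalP_slack_prod => //; rewrite /size_tables /A1 !evalP_frame.
have coefE e k : e \in R0 -> A3 COEF (e * q + k) = charge_coef sz b e k.
  move=> eR; apply: evalP_charge_coef => //; last exact: prodE.
    by rewrite /size_tables /A2 !evalP_frame // /A1 !evalP_frame.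
  by move=> i k'; rewrite /A2 evalP_frame.
have A3_charge : charge_tables sz b R0 A3.
  by split=> [e eR|]; [rewrite /A3 evalP_frame // prodE | exact: coefE].
split; first by rewrite /charge_tables !evalP_frame // /A4 !evalP_frame.
split=> [i k kR|e k eR _]; last first.
  by apply: evalP_limit => //; rewrite /charge_tables /A4 !evalP_frame.
rewrite evalP_frame //; apply: evalP_capacity => //.
by rewrite /size_tables /A3 !evalP_frame // /A2 !evalP_frame // /A1 !evalP_frame.
Qed.
End Tables.

(** * The integral instance *)

(* The common denominator, the integral program, the multiplicity bounds, the item
   parts and the powers of two. *)
Notation DE := 1 (only parsing).
Notation AA := 2 (only parsing).
Notation CC := 4 (only parsing).
Notation UU := 5 (only parsing).
Notation MU := 6 (only parsing).
Notation POW := 25 (only parsing).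

Definition scaled_expr (o : expr) : expr := (0@[o] * (DE@[0] %/ 0@[o + 1]))%X.

Definition offset_b_expr : expr := (2 + 2 * ($3 * $4))%X.
Definition offset_c_expr : expr := (offset_b_expr + 2 * $3)%X.
Definition offset_d_expr : expr := (offset_c_expr + 2 * $4)%X.

Definition pow_prog : prog := tab vk POW (Big BProd vt (Ite ($vt < $vk) 2 1)).

Definition denominator_prog : prog := Wr DE 0 (Big BProd vk (Ite 0@[$vk] 0@[$vk] 1)).

Definition matrix_prog : prog :=
  tab2 vi vj AA (Ite ($vi < $3) (Ite ($vj < $4) (scaled_expr (2 + 2 * ($vi * $4 + $vj))) 0) 0).

Definition capacities_prog : prog :=
  tab vi BB (Ite ($vi < $3) (scaled_expr (offset_b_expr + 2 * $vi)) 0).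

Definition costs_prog : prog :=
  tab vj CC (Ite ($vj < $4) (scaled_expr (offset_c_expr + 2 * $vj)) 0).

Definition bounds_prog : prog :=
  tab vj UU (Ite ($vj < $4)
    (Ite 0@[offset_d_expr + 2 * $vj] 0@[offset_d_expr + 2 * $vj + 1] POW@[$2]) 0).

Definition data_prog : prog :=
  PSeq pow_prog (PSeq denominator_prog (PSeq matrix_prog
 (PSeq capacities_prog (PSeq costs_prog bounds_prog)))).

Section Data.
Variable input : seq nat.
Local Notation L := (in_L input).
Local Notation N := (in_N input).
Local Notation q := (in_q input).
Local Notation m := (in_m input).
Local Notation n := (in_n input).
Implicit Types (i j k : nat) (s : env) (A : memory).

Definition cell (o : nat) : nat := nth 0 input o.

Definition denominator : nat := \prod_(0 <= o < q) (if cell o != 0 then cell o else 1).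

(* The rational at the cells [o] and [o + 1], times the common denominator. *)
Definition scaled (o : nat) : nat := cell o * (denominator %/ cell (o + 1)).

Definition offset_b : nat := 2 + 2 * (m * n).
Definition offset_c : nat := offset_b + 2 * m.
Definition offset_d : nat := offset_c + 2 * n.

Definition matrix_entry i j : nat :=
  if i < m then if j < n then scaled (2 + 2 * (i * n + j)) else 0 else 0.

Definition capacity i : nat := if i < m then scaled (offset_b + 2 * i) else 0.

Definition cost j : nat := if j < n then scaled (offset_c + 2 * j) else 0.

(* An infinite bound is replaced by [2 ^ N], which exceeds the value of the variable in
   any feasible solution in which its column is not null. *)
Definition bound j : nat :=
  if j < n then
    if cell (offset_d + 2 * j) != 0 then cell (offset_d + 2 * j + 1) else 2 ^ N
  else 0.

Lemma le_cap c x : x <= 2 ^ (c * N) -> c <= 100 -> x <= 2 ^ q.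
Proof.
move=> x_le c_le; apply: leq_trans x_le _; rewrite leq_exp2l //.
apply: leq_trans (_ : N ^ 2 <= q); last by rewrite leq_pexp2l // (leq_trans _ (in_N_ge100 _)).
by rewrite expnS expn1 leq_mul2r (leq_trans c_le (in_N_ge100 _)) orbT.
Qed.

Lemma in_N_lt_q : N < q.
Proof. by rewrite -[ltnLHS]expn1 ltn_exp2l // (leq_trans _ (in_N_ge100 _)). Qed.

Lemma mul_le_pow c d x y : x <= 2 ^ (c * N) -> y <= 2 ^ (d * N) -> x * y <= 2 ^ ((c + d) * N).
Proof. by move=> x_le y_le; rewrite mulnDl expnD leq_mul. Qed.

Lemma cell_le o : cell o <= 2 ^ (1 * N).
Proof. by rewrite mul1n ltnW ?input_lt. Qed.

Lemma cell_out o : L <= o -> cell o = 0.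
Proof. exact: nth_default. Qed.

Lemma denominator_gt0 : 0 < denominator.
Proof. by apply: prodn_gt0 => o; case: ifP => //; rewrite lt0n. Qed.

Lemma denominator_le : denominator <= 2 ^ (1 * N).
Proof.
rewrite mul1n; apply: leq_trans (ltnW (input_prod_lt input)).
rewrite /denominator (@big_cat_nat _ _ _ L) //=; last first.
  exact: leq_trans (in_L_le_N input) (in_N_le_q input).
rewrite [X in _ * X]big_nat [X in _ * X]big1 ?muln1 => [|o /andP[o_ge _]].
  by apply: leq_prod => o _; rewrite /cell; case: ifP => //; lia.
by rewrite cell_out.
Qed.

Lemma dvd_denominator o : cell o != 0 -> cell o %| denominator.
Proof.
move=> o_neq0; rewrite /denominator (bigD1_seq o) ?iota_uniq ?mem_index_iota //=.
  by rewrite o_neq0 dvdn_mulr.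
apply: leq_trans (leq_trans (in_L_le_N input) (in_N_le_q input)).
by rewrite ltnNge; apply: contra o_neq0 => /cell_out ->.
Qed.

Lemma scaled_le o : scaled o <= 2 ^ (2 * N).
Proof.
by apply: (@mul_le_pow 1 1) (cell_le o) (leq_trans (leq_div _ _) denominator_le).
Qed.

Lemma matrix_entry_le i j : matrix_entry i j <= 2 ^ (2 * N).
Proof. by rewrite /matrix_entry; do 2!case: ifP => // _; apply: scaled_le. Qed.

Lemma capacity_le i : capacity i <= 2 ^ (2 * N).
Proof. by rewrite /capacity; case: ifP => // _; apply: scaled_le. Qed.

Lemma cost_le j : cost j <= 2 ^ (2 * N).
Proof. by rewrite /cost; case: ifP => // _; apply: scaled_le. Qed.

Lemma bound_le j : bound j <= 2 ^ (1 * N).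
Proof.
by rewrite /bound; case: ifP => // _; case: ifP => _; rewrite ?cell_le // mul1n.
Qed.

Variable s : env.
Hypotheses (s0 : s 0 = q) (s1 : s 1 = 2 ^ q) (s2 : s 2 = N) (s3 : s 3 = m) (s4 : s 4 = n).

Definition input_at A : Prop := A 0 = cell.

Lemma cell_clamp o : cell (minn o L) = cell o.
Proof. by case: (leqP o L) => // L_lt; rewrite !cell_out // ltnW. Qed.

Lemma evalP_pow A k : k < q -> evalP L pow_prog s A POW k = 2 ^ k.
Proof.
move=> k_lt; rewrite /pow_prog evalP_tab ?s0 //= /upd /= s0 s1.
rewrite (_ : \prod_(0 <= i < q) _ = 2 ^ k); first by rewrite (minn_idPl _) // leq_exp2l // ltnW.
rewrite (@big_cat_nat _ _ _ k) ?(ltnW k_lt) //= [X in _ * X]big_nat [X in _ * X]big1.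
  rewrite muln1 big_nat (eq_bigr (fun=> 2)) => [|i /andP[_ i_lt]].
    by rewrite -big_nat prod_nat_const_nat subn0.
  by rewrite lt_testE i_lt.
by move=> i /andP[k_le _]; rewrite lt_testE ltnNge k_le.
Qed.

Lemma evalP_denominator A : input_at A -> evalP L denominator_prog s A DE 0 = denominator.
Proof.
move=> A_input; rewrite /denominator_prog /= updm_eq s0 s1 A_input /clamp /= /upd /=.
under eq_bigr => o _ do rewrite cell_clamp.
exact/minn_idPl/(le_cap denominator_le).
Qed.

Lemma evalE_scaled A o s' : input_at A -> A DE 0 = denominator ->
  evalE L s' A (scaled_expr o) = scaled (evalE L s' A o).
Proof.
by move=> A_input A_de; rewrite /scaled_expr /= /clamp /= A_input A_de !cell_clamp.
Qed.

Lemma evalE_if_lt A s' (a b e f : expr) : evalE L s' A (Ite (a < b)%X e f) =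
  if evalE L s' A a < evalE L s' A b then evalE L s' A e else evalE L s' A f.
Proof. by rewrite /= lt_testE eqb0 negbK. Qed.

Lemma evalP_matrix A i j : input_at A -> A DE 0 = denominator -> i < q -> j < q ->
  evalP L matrix_prog s A AA (i * q + j) = matrix_entry i j.
Proof.
move=> A_input A_de i_lt j_lt; rewrite /matrix_prog (evalP_tab2 _ _ s0) // s1.
rewrite !evalE_if_lt evalE_scaled // -[RHS](minn_idPl (le_cap (matrix_entry_le i j) isT)).
by rewrite /= /upd /= s3 s4.
Qed.

Lemma evalP_capacities A i : input_at A -> A DE 0 = denominator -> i < q ->
  evalP L capacities_prog s A BB i = capacity i.
Proof.
move=> A_input A_de i_lt; rewrite /capacities_prog evalP_tab ?s0 // s1.
rewrite evalE_if_lt evalE_scaled // -[RHS](minn_idPl (le_cap (capacity_le i) isT)).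
by rewrite /= /upd /= s3 s4.
Qed.

Lemma evalP_costs A j : input_at A -> A DE 0 = denominator -> j < q ->
  evalP L costs_prog s A CC j = cost j.
Proof.
move=> A_input A_de j_lt; rewrite /costs_prog evalP_tab ?s0 // s1.
rewrite evalE_if_lt evalE_scaled // -[RHS](minn_idPl (le_cap (cost_le j) isT)).
by rewrite /= /upd /= s3 s4.
Qed.

Lemma evalP_bounds A j : input_at A -> A POW N = 2 ^ N -> j < q ->
  evalP L bounds_prog s A UU j = bound j.
Proof.
move=> A_input A_pow j_lt; rewrite /bounds_prog evalP_tab ?s0 // s1.
rewrite evalE_if_lt -[RHS](minn_idPl (le_cap (bound_le j) isT)).
by rewrite /= /clamp /= /upd /= s2 s3 s4 A_input A_pow !cell_clamp.
Qed.

Record data_tables A : Prop := DataTables {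
  data_pow : forall k, k < q -> A POW k = 2 ^ k;
  data_matrix : forall i j, i < q -> j < q -> A AA (i * q + j) = matrix_entry i j;
  data_capacity : forall i, i < q -> A BB i = capacity i;
  data_cost : forall j, j < q -> A CC j = cost j;
  data_bound : forall j, j < q -> A UU j = bound j
}.

Lemma evalP_data A : input_at A -> data_tables (evalP L data_prog s A).
Proof.
move=> A_input; set A1 := evalP L pow_prog s A; set A2 := evalP L denominator_prog s A1.
set A3 := evalP L matrix_prog s A2; set A4 := evalP L capacities_prog s A3.
set A5 := evalP L costs_prog s A4.
have -> : evalP L data_prog s A = evalP L bounds_prog s A5 by [].
have A1_input : input_at A1 by rewrite /input_at /A1 evalP_frame.
have A2_input : input_at A2 by rewrite /input_at /A2 evalP_frame.
have A3_input : input_at A3 by rewrite /input_at /A3 evalP_frame.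
have A4_input : input_at A4 by rewrite /input_at /A4 evalP_frame.
have A5_input : input_at A5 by rewrite /input_at /A5 evalP_frame.
have A2_de : A2 DE 0 = denominator by apply: evalP_denominator.
have A3_de : A3 DE 0 = denominator by rewrite /A3 evalP_frame.
have A4_de : A4 DE 0 = denominator by rewrite /A4 evalP_frame.
have A5_pow k : k < q -> A5 POW k = 2 ^ k.
  by move=> k_lt; rewrite /A5 /A4 /A3 /A2 !evalP_frame // /A1 evalP_pow.
split=> [k k_lt|i j i_lt j_lt|i i_lt|j j_lt|j j_lt]; last first.
- by apply: evalP_bounds; rewrite // A5_pow // in_N_lt_q.
- by rewrite evalP_frame //; apply: evalP_costs.
- by rewrite evalP_frame // /A5 evalP_frame //; apply: evalP_capacities.
- by rewrite evalP_frame // /A5 /A4 !evalP_frame //; apply: evalP_matrix.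
by rewrite evalP_frame // A5_pow.
Qed.

Definition part_expr (u p : expr) : expr := min_expr p (u - (p - 1))%X.

Definition parts_prog : prog :=
  tab vk MU (part_expr UU@[$vk %/ $2] POW@[$vk - $vk %/ $2 * $2]).

Definition sizes_prog : prog := tab2 vi vk SZ (MU@[$vk] * AA@[$vi, $vk %/ $2]).

Definition weights_prog : prog :=
  tab vk WW (Ite (Big BSum vi (BB@[$vi] < SZ@[$vi, $vk])) 0 (MU@[$vk] * CC@[$vk %/ $2])).

Definition items_prog : prog := PSeq parts_prog (PSeq sizes_prog weights_prog).

Definition size_of : 'I_q -> 'I_q -> nat := item_size N matrix_entry bound.

Definition weight_of : {ffun 'I_q -> nat} := item_weight q N matrix_entry capacity cost bound.

Lemma item_part_le k : item_part N bound k <= 2 ^ (1 * N).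
Proof. exact: leq_trans (part_le _ _) (bound_le _). Qed.

Lemma size_of_le (i k : 'I_q) : size_of i k <= 2 ^ (3 * N).
Proof. exact: mul_le_pow (item_part_le k) (matrix_entry_le _ _). Qed.

Lemma weight_of_le (k : 'I_q) : weight_of k <= 2 ^ (3 * N).
Proof.
by rewrite ffunE; case: ifP => // _; apply: mul_le_pow (item_part_le k) (cost_le _).
Qed.

Lemma evalP_parts A k : data_tables A -> k < q -> evalP L parts_prog s A MU k = item_part N bound k.
Proof.
move=> A_data k_lt; rewrite /parts_prog evalP_tab ?s0 // s1.
rewrite -[RHS](minn_idPl (le_cap (item_part_le k) isT)); congr minn.
rewrite evalE_if_lt /= /clamp /= /upd /= s2.
have -> : k - k %/ N * N = k %% N by rewrite {1}(divn_eq k N) addKn.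
rewrite (data_bound A_data) ?(leq_ltn_trans (leq_div _ _)) //.
by rewrite (data_pow A_data) ?(leq_ltn_trans (leq_mod _ _)).
Qed.

Lemma evalP_sizes A (i k : 'I_q) : data_tables A ->
    (forall k, k < q -> A MU k = item_part N bound k) ->
  evalP L sizes_prog s A SZ (i * q + k) = size_of i k.
Proof.
move=> A_data A_mu; rewrite /sizes_prog (evalP_tab2 _ _ s0) // s1.
rewrite -[RHS](minn_idPl (le_cap (size_of_le i k) isT)); congr minn.
rewrite /= /clamp /= /upd /= s0 s2 A_mu // (data_matrix A_data) //.
exact: leq_ltn_trans (leq_div _ _) (ltn_ord k).
Qed.

Lemma evalP_weights A : data_tables A -> (forall k, k < q -> A MU k = item_part N bound k) ->
    (forall i k : 'I_q, A SZ (i * q + k) = size_of i k) ->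
  weights weight_of (evalP L weights_prog s A).
Proof.
move=> A_data A_mu A_sz k; rewrite /weights_prog evalP_tab ?s0 // s1.
rewrite -[RHS](minn_idPl (le_cap (weight_of_le k) isT)); congr minn.
rewrite /= /clamp /= /upd /= s0 s2 A_mu // (data_cost A_data); last first.
  exact: leq_ltn_trans (leq_div _ _) (ltn_ord k).
rewrite ffunE -if_neg; congr (if _ then _ else _).
rewrite negbK big_mkord sum_nat_eq0; apply: eq_forallb => i /=.
by rewrite lt_testE A_sz (data_capacity A_data) // eqb0 -leqNgt.
Qed.

Lemma evalP_items A : data_tables A -> let A' := evalP L items_prog s A in
  [/\ forall k, k < q -> A' MU k = item_part N bound k,
      size_tables size_of (fun i : 'I_q => capacity i) A' & weights weight_of A'].
Proof.
move=> A_data; set A1 := evalP L parts_prog s A; set A2 := evalP L sizes_prog s A1.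
have -> : evalP L items_prog s A = evalP L weights_prog s A2 by [].
have A1_mu k : k < q -> A1 MU k = item_part N bound k by apply: evalP_parts.
have A1_data : data_tables A1 by case: A_data; split; rewrite /A1 evalP_frame.
have A2_data : data_tables A2 by case: A1_data; split; rewrite /A2 evalP_frame.
have A2_sz (i k : 'I_q) : A2 SZ (i * q + k) = size_of i k by apply: evalP_sizes.
have A2_mu k : k < q -> A2 MU k = item_part N bound k.
  by move=> k_lt; rewrite /A2 evalP_frame // A1_mu.
split; last exact: evalP_weights; first by move=> k k_lt; rewrite evalP_frame // A2_mu.
by split=> [i|i k]; rewrite evalP_frame // (data_capacity A2_data).
Qed.
End Data.

(** * The main program *)

Definition output_prog : prog :=
  tab vj 0 (Big BSum vk (Ite ($vk %/ $2 == $vj) (SEL@[$vk] * MU@[$vk]) 0)).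

Definition main_prog : prog :=
  PSeq data_prog (PSeq items_prog (PSeq tables_prog (PSeq run_prog output_prog))).

Section MainProgram.
Variable input : seq nat.
Local Notation L := (in_L input).
Local Notation N := (in_N input).
Local Notation q := (in_q input).
Local Notation m := (in_m input).
Local Notation n := (in_n input).
Local Notation sz := (@size_of input).
Local Notation b := (fun i : 'I_q => capacity input i).
Local Notation w := (weight_of input).
Hypothesis lengthE : L = 2 * (m * n + m + n + n + 1).
Hypothesis columns_sparse :
  forall j, #|[set i : 'I_q | matrix_entry input i j != 0]| <= 2.

Let N_gt0 : 0 < N. Proof. exact: leq_trans (in_N_ge100 _). Qed.

Lemma m_le_N : m <= N.
Proof. by have [m_lt _] := in_sizes_lt lengthE; rewrite (leq_trans (ltnW m_lt)) ?in_L_le_N. Qed.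

Lemma n_le_N : n <= N.
Proof. by have [_ n_lt] := in_sizes_lt lengthE; rewrite (leq_trans (ltnW n_lt)) ?in_L_le_N. Qed.

Lemma exp_le_q c d : 0 < c -> c + d <= 16 -> 100 ^ c * N ^ d <= q.
Proof.
move=> c_gt0 cd_le; apply: leq_trans (_ : N ^ (c + d) <= q); last by rewrite leq_pexp2l.
by rewrite expnD leq_mul2r leq_exp2r ?in_N_ge100 ?orbT.
Qed.

Lemma nN_le_q : n * N <= q.
Proof.
apply: (@leq_trans (N ^ 2)); last by rewrite leq_pexp2l.
by rewrite expnS expn1 leq_mul2r n_le_N orbT.
Qed.

Lemma rounds_suffice : 200 * (N * N) ^ 4 * (N + N * N + 1) ^ 3 <= q.
Proof.
apply: (@leq_trans (200 * N ^ 8 * (2 * N ^ 2) ^ 3)).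
  rewrite mulnn -expnM leq_mul2l leq_exp2r //; apply/orP; right.
  by have := in_N_ge100 input; move: (N) => x; rewrite expnS expn1; nia.
rewrite expnMn -expnM mulnACA -expnD.
apply: leq_trans (exp_le_q (isT : 0 < 2) (isT : 2 + 14 <= 16)).
by rewrite leq_mul2r; apply/orP; right.
Qed.

Lemma in_q_le_pow : q <= 2 ^ (16 * N).
Proof. by rewrite mulnC expnM leq_exp2r // ltnW // ltn_expl. Qed.

Lemma four_q_le_pow : 4 * q <= 2 ^ (17 * N).
Proof.
apply: (mul_le_pow (c := 1) _ in_q_le_pow); rewrite mul1n (@leq_exp2l 2 2) //.
exact: leq_trans (in_N_ge100 _).
Qed.

Lemma greedy_cap : 4 * q * (q * (q * (4 * q))) <= 2 ^ q.
Proof.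
apply: (le_cap (c := 17 + (16 + (16 + 17)))) => //.
by rewrite !mul_le_pow ?four_q_le_pow ?in_q_le_pow.
Qed.

Lemma weight_cap : 2 ^ (3 * N) * (2 ^ (16 * N)) ^ (N * N) * 2 ^ (16 * N) <= 2 ^ q.
Proof.
rewrite -expnM -!expnD leq_exp2l //.
apply: leq_trans (exp_le_q (isT : 0 < 2) (isT : 2 + 3 <= 16)).
by rewrite !expnS expn0 !muln1; have := in_N_ge100 input; move: (N) => x; nia.
Qed.

Lemma active_lt (k : 'I_q) : k \in active w -> k %/ N < n.
Proof.
rewrite inE ffunE; case: ifP => // _; apply: contraR => k_out.
by rewrite /cost (negbTE k_out) muln0.
Qed.

Lemma active_item_fits (k : 'I_q) : k \in active w -> fits sz b k.
Proof. by rewrite inE ffunE; case: ifP => // /forallP. Qed.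

Lemma item_rows_sparse (k : 'I_q) : #|rows sz k| <= 2.
Proof.
apply: leq_trans (columns_sparse (k %/ N)); apply: subset_leq_card; apply/subsetP => i.
by rewrite !inE muln_eq0 negb_or => /andP[].
Qed.

Lemma size_of_out (i k : 'I_q) : N <= i -> sz i k = 0.
Proof.
by move=> N_le; rewrite /size_of /item_size /matrix_entry ltnNge (leq_trans m_le_N N_le) muln0.
Qed.

Lemma active_item_lt (k : 'I_q) : k \in active w -> k < N * N.
Proof. by move/active_lt => k_lt; rewrite -ltn_divLR // (leq_trans k_lt n_le_N). Qed.

Lemma item_slack_prod_le (e : 'I_q) : slack_prod sz b e <= 2 ^ (16 * N).
Proof.
apply: (@leq_trans (\prod_(i in rows sz e) 2 ^ (2 * N))).
  apply: leq_prod => i _; rewrite geq_max expn_gt0 /=.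
  exact: leq_trans (leq_subr _ _) (capacity_le _ _).
rewrite prod_nat_const -expnM leq_exp2l //.
by have := item_rows_sparse e; move: #|_| => r; nia.
Qed.

Lemma evalP_selection : exists S,
  let A' := evalP L (PSeq data_prog (PSeq items_prog (PSeq tables_prog run_prog)))
              (env0 input) (mem0 input) in
  [/\ solved sz b (3 : rat)%R (loss rat N) w S, selects S A' &
      forall k, k < q -> A' MU k = item_part N (bound input) k].
Proof.
set s := env0 input; set A1 := evalP L data_prog s (mem0 input).
set A2 := evalP L items_prog s A1; set A3 := evalP L tables_prog s A2.
have A1_data : data_tables input A1 by apply: evalP_data.
have [A2_mu A2_sz A2_w] := evalP_items (s := s) erefl erefl erefl A1_data.
have b_cap (i : 'I_q) : b i < 2 ^ q.
  apply: leq_ltn_trans (capacity_le _ _) _; rewrite ltn_exp2l //.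
  by have := exp_le_q (isT : 0 < 1) (isT : 1 + 1 <= 16); have := N_gt0; lia.
have P_cap : 2 * 2 ^ (16 * N) <= 2 ^ q.
  by apply: (le_cap (c := 17)) => //; rewrite -expnS leq_exp2l //; have := N_gt0; lia.
have [A3_charge A3_lp] := evalP_tables L (s := s) active_item_fits (fun k _ => item_rows_sparse k)
  (fun e _ => item_slack_prod_le e) erefl erefl b_cap P_cap
  (le_cap four_q_le_pow (isT : 17 <= 100)) A2_sz.
have A3_sz : size_tables sz b A3 by rewrite /size_tables /A3 !evalP_frame.
have A3_w : weights w A3 by move=> k; rewrite /A3 evalP_frame.
have [S [S_solved S_sel]] := @evalP_run rat L q (2 ^ q) N sz b (active w) active_item_fits
  (fun k _ => item_rows_sparse k) (fun i k _ => @size_of_out i k) active_item_lt N_gt0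
  rounds_suffice greedy_cap _ (fun e _ => item_slack_prod_le e) in_q_le_pow w (2 ^ (3 * N))
  (subxx _) (@weight_of_le input) weight_cap s A3 (And3 erefl erefl erefl) A3_charge A3_lp
  A3_sz A3_w.
exists S; split=> // k k_lt.
have -> : evalP L (PSeq data_prog (PSeq items_prog (PSeq tables_prog run_prog))) s
  (mem0 input) = evalP L run_prog s A3 by [].
by rewrite evalP_frame // /A3 evalP_frame // /A2 A2_mu.
Qed.

Definition program_output (j : nat) : nat := evalP L main_prog (env0 input) (mem0 input) 0 j.

Lemma main_prog_copies : exists2 S : {set 'I_q},
  solved sz b (3 : rat)%R (loss rat N) w S &
  forall j, j < n -> program_output j = copies N (bound input) S j.
Proof.
have [S [S_solved A_sel A_mu]] := evalP_selection; exists S => // j j_lt.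
set A := evalP L (PSeq _ _) (env0 input) (mem0 input) in A_sel A_mu.
have -> : program_output j = evalP L output_prog (env0 input) A 0 j by [].
have [_ n_lt] := in_sizes_lt lengthE.
have j_lt_q : j < q by apply: leq_trans j_lt (leq_trans n_le_N (in_N_le_q _)).
have copies_cap : copies N (bound input) S j <= 2 ^ q.
  apply: (le_cap (c := 1)) => //; apply: leq_trans (bound_le input j).
  exact: copies_le _ N_gt0 nN_le_q _ _ j_lt.
rewrite evalP_tab //=; last by move=> _; apply: ltn_trans n_lt.
rewrite -[RHS](minn_idPl copies_cap); congr minn.
rewrite /upd /= big_mkord /copies [RHS]big_mkcond; apply: eq_bigr => k _.
rewrite eq_testE /clamp /= A_sel A_mu // eqb0 negbK.
by case: (k \in S); case: (_ == j); rewrite ?mul1n.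
Qed.

Lemma main_prog_approx :
  [/\ forall j, j < n -> program_output j <= bound input j,
      within q n (matrix_entry input) (capacity input) program_output &
      forall y, within q n (matrix_entry input) (capacity input) y ->
        (forall j, j < n -> y j <= minn (bound input j) (2 ^ N - 1)) ->
      4 * \sum_(0 <= j < n) cost input j * y j <=
        15 * \sum_(0 <= j < n) cost input j * program_output j].
Proof.
have [S S_solved outputE] := main_prog_copies.
have matrix_out i j : n <= j -> matrix_entry input i j = 0.
  by rewrite /matrix_entry [j < n]ltnNge => ->; case: ifP.
have cost_out j : n <= j -> cost input j = 0 by rewrite /cost ltnNge => ->.
have sumE (g : nat -> nat) : \sum_(0 <= j < n) g j * program_output j =
    \sum_(0 <= j < n) g j * copies N (bound input) S j.
  by rewrite big_nat [RHS]big_nat; apply: eq_bigr => j /andP[_ /outputE ->].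
split=> [j j_lt|i i_lt|y y_within y_le].
- by rewrite outputE // (copies_le _ N_gt0 nN_le_q).
- by rewrite sumE; apply: (copies_within matrix_out S_solved).
rewrite sumE; apply: (copies_approx N_gt0 nN_le_q matrix_out cost_out _ S_solved y_within y_le).
apply: leq_trans (card_ord_lt q (N * N)); apply: subset_leq_card; apply/subsetP => k.
by move/active_item_lt; rewrite inE.
Qed.
End MainProgram.

(** * Encoded programs *)

Lemma nth_flatten_uniform (T : Type) (x0 : T) c (ss : seq (seq T)) i t :
    all (fun r => size r == c) ss -> t < c ->
  nth x0 (flatten ss) (i * c + t) = nth x0 (nth [::] ss i) t.
Proof.
move=> ss_c t_lt; elim: ss i ss_c => [|r ss IH] i /=; first by rewrite !nth_nil.
case/andP=> /eqP r_c /IH{}IH; rewrite nth_cat r_c; case: i => [|i]; first by rewrite mul0n t_lt.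
by rewrite mulSn -addnA ltnNge leq_addr /= addKn IH.
Qed.

Lemma size_flatten_uniform (T : Type) c (ss : seq (seq T)) :
  all (fun r => size r == c) ss -> size (flatten ss) = size ss * c.
Proof. by elim: ss => //= r ss IH /andP[/eqP r_c /IH]; rewrite size_cat r_c mulSn => ->. Qed.

Lemma flat_index_lt r c i j : i < r -> j < c -> i * c + j < r * c.
Proof.
move=> i_lt j_lt; apply: (@leq_trans (i.+1 * c)); first by rewrite mulSnr ltn_add2l.
by rewrite leq_mul2r i_lt orbT.
Qed.

Lemma absz_natr (z : int) : (0 <= z -> (`|z|%N)%:R = z%:~R :> rat)%R.
Proof. by move=> z_ge0; rewrite [LHS]pmulrn; congr (_%:~R)%R; rewrite gez0_abs. Qed.

Lemma scaled_rat input o (r : rat) : (0 <= r)%R ->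
    cell input o = `|numq r|%N -> cell input (o + 1) = `|denq r|%N ->
  ((scaled input o)%:R = (denominator input)%:R * r :> rat)%R.
Proof.
move=> r_ge0 num_o den_o; rewrite /scaled num_o den_o.
have den_dvd : `|denq r|%N %| denominator input.
  by rewrite -den_o dvd_denominator // den_o absz_eq0 denq_eq0.
rewrite -[in RHS](divnK den_dvd) !natrM !absz_natr ?denq_ge0 ?numq_ge0 // numqE.
by ring.
Qed.

Lemma le_num_mul_den (a b : rat) y : (0 < a -> 0 <= b -> y%:R * a <= b ->
  (y <= `|numq b| * `|denq a|)%N)%R.
Proof.
move=> a_gt0 b_ge0 ya_le; rewrite -(ler_nat rat) natrM !absz_natr ?denq_ge0 ?numq_ge0 //.
have den_ge1 (r : rat) : (1 <= (denq r)%:~R :> rat)%R by rewrite ler1z -gtz0_ge1 denq_gt0.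
have num_ge1 : (1 <= (numq a)%:~R :> rat)%R by rewrite ler1z -gtz0_ge1 numq_gt0.
have den_a_ge0 : (0 <= (denq a)%:~R :> rat)%R by rewrite ler0z denq_ge0.
apply: (@le_trans _ _ (y%:R * (numq a)%:~R)%R); first by rewrite ler_peMr.
rewrite (numqE a) mulrA; apply: ler_wpM2r => //; apply: le_trans ya_le _.
by rewrite numqE ler_peMr.
Qed.

Lemma cell_mul_lt input o o' : o < in_L input -> o' < in_L input -> o != o' ->
  cell input o * cell input o' < 2 ^ in_N input.
Proof.
move=> o_lt o'_lt oo'; apply: leq_ltn_trans (input_prod_lt input).
rewrite /input_prod big_mkord (bigD1 (Ordinal o_lt)) //= (bigD1 (Ordinal o'_lt)) /=; last first.
  by rewrite -val_eqE /= eq_sym.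
rewrite mulnA; apply: leq_trans (leq_pmulr _ _); first by rewrite leq_mul ?leq_addr.
by apply: prodn_gt0 => i; rewrite addn1.
Qed.

Section Encoding.
Variables (m n : nat) (P : pip m n).
Implicit Types (i : 'I_m) (j : 'I_n) (x : 'cV[int]_n) (y : nat -> nat).

Local Notation e := (encode P).
Local Notation N := (in_N e).
Local Notation q := (in_q e).
Local Notation D := ((denominator e)%:R : rat)%R.

Let A_code := [seq encode_rat (pip_A P i j) | i <- enum 'I_m, j <- enum 'I_n].
Let b_code := [seq encode_rat (pip_b P i 0%R) | i <- enum 'I_m].
Let c_code := [seq encode_rat (pip_c P 0%R j) | j <- enum 'I_n].
Let d_code := [seq encode_bound (pip_d P j) | j <- enum 'I_n].

Let A_code_size : all (fun r => size r == 2) A_code.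
Proof. by apply/allP => r /allpairsP[[i j] [_ _ ->]]. Qed.

Let b_code_size : all (fun r => size r == 2) b_code.
Proof. by apply/allP => r /mapP[i _ ->]. Qed.

Let c_code_size : all (fun r => size r == 2) c_code.
Proof. by apply/allP => r /mapP[j _ ->]. Qed.

Let d_code_size : all (fun r => size r == 2) d_code.
Proof. by apply/allP => r /mapP[j _ ->]; case: (pip_d P j). Qed.

Let size_A_code : size (flatten A_code) = m * n * 2.
Proof. by rewrite (size_flatten_uniform A_code_size) size_allpairs !size_enum_ord. Qed.

Let size_b_code : size (flatten b_code) = m * 2.
Proof. by rewrite (size_flatten_uniform b_code_size) size_map size_enum_ord. Qed.

Let size_c_code : size (flatten c_code) = n * 2.
Proof. by rewrite (size_flatten_uniform c_code_size) size_map size_enum_ord. Qed.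

Let size_d_code : size (flatten d_code) = n * 2.
Proof. by rewrite (size_flatten_uniform d_code_size) size_map size_enum_ord. Qed.

Let encodeE : e = [:: m, n & flatten A_code ++ flatten b_code ++ flatten c_code ++ flatten d_code].
Proof. by []. Qed.

Lemma size_encode : in_L e = 2 * (in_m e * in_n e + in_m e + in_n e + in_n e + 1).
Proof.
rewrite /in_L encodeE /= !size_cat size_A_code size_b_code size_c_code size_d_code.
by rewrite /in_m /in_n /=; lia.
Qed.

Lemma encode_A i j t : t < 2 ->
  cell e (2 + 2 * (i * n + j) + t) = nth 0 (encode_rat (pip_A P i j)) t.
Proof.
move=> t_lt; rewrite /cell encodeE [LHS]/= nth_cat size_A_code.
have ij_lt := flat_index_lt (ltn_ord i) (ltn_ord j).
rewrite ifT; last by move: ij_lt; clear -t_lt; lia.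
rewrite mulnC (nth_flatten_uniform _ _ A_code_size) //; congr nth.
rewrite /A_code nth_flatten_uniform //; last first.
  by apply/allP => r /mapP[k _ ->]; rewrite size_map size_enum_ord.
rewrite (nth_map i) ?size_enum_ord // (nth_map j) ?size_enum_ord //.
by rewrite !nth_ord_enum.
Qed.

Lemma encode_b i t : t < 2 ->
  cell e (offset_b e + 2 * i + t) = nth 0 (encode_rat (pip_b P i 0%R)) t.
Proof.
move=> t_lt; have i_lt := ltn_ord i; rewrite /cell (_ : _ + t = (m * n * 2 + (i * 2 + t)).+2).
  rewrite encodeE [LHS]/= nth_cat size_A_code ltnNge leq_addr addKn nth_cat size_b_code ifT.
    by rewrite (nth_flatten_uniform _ _ b_code_size) // (nth_map i) ?size_enum_ord // nth_ord_enum.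
  by lia.
by rewrite /offset_b; change (in_m e) with m; change (in_n e) with n; lia.
Qed.

Lemma encode_c j t : t < 2 ->
  cell e (offset_c e + 2 * j + t) = nth 0 (encode_rat (pip_c P 0%R j)) t.
Proof.
move=> t_lt; have j_lt := ltn_ord j.
rewrite /cell (_ : _ + t = (m * n * 2 + (m * 2 + (j * 2 + t))).+2).
  rewrite encodeE [LHS]/= nth_cat size_A_code ltnNge leq_addr addKn nth_cat size_b_code.
  rewrite ltnNge leq_addr addKn nth_cat size_c_code ifT; last by lia.
  by rewrite (nth_flatten_uniform _ _ c_code_size) // (nth_map j) ?size_enum_ord // nth_ord_enum.
by rewrite /offset_c /offset_b; change (in_m e) with m; change (in_n e) with n; lia.
Qed.

Lemma encode_d j t : t < 2 ->
  cell e (offset_d e + 2 * j + t) = nth 0 (encode_bound (pip_d P j)) t.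
Proof.
move=> t_lt; have j_lt := ltn_ord j.
rewrite /cell (_ : _ + t = (m * n * 2 + (m * 2 + (n * 2 + (j * 2 + t)))).+2).
  rewrite encodeE [LHS]/= nth_cat size_A_code ltnNge leq_addr addKn nth_cat size_b_code.
  rewrite ltnNge leq_addr addKn nth_cat size_c_code ltnNge leq_addr addKn.
  by rewrite (nth_flatten_uniform _ _ d_code_size) // (nth_map j) ?size_enum_ord // nth_ord_enum.
by rewrite /offset_d /offset_c /offset_b; change (in_m e) with m; change (in_n e) with n; lia.
Qed.

Lemma matrix_entryE i j : ((matrix_entry e i j)%:R = D * pip_A P i j)%R.
Proof.
rewrite /matrix_entry !ltn_ord; apply: scaled_rat (pip_A_ge0 P i j) _ _.
  by rewrite -[_ + 2 * _]addn0 encode_A.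
by rewrite encode_A.
Qed.

Lemma capacityE i : ((capacity e i)%:R = D * pip_b P i 0)%R.
Proof.
rewrite /capacity ltn_ord; apply: scaled_rat (pip_b_ge0 P i) _ _.
  by rewrite -[_ + 2 * _]addn0 encode_b.
by rewrite encode_b.
Qed.

Lemma costE j : ((cost e j)%:R = D * pip_c P 0 j)%R.
Proof.
rewrite /cost ltn_ord; apply: scaled_rat (pip_c_ge0 P j) _ _.
  by rewrite -[_ + 2 * _]addn0 encode_c.
by rewrite encode_c.
Qed.

Lemma boundE j : bound e j = if pip_d P j is Some u then u else 2 ^ N.
Proof.
rewrite /bound ltn_ord -{1}[_ + 2 * j]addn0 !encode_d //.
by case: (pip_d P j).
Qed.

Let D_gt0 : (0 < D)%R. Proof. by rewrite ltr0n denominator_gt0. Qed.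

Lemma m_le_in_q : m <= q.
Proof. exact: leq_trans (m_le_N size_encode) (in_N_le_q _). Qed.

Lemma matrix_entry_sparse k : two_column_sparse P ->
  #|[set i : 'I_q | matrix_entry e i k != 0]| <= 2.
Proof.
move=> sparse; have [k_lt|k_ge] := ltnP k n; last first.
  rewrite (_ : [set _ | _] = set0) ?cards0 //; apply/setP => i.
  by rewrite !inE /matrix_entry [k < n]ltnNge k_ge; case: ifP.
apply: leq_trans (sparse (Ordinal k_lt)).
apply: leq_trans (leq_imset_card (widen_ord m_le_in_q) _); apply: subset_leq_card.
apply/subsetP => i; rewrite inE => entry_neq0.
have i_lt : i < m by move: entry_neq0; rewrite /matrix_entry; case: (i < m).
apply/imsetP; exists (Ordinal i_lt); last exact: val_inj.
rewrite inE; apply: contra entry_neq0 => /eqP A_eq0.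
by rewrite -(eqr_nat rat) (matrix_entryE (Ordinal i_lt) (Ordinal k_lt)) A_eq0 mulr0.
Qed.

Definition vec y : 'cV[int]_n := (\col_j (y j)%:Z)%R.

Definition coords x (k : nat) : nat := oapp (fun j => `|x j 0%R|%N) 0 (insub k).

Lemma coordsK x : (forall j, 0 <= x j 0)%R -> vec (coords x) = x.
Proof.
by move=> x_ge0; apply/matrixP => j k; rewrite ord1 mxE /coords valK /= gez0_abs.
Qed.

Lemma scaled_load y i : (D * (pip_A P *m map_mx intr (vec y)) i 0 =
  (\sum_(0 <= k < n) matrix_entry e i k * y k)%N%:R)%R.
Proof.
rewrite mxE mulr_sumr big_mkord natr_sum; apply: eq_bigr => j _.
by rewrite !mxE natrM matrix_entryE mulrA.
Qed.

Lemma scaled_objective y :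
  (D * objective P (vec y) = (\sum_(0 <= k < n) cost e k * y k)%N%:R)%R.
Proof.
rewrite /objective mxE mulr_sumr big_mkord natr_sum; apply: eq_bigr => j _.
by rewrite !mxE natrM costE mulrA.
Qed.

Lemma feasible_vec y : feasible P (vec y) <->
  within q n (matrix_entry e) (capacity e) y /\ forall j u, pip_d P j = Some u -> y j <= u.
Proof.
have loadE i : ((pip_A P *m map_mx intr (vec y)) i 0 <= pip_b P i 0)%R =
    (\sum_(0 <= k < n) matrix_entry e i k * y k <= capacity e i).
  by rewrite -(ler_pM2l D_gt0) scaled_load -capacityE ler_nat.
split=> [[y_load _ y_bound]|[y_within y_bound]]; split.
- move=> k _; have [k_lt|k_ge] := ltnP k m; first by rewrite -(loadE (Ordinal k_lt)).
  by rewrite big1 // => k' _; rewrite /matrix_entry ltnNge k_ge.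
- by move=> j u /y_bound; rewrite mxE lez_nat.
- by move=> i; rewrite loadE y_within // (leq_trans (ltn_ord i) m_le_in_q).
- by move=> j; rewrite mxE.
by move=> j u /y_bound; rewrite mxE lez_nat.
Qed.

Lemma feasible_coord_lt x i j : feasible P x -> pip_A P i j != 0%R -> `|x j 0%R|%N < 2 ^ N.
Proof.
move=> [x_load x_ge0 _] A_neq0; have A_gt0 : (0 < pip_A P i j)%R by rewrite lt0r A_neq0 pip_A_ge0.
have num_b : cell e (offset_b e + 2 * i) = `|numq (pip_b P i 0%R)|%N.
  by rewrite -[_ + 2 * i]addn0 encode_b.
have den_A : cell e (2 + 2 * (i * n + j) + 1) = `|denq (pip_A P i j)|%N by rewrite encode_A.
have ij_lt := flat_index_lt (ltn_ord i) (ltn_ord j); have i_lt := ltn_ord i.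
have in_e o : o < 2 * (m * n + m + n + n + 1) -> o < in_L e by rewrite size_encode.
apply: leq_ltn_trans (cell_mul_lt (o := offset_b e + 2 * i) (o' := 2 + 2 * (i * n + j) + 1) _ _ _).
- rewrite num_b den_A; apply: le_num_mul_den A_gt0 (pip_b_ge0 P i) _.
  apply: le_trans (x_load i); rewrite mxE (bigD1 j) //= mxE absz_natr // mulrC lerDl.
  by apply: sumr_ge0 => k _; rewrite mulr_ge0 ?pip_A_ge0 // mxE ler0z.
- by apply: in_e; rewrite /offset_b; change (in_m e) with m; change (in_n e) with n; lia.
- by apply: in_e; lia.
by rewrite /offset_b; change (in_m e) with m; change (in_n e) with n; apply/eqP; lia.
Qed.

Lemma optimal_column x j : optimal P x -> pip_d P j = None -> pip_c P 0%R j != 0%R ->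
  exists i, pip_A P i j != 0%R.
Proof.
move=> [[x_load x_ge0 x_bound] x_opt] d_j c_neq0; apply/existsP; apply: contraT.
move/existsPn => column_eq0; pose x' := (x + delta_mx j 0)%R.
have mul_x' p (B : 'M[rat]_(p, n)) :
    (B *m map_mx intr x' = B *m map_mx intr x + col j B)%R.
  by rewrite map_mxD map_delta_mx mulmxDr -colE.
have : feasible P x'.
  split=> [i|k|k u d_k].
  - by rewrite mul_x' [leLHS]mxE [X in (_ + X)%R]mxE (eqP (negPn (column_eq0 i))) addr0.
  - by rewrite !mxE addr_ge0.
  by rewrite !mxE; case: eqP d_k => [->|_]; [rewrite d_j | rewrite addr0 => /x_bound].
move/x_opt; rewrite /objective mul_x' [leLHS]mxE gerDl mxE leNgt lt0r c_neq0.
by rewrite pip_c_ge0.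
Qed.

Lemma optimal_coord_le x j : optimal P x -> pip_c P 0%R j != 0%R ->
  `|x j 0%R|%N <= minn (bound e j) (2 ^ N - 1).
Proof.
move=> x_optimal c_neq0; have [x_feasible _] := x_optimal; have [_ x_ge0 x_bound] := x_feasible.
rewrite boundE; case d_j: (pip_d P j) => [u|].
  have x_le : `|x j 0%R|%N <= u by rewrite -lez_nat gez0_abs ?(x_bound j).
  by have := input_lt e (offset_d e + 2 * j + 1); rewrite -/(cell e _) encode_d // d_j /=; lia.
have [i A_neq0] := optimal_column x_optimal d_j c_neq0.
by have := feasible_coord_lt x_feasible A_neq0; lia.
Qed.

Hypothesis sparse : two_column_sparse P.

Let program_ok := main_prog_approx size_encode (fun k => matrix_entry_sparse k sparse).

Lemma program_feasible : feasible P (vec (program_output e)).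
Proof.
have [out_bound out_within _] := program_ok.
apply/feasible_vec; split=> // j u d_j.
by have := out_bound j (ltn_ord j); rewrite boundE d_j.
Qed.

Lemma program_approx x : optimal P x ->
  (4 * objective P x <= 15 * objective P (vec (program_output e)))%R.
Proof.
move=> x_optimal; have [_ _ approx] := program_ok.
have [x_feasible _] := x_optimal; have [_ x_ge0 _] := x_feasible.
rewrite -(coordsK x_ge0) in x_feasible *; have [x_within _] := (feasible_vec _).1 x_feasible.
pose y k := if cost e k == 0 then 0 else coords x k.
have y_value : \sum_(0 <= k < n) cost e k * y k = \sum_(0 <= k < n) cost e k * coords x k.
  by apply: eq_bigr => k _; rewrite /y; case: eqP => [->|].
rewrite -(ler_pM2l D_gt0) !(mulrCA D) !scaled_objective -!natrM ler_nat -y_value.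
apply: approx => [k k_lt|k k_lt].
  apply: leq_trans (x_within k k_lt); apply: leq_sum => k' _; rewrite leq_mul2l /y.
  by case: (cost e k' == 0); rewrite ?leqnn orbT.
rewrite /y; case: eqP => // /eqP cost_neq0; pose j := Ordinal k_lt.
rewrite (_ : coords x k = `|x j 0%R|%N); last by rewrite /coords insubT.
apply: (optimal_coord_le (j := j) x_optimal).
by apply: contra cost_neq0 => /eqP c_eq0; rewrite -(eqr_nat rat) (costE j) c_eq0 mulr0.
Qed.
End Encoding.

Lemma sparse_pip_approx : exists (prg : cmd) (T : {poly nat}), forall m n (P : pip m n),
    two_column_sparse P -> exists2 x : 'cV[int]_n,
  forall t, computes prg (encode P) t (T.[bitsize (encode P)])%R x &
  feasible P x /\ forall y, optimal P y -> (4 * objective P y <= 15 * objective P x)%R.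
Proof.
have [T machine_runs] := @machine_poly_time main_prog isT.
exists (machine main_prog), T => m n P sparse.
exists (vec n (program_output (encode P))); last first.
  by split=> [|y]; [apply: program_feasible | apply: program_approx].
move=> t; have [k [s [run_s k_le s_ram]]] := machine_runs (encode P) t (size_encode P).
exists k, s; split=> //; apply/matrixP => j l; rewrite !mxE s_ram //.
exact: ltnW (ltn_trans (ltn_ord j) (in_sizes_lt (size_encode P)).2).
Qed.

Local Open Scope ring_scope.

Lemma ratr_ratio (R : rcfType) (alpha : R) (a b : rat) : 15 / 4 <= alpha ->
  0 <= b -> 4 * a <= 15 * b -> alpha^-1 * ratr a <= ratr b.
Proof.
move=> alpha_ge b_ge0 ab; have alpha_gt0 : 0 < alpha by apply: lt_le_trans alpha_ge; lra.
rewrite mulrC ler_pdivrMr //; apply: le_trans (_ : ratr b * (15 / 4) <= _); last first.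
  by apply: ler_wpM2l => //; rewrite ler0q.
have : ratr (4 * a) <= ratr (15 * b) :> R by rewrite ler_rat.
by rewrite !rmorphM /= !ratr_nat; lra.
Qed.

Lemma objective_ge0 m n (P : pip m n) x : feasible P x -> 0 <= objective P x.
Proof.
case=> _ x_ge0 _; rewrite /objective mxE; apply: sumr_ge0 => j _.
by rewrite mulr_ge0 ?pip_c_ge0 // mxE ler0z.
Qed.

Lemma sqrt5_le (R : rcfType) : Num.sqrt 5 <= 9 / 4 :> R.
Proof.
rewrite -(@ler_pXn2r _ 2) ?nnegrE ?sqrtr_ge0 //; last by lra.
by rewrite sqr_sqrtr ?ler0n //; lra.
Qed.

Lemma mean_tapes_const (R : rcfType) T (v : R) : (2 ^+ T)^-1 * \sum_(t : T.-tuple bool) v = v.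
Proof.
rewrite sumr_const card_tuple card_bool -[X in _ * X]mulr_natl natrX mulKf //.
by rewrite expf_neq0 // pnatr_eq0.
Qed.

Theorem theorem5 (R : rcfType) :
  det_poly_approx (4 : R) (fun m n (P : pip m n) => two_column_sparse P) /\
  rand_poly_approx (6 - Num.sqrt 5 : R)
    (fun m n (P : pip m n) =>
       [/\ two_column_sparse P, simple_pip P & unit_multiplicity P]).
Proof.
have [prg [T approx]] := sparse_pip_approx; split; exists prg, T => m n P.
  move=> /approx[x x_computed [x_feasible x_ratio]]; exists x; split=> // y /x_ratio.
  by apply: ratr_ratio (objective_ge0 x_feasible); lra.
move=> [/approx[x x_computed [x_feasible x_ratio]] _ _] steps.
exists (fun=> x); split=> [t||y /x_ratio] //; first exact: x_computed.
rewrite mean_tapes_const.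
by apply: ratr_ratio (objective_ge0 x_feasible); have := sqrt5_le R; lra.
Qed.
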